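(* Fix an integer $k\ge 0$. For $u>0$ let $$I_k(u)=\int_{\substack{t_1,\ldots,t_k\ge 1\\ t_1+\cdots+t_k\le u}}\frac{dt_1}{t_1}\cdots\frac{dt_k}{t_k}$$ (with $I_0(u)=1$), and for $t>0$ let $L_k(t)=\frac{(-1)^k}{k!}I_k(1/t)$. For integers $j\ge 0$ let $$C_j=\frac{1}{j!}\,\frac{1}{2\pi i}\int_{c-i\infty}^{c+i\infty}\frac{e^s}{s}(\log s+\gamma)^j\,ds\qquad(c>0),$$ the integral being interpreted as $\lim_{T\to\infty}\int_{c-iT}^{c+iT}$, and set $D_j=(-1)^j j!\,C_j$. Then as $u\to\infty$, $$I_k(u)=\sum_{j=0}^{k}\binom{k}{j}D_j(\log u)^{k-j}+O\Big(\frac{(\log u)^k}{u}\Big),$$ and equivalently, as $t\to 0^+$, $$L_k(t)=\sum_{j=0}^{k}C_j\frac{(\log t)^{k-j}}{(k-j)!}+O\big(t\,|\log t|^k\big).$$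
   Context: $\gamma$ is the Euler–Mascheroni constant and $\log s$ is the principal branch of the logarithm on $\mathrm{Re}(s)>0$. The implied constants in the $O$-terms may depend on $k$. (Equivalently, $L_k$ is the ''Dickman polylogarithm'': $L_0\equiv1$, $L_k(t)=0$ for $t\ge 1/k$, and $L_k(t)=-\int_t^{1/k}L_{k-1}\big(\tfrac{x}{1-x}\big)\tfrac{dx}{x}$ for $0<t<1/k$.) By a separate result, $\sum_{j\ge0}C_jz^j=e^{\gamma z}/\Gamma(1-z)$. *)

(* Defs.v *)
From HB Require Import structures.
From mathcomp Require Import all_boot all_order all_algebra.
From mathcomp Require Import all_classical all_reals all_analysis.
From mathcomp Require Import complex.

Set Implicit Arguments.
Unset Strict Implicit.
Unset Printing Implicit Defensive.
Import Order.TTheory GRing.Theory Num.Theory.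
Import numFieldNormedType.Exports.

Local Open Scope classical_set_scope.
Local Open Scope ring_scope.
Local Open Scope complex_scope.

(* Lebesgue measure on R^n, carried by n-tuples: the n-fold product of          *)
(* lebesgue_measure, built by transporting lambda \x lambda^n along             *)
(* (x, t) |-> x :: t. For n = 0 it is the unit mass on the empty tuple.         *)
Section lebesgue_tuple.
Context {R : realType}.
Local Notation R_ := (measurableTypeR R).

Definition tuple_of_pair n (p : R_ * n.-tuple R_) : n.+1.-tuple R_ :=
  [tuple of p.1 :: p.2].

Lemma measurable_tuple_of_pair n : measurable_fun setT (@tuple_of_pair n).
Proof. exact: measurable_cons. Qed.

Section lebesgue_tupleS.
Variables (n : nat) (m : {sigma_finite_measure set (n.-tuple R_) -> \bar R}).

Definition lebesgue_tupleS : set (n.+1.-tuple R_) -> \bar R :=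
  pushforward (@lebesgue_measure R \x m)%E (@tuple_of_pair n).

HB.instance Definition _ := Measure.copy lebesgue_tupleS
  (measure_function_pushforward__canonical__measure_function_Measure
     (@lebesgue_measure R \x m)%E (@measurable_tuple_of_pair n)).

Let split_tuple (t : n.+1.-tuple R_) : R_ * n.-tuple R_ :=
  (thead t, [tuple of behead t]).

Let tuple_of_pairK : cancel (@tuple_of_pair n) split_tuple.
Proof. by move=> [x t]; congr pair; apply/val_inj. Qed.

Let measurable_split_tuple : measurable_fun setT split_tuple.
Proof.
apply: measurable_fun_pair; first exact: measurable_tnth.
exact: measurable_behead.
Qed.

Let sigma_finite_lebesgue_tupleS : sigma_finite setT lebesgue_tupleS.
Proof.
have /sigma_finiteP[F [FT ndF Foo]] := sigma_finiteT (@lebesgue_measure R).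
have /sigma_finiteP[G [GT ndG Goo]] := sigma_finiteT m.
exists (fun i => split_tuple @^-1` (F i `*` G i)).
  apply/seteqP; split => // t _.
  have [i _ Fi] : (\bigcup_i F i) (split_tuple t).1 by rewrite -FT.
  have [j _ Gj] : (\bigcup_i G i) (split_tuple t).2 by rewrite -GT.
  exists (maxn i j) => //; split.
    by move: Fi; exact/subsetPset/ndF/leq_maxl.
  by move: Gj; exact/subsetPset/ndG/leq_maxr.
move=> i; have [mF Fi] := Foo i; have [mG Gi] := Goo i; split.
  rewrite -[X in measurable X]setTI; apply: measurable_split_tuple => //.
  exact: measurableX.
rewrite /lebesgue_tupleS /pushforward -comp_preimage.
rewrite (_ : _ \o _ = idfun); last by apply/funext/tuple_of_pairK.
by rewrite preimage_id product_measure1E// lte_mul_pinfty// ge0_fin_numE.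
Qed.

HB.instance Definition _ := Measure_isSigmaFinite.Build _ _ _
  lebesgue_tupleS sigma_finite_lebesgue_tupleS.

End lebesgue_tupleS.

Fixpoint lebesgue_tuple n : {sigma_finite_measure set (n.-tuple R_) -> \bar R} :=
  if n is m.+1 then lebesgue_tupleS (lebesgue_tuple m) else \d_ [tuple].

End lebesgue_tuple.

Section dickman.
Context {R : realType}.

Definition dickman_domain k (u : R) : set (k.-tuple (measurableTypeR R)) :=
  [set t | (forall i, 1 <= tnth t i) /\ \sum_(i < k) tnth t i <= u].

(* The integrand is at most 1 on a bounded domain, so the integral is finite    *)
(* and taking its real value loses nothing.                                          *)
Definition dickmanI k (u : R) : R :=
  \int[lebesgue_tuple k]_(t in @dickman_domain k u)
    \prod_(i < k) (tnth t i)^-1.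

Lemma dickmanI0 (u : R) : 0 <= u -> dickmanI 0 u = 1.
Proof.
move=> u0; rewrite /dickmanI /Rintegral.
have -> : @dickman_domain 0 u = setT.
  by apply/seteqP; split => // t _; split=> [[]//|]; rewrite big_ord0.
under eq_integral do rewrite big_ord0.
by rewrite integral_cst// [X in (_ * X)%E]diracT mule1.
Qed.

Definition dickmanL k (t : R) : R := (-1) ^+ k / k`!%:R * dickmanI k t^-1.

Definition euler_gamma : R :=
  lim ((\sum_(1 <= i < n.+1) i%:R^-1 - ln n%:R) @[n --> \oo]).

Definition expc (z : R[i]) : R[i] :=
  expR (complex.Re z) * cos (complex.Im z) +i*
  (expR (complex.Re z) * sin (complex.Im z)).

(* Principal logarithm on the half-plane 0 < Re z only, where the principal     *)
(* argument is arctan (Im z / Re z).                                            *)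
Definition logc (z : R[i]) : R[i] :=
  ln (Num.sqrt (complex.Re z ^+ 2 + complex.Im z ^+ 2)) +i*
  atan (complex.Im z / complex.Re z).

Lemma expc_logc (z : R[i]) : 0 < complex.Re z -> expc (logc z) = z.
Proof.
case: z => x y /= x0; rewrite /expc /=.
have n0 : 0 < Num.sqrt (x ^+ 2 + y ^+ 2).
  by rewrite sqrtr_gt0 ltr_wpDr ?sqr_ge0 ?exprn_gt0.
have nE : Num.sqrt (x ^+ 2 + y ^+ 2) * cos (atan (y / x)) = x.
  have -> : x ^+ 2 + y ^+ 2 = x ^+ 2 * (1 + (y / x) ^+ 2).
    by rewrite mulrDr mulr1 -exprMn mulrCA divff ?mulr1 ?gt_eqF.
  rewrite sqrtrM ?sqr_ge0// sqrtr_sqr gtr0_norm// cos_atan mulfK//.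
  by rewrite gt_eqF// sqrtr_gt0 ltr_wpDr ?sqr_ge0.
have c0 : cos (atan (y / x)) != 0.
  by apply: contraTneq x0 => c0; rewrite -nE c0 mulr0 ltxx.
rewrite lnK ?posrE// nE; congr (_ +i* _).
have /(congr1 ( *%R^~ (cos (atan (y / x))))) := atanK (y / x).
rewrite /tan divfK// => ->.
by rewrite mulrCA nE divfK// gt_eqF.
Qed.

Definition cintegral (a b : R) (f : R -> R[i]) : R[i] :=
  (\int[lebesgue_measure]_(y in `[a, b]) complex.Re (f y)) +i*
  (\int[lebesgue_measure]_(y in `[a, b]) complex.Im (f y)).

(* The integral of f along the segment from c - iT to c + iT, parametrized by   *)
(* s = c + iy, ds = i dy.                                                       *)
Definition vertical_integral (f : R[i] -> R[i]) (c T : R) : R[i] :=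
  cintegral (- T) T (fun y => f (c +i* y) * (0 +i* 1)).

Definition C_integrand j (s : R[i]) : R[i] :=
  expc s / s * (logc s + euler_gamma%:C) ^+ j.

Definition C_truncated j (c T : R) : R[i]^o :=
  vertical_integral (C_integrand j) c T.

Definition C_coef j (c : R) : R[i] :=
  j`!%:R^-1 * (2 * pi%:C * (0 +i* 1))^-1 * lim (C_truncated j c T @[T --> +oo]).

Definition D_coef j (c : R) : R[i] := (-1) ^+ j * j`!%:R * C_coef j c.

End dickman.

(* Main.v *)
(* Let w(t) = 1/t on [1, +oo[ and E1(z) = int_1^oo e^{-zt} dt/t.  Since I_k is an
   iterated convolution with w, u I_k(u) = J_k(u) + k J_{k-1}(u - 1), where J_k
   is the iterated convolution of the ramp max(u, 0).  The ramp has the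
   absolutely convergent inversion formula
     int_(Re s = c) e^{sx} / s^2 dy = 2 pi max(x, 0),
   so Fubini and induction on k give
     2 pi J_k(x) / u = int_(Re s = c) e^{sx/u} E1(s/u)^k / s^2 dy
   and hence a formula for I_k(u).  There E1(s/u) = ln u - log s - gamma + O(|s|/u).
   Dropping the error term leaves exactly the polynomial in ln u with
   coefficients D_j, because one integration by parts turns the integral
   defining j! C_j into the integral of e^s (l^j - j l^{j-1}) / s^2 with
   l = log s + gamma.  The error is bounded by splitting at |Im s| = u. *)

Require Import Defs.
From HB Require Import structures.
From mathcomp Require Import all_boot all_order all_algebra.
From mathcomp Require Import all_classical all_reals all_analysis.
From mathcomp Require Import measurable_realfun complex.
From mathcomp Require Import ring lra.

Set Implicit Arguments.
Unset Strict Implicit.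
Unset Printing Implicit Defensive.
Import Order.TTheory GRing.Theory Num.Theory.
Import numFieldNormedType.Exports.

Local Open Scope classical_set_scope.
Local Open Scope ring_scope.
Local Open Scope complex_scope.

Local Notation Re := complex.Re.
Local Notation Im := complex.Im.
Local Notation cabs := ComplexField.Normc.normc.

(** * Complex numbers and componentwise derivatives *)

(** Why the ramp: the natural start of the induction, inversion of $1/s$ for the unit step,
    converges only conditionally, and so does the main term once $E_1$ is replaced by a logarithm.
    With $s^{-2}$ every integral over the line is absolutely convergent. The identity for $u I_k(u)$
    mirrors $-\frac{d}{ds}(E_1^k/s)$ with $E_1'(s) = -e^{-s}/s$. Neither Cauchy's theorem nor
    residues are used: everything along the line is calculus in a real parameter and Fubini. Why the
    error has the right order: for $|\mathrm{Im}\,s| \le u$ the replacement costs $O((\ln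
    u)^{k-1}|s|/u)$; after division by $s^2$ the integral of $1/|s|$ gives back the missing
    logarithm. As $\gamma$ is defined by harmonic sums, the constant in the expansion of $E_1$ at 0
    has to be identified separately, through $\int_0^n (1-(1-r/n)^n)\,dr/r = \sum_{i \le n} 1/i$. *)

Section complex_algebra.
Context {R : realType}.
Implicit Types (x y : R) (z w : R[i]).

Lemma complex_ext z w : Re z = Re w -> Im z = Im w -> z = w.
Proof. by case: z => a b; case: w => a' b' /= -> ->. Qed.

Lemma ReD z w : Re (z + w) = Re z + Re w.
Proof. by case: z; case: w. Qed.
Lemma ImD z w : Im (z + w) = Im z + Im w.
Proof. by case: z; case: w. Qed.
Lemma ReN z : Re (- z) = - Re z. Proof. by case: z. Qed.
Lemma ImN z : Im (- z) = - Im z. Proof. by case: z. Qed.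
Lemma ReM z w : Re (z * w) = Re z * Re w - Im z * Im w.
Proof. by case: z; case: w. Qed.
Lemma ImM z w : Im (z * w) = Re z * Im w + Im z * Re w.
Proof. by case: z; case: w. Qed.
Lemma ReV z : Re z^-1 = Re z / (Re z ^+ 2 + Im z ^+ 2).
Proof. by case: z. Qed.
Lemma ImV z : Im z^-1 = - Im z / (Re z ^+ 2 + Im z ^+ 2).
Proof. by case: z => a b /=; rewrite mulNr. Qed.

Definition reimE := (ReD, ImD, ReN, ImN, ReM, ImM, ReV, ImV).

Lemma normcE z : `|z| = (cabs z)%:C.
Proof. by case: z. Qed.

Lemma cabs_ge0 z : 0 <= cabs z.
Proof. by case: z => a b; exact: sqrtr_ge0. Qed.

Lemma cabs_sqr z : cabs z ^+ 2 = Re z ^+ 2 + Im z ^+ 2.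
Proof. by case: z => a b /=; rewrite sqr_sqrtr// addr_ge0// sqr_ge0. Qed.

Lemma cabsM z w : cabs (z * w) = cabs z * cabs w.
Proof. exact: ComplexField.Normc.normcM. Qed.

Lemma cabsV z : cabs z^-1 = (cabs z)^-1.
Proof. exact: ComplexField.Normc.normcV. Qed.

Lemma cabs_real x : cabs x%:C = `|x|.
Proof. by rewrite /= expr0n addr0 sqrtr_sqr. Qed.

Lemma cabs1 : cabs (1 : R[i]) = 1.
Proof. by rewrite (cabs_real 1) normr1. Qed.

Lemma cabs0 : cabs (0 : R[i]) = 0.
Proof. by rewrite (cabs_real 0) normr0. Qed.

Lemma cabsN z : cabs (- z) = cabs z.
Proof. by case: z => a b /=; rewrite !sqrrN. Qed.

Lemma cabsX z n : cabs (z ^+ n) = cabs z ^+ n.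
Proof. by elim: n => [|n IH]; rewrite ?expr0 ?cabs1// !exprS cabsM IH. Qed.

Lemma cabs_nat n : cabs (n%:R : R[i]) = n%:R.
Proof. by rewrite -(rmorph_nat (real_complex R)) cabs_real normr_nat. Qed.

Lemma cabsD z w : cabs (z + w) <= cabs z + cabs w.
Proof. by rewrite -lecR rmorphD /= -!normcE ler_normD. Qed.

Lemma cabsB z w : cabs (z - w) <= cabs z + cabs w.
Proof. by rewrite (le_trans (cabsD _ _))// cabsN. Qed.

Lemma Re_cabs z : `|Re z| <= cabs z.
Proof. by case: z => a b; rewrite /= -[leLHS]sqrtr_sqr ler_wsqrtr// lerDl sqr_ge0. Qed.

Lemma Im_cabs z : `|Im z| <= cabs z.
Proof. by case: z => a b; rewrite /= -[leLHS]sqrtr_sqr ler_wsqrtr// lerDr sqr_ge0. Qed.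

Lemma cabs_le_ReIm z : cabs z <= `|Re z| + `|Im z|.
Proof.
have {1}-> : z = (Re z)%:C + (0 +i* 1) * (Im z)%:C.
  by apply: complex_ext; rewrite ?reimE /=; ring.
apply: (le_trans (cabsD _ _)); rewrite cabsM !cabs_real /=.
by rewrite expr0n add0r expr1n sqrtr1 mul1r.
Qed.

Lemma cabs_eq0 z : (cabs z == 0) = (z == 0).
Proof.
by apply/eqP/eqP => [/ComplexField.Normc.eq0_normc//|->]; rewrite cabs0.
Qed.

Lemma cabs_gt0 z : (0 < cabs z) = (z != 0).
Proof. by rewrite lt_def cabs_ge0 cabs_eq0 andbT. Qed.

Lemma neq0_Re_gt0 z : 0 < Re z -> z != 0.
Proof. by apply: contraTneq => -> /=; rewrite ltxx. Qed.

Lemma expcD z w : expc (z + w) = expc z * expc w.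
Proof.
by apply: complex_ext; rewrite /expc /= !reimE /= expRD ?cosD ?sinD; ring.
Qed.

Lemma expc0 : expc (0 : R[i]) = 1.
Proof. by rewrite /expc /= expR0 cos0 sin0 mulr1 mulr0. Qed.

Lemma expc_real x : expc x%:C = (expR x)%:C.
Proof. by rewrite /expc /= cos0 sin0 mulr1 mulr0. Qed.

Lemma cabs_expc z : cabs (expc z) = expR (Re z).
Proof.
by rewrite /expc /= !exprMn -mulrDr cos2Dsin2 mulr1 sqrtr_sqr ger0_norm.
Qed.

(** Telescoping, one factor at a time. It carries the approximation of $E_1$ by a logarithm over to
    powers, at the price of one power of [L] less than the trivial bound. *)
Lemma cabs_powB z w (L : R) n : cabs z <= L -> cabs w <= L ->
  cabs (z ^+ n.+1 - w ^+ n.+1) <= n.+1%:R * L ^+ n * cabs (z - w).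
Proof.
move=> zL wL; have L0 : 0 <= L := le_trans (cabs_ge0 z) zL.
elim: n => [|n IH]; first by rewrite !expr1 expr0 !mul1r.
have -> : z ^+ n.+2 - w ^+ n.+2 = z * (z ^+ n.+1 - w ^+ n.+1) + w ^+ n.+1 * (z - w).
  by rewrite (exprS z n.+1) (exprS w n.+1); ring.
apply: (le_trans (cabsD _ _)); rewrite !cabsM cabsX.
have -> : n.+2%:R * L ^+ n.+1 * cabs (z - w) =
   L * (n.+1%:R * L ^+ n * cabs (z - w)) + L ^+ n.+1 * cabs (z - w).
  by rewrite (exprS L n) -(natr1 n.+1); ring.
rewrite lerD// ?ler_pM ?cabs_ge0// ?exprn_ge0 ?cabs_ge0//.
by rewrite lerXn2r// nnegrE cabs_ge0.
Qed.

End complex_algebra.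

Section complex_derivative.
Context {R : realType}.
Implicit Types (f g : R -> R[i]) (x : R) (l m : R[i]).

Definition cderiv f x l :=
  is_derive x 1 (fun r => Re (f r)) (Re l) /\
  is_derive x 1 (fun r => Im (f r)) (Im l).

Lemma cderiv_eq f x l m : cderiv f x l -> l = m -> cderiv f x m.
Proof. by move=> ? <-. Qed.

Lemma cderiv_ext f g x l : f =1 g -> cderiv f x l -> cderiv g x l.
Proof. by move=> /funext ->. Qed.

Lemma cderiv_cst (a : R[i]) x : cderiv (fun=> a) x 0.
Proof. by split; exact: is_derive_cst. Qed.

Lemma cderivD f g x l m : cderiv f x l -> cderiv g x m ->
  cderiv (fun r => f r + g r) x (l + m).
Proof.
move=> [fr fi] [gr gi]; split.
  rewrite (_ : (fun _ => _) = (fun r => Re (f r)) + (fun r => Re (g r))); last first.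
    by apply/funext => r; rewrite ReD.
  by rewrite ReD; exact: is_deriveD.
rewrite (_ : (fun _ => _) = (fun r => Im (f r)) + (fun r => Im (g r))); last first.
  by apply/funext => r; rewrite ImD.
by rewrite ImD; exact: is_deriveD.
Qed.

Lemma cderivM f g x l m : cderiv f x l -> cderiv g x m ->
  cderiv (fun r => f r * g r) x (l * g x + f x * m).
Proof.
move=> [fr fi] [gr gi]; split.
  rewrite (_ : (fun _ => _) = (fun r => Re (f r)) * (fun r => Re (g r)) -
     (fun r => Im (f r)) * (fun r => Im (g r))); last first.
    by apply/funext => r; rewrite ReM.
  apply: (is_derive_eq (is_deriveB (is_deriveM fr gr) (is_deriveM fi gi))).
  by rewrite !reimE /GRing.scale /=; ring.
rewrite (_ : (fun _ => _) = (fun r => Re (f r)) * (fun r => Im (g r)) +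
   (fun r => Im (f r)) * (fun r => Re (g r))); last first.
  by apply/funext => r; rewrite ImM.
apply: (is_derive_eq (is_deriveD (is_deriveM fr gi) (is_deriveM fi gr))).
by rewrite !reimE /GRing.scale /=; ring.
Qed.

Lemma cderivZ (a : R[i]) f x l : cderiv f x l ->
  cderiv (fun r => a * f r) x (a * l).
Proof.
move=> fl; apply: cderiv_eq (cderivM (cderiv_cst a x) fl) _.
by rewrite mul0r add0r.
Qed.

Lemma cderiv_id (a b : R[i]) x : cderiv (fun r => a + b * r%:C) x b.
Proof.
split.
  rewrite (_ : (fun _ => _) = cst (Re a) + cst (Re b) * id); last first.
    by apply/funext => r; rewrite !reimE /= mulr0 subr0.
  apply: (is_derive_eq (is_deriveD (is_derive_cst _ _ _)
  (is_deriveM (is_derive_cst _ _ _) (is_derive_id _ _)))).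
  by rewrite /GRing.scale /=; ring.
rewrite (_ : (fun _ => _) = cst (Im a) + cst (Im b) * id); last first.
  by apply/funext => r; rewrite !reimE /= mulr0 add0r.
apply: (is_derive_eq (is_deriveD (is_derive_cst _ _ _)
  (is_deriveM (is_derive_cst _ _ _) (is_derive_id _ _)))).
  by rewrite /GRing.scale /=; ring.
Qed.

Lemma cderivX f x l n : cderiv f x l ->
  cderiv (fun r => f r ^+ n) x (n%:R * f x ^+ n.-1 * l).
Proof.
move=> fl; elim: n => [|n IH].
  rewrite !mul0r; apply: cderiv_ext (cderiv_cst 1 x) => r; rewrite expr0//.
apply: (@cderiv_ext (fun r => f r * f r ^+ n)); first by move=> r; rewrite exprS.
apply: cderiv_eq (cderivM fl IH) _; case: n {IH} => [|n] /=.
  by rewrite !expr0; ring.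
rewrite -(natr1 n.+1) (exprS (f x) n); ring.
Qed.

Lemma cderivV f x l : f x != 0 -> cderiv f x l ->
  cderiv (fun r => (f r)^-1) x (- (f x) ^- 2 * l).
Proof.
move=> fx0 [fr fi].
have n0 : Re (f x) ^+ 2 + Im (f x) ^+ 2 != 0.
  by rewrite -cabs_sqr sqrf_eq0 cabs_eq0.
pose N : R -> R := (fun r => Re (f r)) * (fun r => Re (f r)) +
  (fun r => Im (f r)) * (fun r => Im (f r)).
have dN : is_derive x 1 N (2 * Re (f x) * Re l + 2 * Im (f x) * Im l).
  apply: (is_derive_eq (is_deriveD (is_deriveM fr fr) (is_deriveM fi fi))).
  by rewrite /GRing.scale /=; ring.
have dV : is_derive x 1 (fun r => (N r)^-1)
    (- (N x) ^- 2 * (2 * Re (f x) * Re l + 2 * Im (f x) * Im l)).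
  exact: is_deriveV.
have nE (a b : R) : (a * a - b * b) ^+ 2 + (a * b + b * a) ^+ 2 = (a ^+ 2 + b ^+ 2) ^+ 2.
  by ring.
have Nx : N x = Re (f x) ^+ 2 + Im (f x) ^+ 2 by rewrite !expr2.
split.
  rewrite (_ : (fun _ => _) = (fun r => Re (f r)) * (fun r => (N r)^-1)); last first.
    by apply/funext => r; rewrite ReV !expr2.
  apply: (is_derive_eq (is_deriveM fr dV)).
  rewrite /GRing.scale /= Nx expr2 invfM !reimE /= nE invfM.
  by field; rewrite ?nE ?sqrf_eq0.
rewrite (_ : (fun _ => _) = - ((fun r => Im (f r)) * (fun r => (N r)^-1))); last first.
  by apply/funext => r; rewrite ImV mulNr !expr2.
apply: (is_derive_eq (is_deriveN (is_deriveM fi dV))).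
rewrite /GRing.scale /= Nx expr2 invfM !reimE /= nE.
by field.
Qed.

Lemma cderiv_expc f x l : cderiv f x l ->
  cderiv (fun r => expc (f r)) x (expc (f x) * l).
Proof.
move=> [fr fi].
have de : is_derive x 1 (expR \o (fun r => Re (f r))) (expR (Re (f x)) * Re l).
  exact: (is_derive1_comp (is_derive_expR _) fr).
have dc : is_derive x 1 (cos \o (fun r => Im (f r))) (- sin (Im (f x)) * Im l).
  exact: (is_derive1_comp (is_derive_cos _) fi).
have ds : is_derive x 1 (sin \o (fun r => Im (f r))) (cos (Im (f x)) * Im l).
  exact: (is_derive1_comp (is_derive_sin _) fi).
split.
  rewrite (_ : (fun _ => _) = (expR \o (fun r => Re (f r))) * (cos \o (fun r => Im (f r))))//.
  apply: (is_derive_eq (is_deriveM de dc)).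
  by rewrite /GRing.scale /= !reimE /=; ring.
rewrite (_ : (fun _ => _) = (expR \o (fun r => Re (f r))) * (sin \o (fun r => Im (f r))))//.
apply: (is_derive_eq (is_deriveM de ds)).
by rewrite /GRing.scale /= !reimE /=; ring.
Qed.

Lemma cderiv_continuous f x l : cderiv f x l ->
  {for x, continuous (fun r => Re (f r))} /\ {for x, continuous (fun r => Im (f r))}.
Proof.
by move=> [[fr _] [fi _]]; split; apply/differentiable_continuous/derivable1_diffP.
Qed.

End complex_derivative.

(** * Integration of complex-valued functions *)

Section complex_integral.
Context d {T : measurableType d} {R : realType}.
Variable mu : {measure set T -> \bar R}.
Implicit Types (D : set T) (f g : T -> R[i]) (h : T -> R).

Definition cint D f : R[i] :=
  (\int[mu]_(x in D) Re (f x)) +i* (\int[mu]_(x in D) Im (f x)).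

Definition cmeas D f := measurable_fun D (fun x => Re (f x)) /\
  measurable_fun D (fun x => Im (f x)).

Definition cintegrable D f := mu.-integrable D (EFin \o (fun x => Re (f x))) /\
  mu.-integrable D (EFin \o (fun x => Im (f x))).

Lemma cmeas_cst D (a : R[i]) : cmeas D (fun=> a).
Proof. by split; exact: measurable_cst. Qed.

Lemma cmeas_real D h : measurable_fun D h -> cmeas D (fun x => (h x)%:C).
Proof. by move=> mh; split => //; exact: measurable_cst. Qed.

Lemma cmeasM D f g : cmeas D f -> cmeas D g -> cmeas D (fun x => f x * g x).
Proof.
move=> [fr fi] [gr gi]; split.
  by under eq_fun do rewrite ReM; apply: measurable_funB; exact: measurable_funM.
by under eq_fun do rewrite ImM; apply: measurable_funD; exact: measurable_funM.
Qed.

Lemma cmeas_expc D f : cmeas D f -> cmeas D (fun x => expc (f x)).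
Proof.
move=> [fr fi]; split => /=.
  apply: measurable_funM; apply: measurableT_comp => //.
  by apply: continuous_measurable_fun; exact: continuous_cos.
apply: measurable_funM; apply: measurableT_comp => //.
by apply: continuous_measurable_fun; exact: continuous_sin.
Qed.

Lemma eq_cint D f g : (forall x, D x -> f x = g x) -> cint D f = cint D g.
Proof.
by move=> fg; congr (_ +i* _); apply: eq_Rintegral => x /set_mem /fg ->.
Qed.

Lemma cint_mkcond D f g : (forall x, D x -> g x = f x) ->
  (forall x, ~ D x -> g x = 0) -> cint setT g = cint D f.
Proof.
move=> Dg nDg; apply: complex_ext; rewrite /= [RHS]Rintegral_mkcond;
  apply: eq_Rintegral => x _; rewrite patchE; case: ifPn.
- by move=> /set_mem /Dg ->.
- by move=> /negP nDx; rewrite nDg// => /mem_set.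
- by move=> /set_mem /Dg ->.
- by move=> /negP nDx; rewrite nDg// => /mem_set.
Qed.

Lemma eq_cintegrable D f g : measurable D -> (forall x, D x -> f x = g x) ->
  cintegrable D f -> cintegrable D g.
Proof.
move=> mD fg [fr fi]; split.
  by apply: eq_integrable fr => // x /set_mem /fg /= ->.
by apply: eq_integrable fi => // x /set_mem /fg /= ->.
Qed.

Lemma cintegrable_meas D f : cintegrable D f -> cmeas D f.
Proof.
by move=> [/measurable_int/measurable_EFinP ? /measurable_int/measurable_EFinP ?].
Qed.

Lemma cintegrable_le D f h : measurable D -> cmeas D f ->
  mu.-integrable D (EFin \o h) -> (forall x, D x -> cabs (f x) <= h x) ->
  cintegrable D f.
Proof.
move=> mD [fr fi] ih fh; split.
  apply: (le_integrable mD _ _ ih); first exact/measurable_EFinP.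
  move=> x Dx; rewrite /= lee_fin (le_trans (Re_cabs _))// (le_trans (fh _ Dx))//.
  exact: ler_norm.
apply: (le_integrable mD _ _ ih); first exact/measurable_EFinP.
move=> x Dx; rewrite /= lee_fin (le_trans (Im_cabs _))// (le_trans (fh _ Dx))//.
exact: ler_norm.
Qed.

Lemma cintegrableS D E f : measurable D -> measurable E -> E `<=` D ->
  cintegrable D f -> cintegrable E f.
Proof. by move=> mD mE ED [fr fi]; split; exact: (integrableS mD). Qed.

Lemma cintegrable_cabs D f : measurable D -> cintegrable D f ->
  mu.-integrable D (EFin \o (fun x => cabs (f x))).
Proof.
move=> mD [fr fi].
have /cintegrable_meas [mr mi] : cintegrable D f by [].
apply: (le_integrable mD _ _ (integrableD mD (integrable_abse fr) (integrable_abse fi))).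
  apply/measurable_EFinP.
  rewrite (_ : (fun x => cabs (f x)) =
    (fun x => Num.sqrt (Re (f x) ^+ 2 + Im (f x) ^+ 2))); last first.
    by apply/funext => x; case: (f x).
  apply: measurableT_comp; first by apply: continuous_measurable_fun; exact: sqrt_continuous.
  by apply: measurable_funD; exact: measurable_funX.
move=> x Dx; rewrite /= lee_fin ger0_norm ?cabs_ge0// (le_trans (cabs_le_ReIm _))//.
exact: ler_norm.
Qed.

(** The factor 2 comes from estimating real and imaginary parts separately; only orders of magnitude
    matter later. *)
Lemma cabs_cint_le D f h : measurable D -> cintegrable D f ->
  mu.-integrable D (EFin \o h) -> (forall x, D x -> cabs (f x) <= h x) ->
  cabs (cint D f) <= 2 * \int[mu]_(x in D) h x.
Proof.
move=> mD [fr fi] ih fh.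
rewrite (le_trans (cabs_le_ReIm _))//= mulr_natl mulr2n lerD//.
  rewrite (le_trans (le_normr_Rintegral mD fr))//.
  apply: le_Rintegral => //; first exact: integrable_norm.
  by move=> x Dx; rewrite (le_trans (Re_cabs _))// fh.
rewrite (le_trans (le_normr_Rintegral mD fi))//.
apply: le_Rintegral => //; first exact: integrable_norm.
by move=> x Dx; rewrite (le_trans (Im_cabs _))// fh.
Qed.

Lemma cintegrableD D f g : measurable D -> cintegrable D f -> cintegrable D g ->
  cintegrable D (fun x => f x + g x).
Proof.
move=> mD [fr fi] [gr gi]; split.
  apply: eq_integrable (integrableD mD fr gr) => // x _ /=.
  by rewrite ReD.
apply: eq_integrable (integrableD mD fi gi) => // x _ /=.
by rewrite ImD.
Qed.

Lemma cintD D f g : measurable D -> cintegrable D f -> cintegrable D g ->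
  cint D (fun x => f x + g x) = cint D f + cint D g.
Proof.
move=> mD [fr fi] [gr gi]; apply: complex_ext; rewrite ?ReD ?ImD /= -RintegralD//.
  by apply: eq_Rintegral => x _; rewrite ReD.
by apply: eq_Rintegral => x _; rewrite ImD.
Qed.

Lemma cintegrableZ D (a : R[i]) f : measurable D -> cintegrable D f ->
  cintegrable D (fun x => a * f x).
Proof.
move=> mD [fr fi]; split.
  apply: eq_integrable (integrableB mD (integrableZl mD (Re a) fr)
    (integrableZl mD (Im a) fi)) => // x _ /=.
  by rewrite ReM.
apply: eq_integrable (integrableD mD (integrableZl mD (Re a) fi)
  (integrableZl mD (Im a) fr)) => // x _ /=.
by rewrite ImM.
Qed.

Lemma cintZ D (a : R[i]) f : measurable D -> cintegrable D f ->
  cint D (fun x => a * f x) = a * cint D f.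
Proof.
move=> mD [fr fi]; apply: complex_ext; rewrite ?ReM ?ImM /= -!RintegralZl//.
  rewrite -RintegralB//; [|exact: (integrableZl mD _ fr)|exact: (integrableZl mD _ fi)].
  by apply: eq_Rintegral => x _; rewrite ReM.
rewrite -RintegralD//; [|exact: (integrableZl mD _ fi)|exact: (integrableZl mD _ fr)].
by apply: eq_Rintegral => x _; rewrite ImM.
Qed.

Lemma cintegrableB D f g : measurable D -> cintegrable D f -> cintegrable D g ->
  cintegrable D (fun x => f x - g x).
Proof.
move=> mD fi gi; apply: (@eq_cintegrable _ (fun x => f x + -1 * g x)) => //.
  by move=> x _; rewrite mulN1r.
by apply: cintegrableD => //; exact: cintegrableZ.
Qed.

Lemma cintB D f g : measurable D -> cintegrable D f -> cintegrable D g ->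
  cint D (fun x => f x - g x) = cint D f - cint D g.
Proof.
move=> mD fi gi; rewrite -[in RHS]mulN1r -cintZ// -cintD//.
  by apply: eq_cint => x _; rewrite mulN1r.
exact: cintegrableZ.
Qed.

Lemma cint_sum D n (F : nat -> T -> R[i]) : measurable D ->
  (forall j, cintegrable D (F j)) ->
  cint D (fun x => \sum_(j < n) F j x) = \sum_(j < n) cint D (F j) /\
  cintegrable D (fun x => \sum_(j < n) F j x).
Proof.
move=> mD iF; elim: n => [|n [IH1 IH2]].
  split; rewrite ?big_ord0.
    have e (x : T) : D x -> \sum_(j < 0) F j x = 0 * F 0%N x.
      by rewrite big_ord0 mul0r.
    by rewrite (eq_cint e) cintZ// mul0r.
  apply: (@eq_cintegrable _ (fun x => 0 * F 0%N x)) => //.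
    by move=> x _; rewrite big_ord0 mul0r.
  exact: cintegrableZ.
split.
  rewrite big_ord_recr/= -IH1 -cintD//.
  by apply: eq_cint => x _; rewrite big_ord_recr.
apply: (@eq_cintegrable _ (fun x => \sum_(j < n) F j x + F n x)) => //.
  by move=> x _; rewrite big_ord_recr.
exact: cintegrableD.
Qed.

End complex_integral.

Section cmeas_product.
Context d1 d2 {T1 : measurableType d1} {T2 : measurableType d2} {R : realType}.

Lemma cmeas_fst (f : T1 -> R[i]) : cmeas setT f ->
  cmeas setT (fun p : T1 * T2 => f p.1).
Proof.
by move=> [fr fi]; split; [exact: (measurableT_comp fr measurable_fst)|
  exact: (measurableT_comp fi measurable_fst)].
Qed.

Lemma cmeas_snd (f : T2 -> R[i]) : cmeas setT f ->
  cmeas setT (fun p : T1 * T2 => f p.2).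
Proof.
by move=> [fr fi]; split; [exact: (measurableT_comp fr measurable_snd)|
  exact: (measurableT_comp fi measurable_snd)].
Qed.

End cmeas_product.

(** * Fubini's theorem under a product majorant *)

Section fubini_dominated.
Context d1 d2 {T1 : measurableType d1} {T2 : measurableType d2} {R : realType}.
Variables (m1 : {sigma_finite_measure set T1 -> \bar R})
          (m2 : {sigma_finite_measure set T2 -> \bar R}).
Variables (g : T1 -> R) (h : T2 -> R).
Hypotheses (ig : m1.-integrable setT (EFin \o g))
           (ih : m2.-integrable setT (EFin \o h)).

Let product_integrable (F : T1 -> T2 -> R) :
  measurable_fun setT (fun p : T1 * T2 => F p.1 p.2) ->
  (forall x y, `|F x y| <= g x * h y) ->
  (m1 \x m2)%E.-integrable setT (EFin \o (fun p : T1 * T2 => F p.1 p.2)).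
Proof.
move=> mF Fgh.
have mg : measurable_fun setT g by exact/measurable_EFinP/(measurable_int m1).
have mh : measurable_fun setT h by exact/measurable_EFinP/(measurable_int m2).
have mgh : measurable_fun setT (fun p : T1 * T2 => (g p.1 * h p.2)%:E).
  by apply/measurable_EFinP/measurable_funM; apply: measurableT_comp.
have igh : (m1 \x m2)%E.-integrable setT (fun p : T1 * T2 => (g p.1 * h p.2)%:E).
  apply/integrable12ltyP => //=.
  under eq_integral => x _.
    under eq_integral => y _ do rewrite normrM EFinM.
    rewrite ge0_integralZl//; last exact/measurable_EFinP/measurableT_comp.
    over.
  have /integrableP[_] := ih; rewrite /= => hoo.
  rewrite ge0_integralZr//; last 2 first.
  - exact/measurable_EFinP/measurableT_comp.
  - exact: integral_ge0.
  have /integrableP[_ goo] := ig.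
  rewrite lte_mul_pinfty ?integral_ge0//.
  by rewrite ge0_fin_numE// ?integral_ge0.
apply: (le_integrable _ _ _ igh) => //; first exact/measurable_EFinP.
by move=> [x y] _ /=; rewrite lee_fin (le_trans (Fgh _ _))// ler_norm.
Qed.

Let section_integrable (F : T1 -> T2 -> R) x :
  measurable_fun setT (fun p : T1 * T2 => F p.1 p.2) ->
  (forall x y, `|F x y| <= g x * h y) ->
  m2.-integrable setT (EFin \o F x).
Proof.
move=> mF Fgh; apply: (le_integrable _ _ _ (integrableZl _ (g x) ih)) => //.
  apply/measurable_EFinP.
  exact: (measurableT_comp mF (measurable_pair1 x)).
by move=> y _ /=; rewrite lee_fin (le_trans (Fgh _ _))// ler_norm.
Qed.

Let sectionr_integrable (F : T1 -> T2 -> R) y :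
  measurable_fun setT (fun p : T1 * T2 => F p.1 p.2) ->
  (forall x y, `|F x y| <= g x * h y) ->
  m1.-integrable setT (EFin \o F^~ y).
Proof.
move=> mF Fgh; apply: (le_integrable _ _ _ (integrableZr _ (h y) ig)) => //.
  apply/measurable_EFinP.
  exact: (measurableT_comp mF (measurable_pair2 y)).
by move=> x _ /=; rewrite lee_fin (le_trans (Fgh _ _))// ler_norm.
Qed.

(** A product majorant [g x * h y] suffices for every exchange below: on the vertical line [g] is a
    multiple of $1/(1+y^2)$ and [h] decays exponentially, while for convolutions both are multiples
    of indicators of an interval. *)
Lemma Rfubini (F : T1 -> T2 -> R) :
  measurable_fun setT (fun p : T1 * T2 => F p.1 p.2) ->
  (forall x y, `|F x y| <= g x * h y) ->
  \int[m1]_x \int[m2]_y F x y = \int[m2]_y \int[m1]_x F x y.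
Proof.
move=> mF Fgh; rewrite /Rintegral; congr fine.
under eq_integral => x _.
  rewrite fineK; last exact/integrable_fin_num/section_integrable.
  over.
under [RHS]eq_integral => y _.
  rewrite fineK; last exact/integrable_fin_num/sectionr_integrable.
  over.
exact: (Fubini (product_integrable mF Fgh)).
Qed.

Lemma cfubini (F : T1 -> T2 -> R[i]) :
  cmeas setT (fun p : T1 * T2 => F p.1 p.2) ->
  (forall x y, cabs (F x y) <= g x * h y) ->
  cint m1 setT (fun x => cint m2 setT (F x)) =
  cint m2 setT (fun y => cint m1 setT (F^~ y)).
Proof.
move=> [mr mi] Fgh; apply: complex_ext => /=.
  apply: (Rfubini (F := fun x y => Re (F x y))) => // x y.
  exact: le_trans (Re_cabs _) (Fgh _ _).
apply: (Rfubini (F := fun x y => Im (F x y))) => // x y.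
exact: le_trans (Im_cabs _) (Fgh _ _).
Qed.

End fubini_dominated.

(** * Truncated integrals, the fundamental theorem of calculus, differentiation under the
    integral *)

Section lebesgue_line.
Context {R : realType}.
Local Notation mu := (@lebesgue_measure R).
Implicit Types (f : R -> R) (D : set R).

(** Dominated convergence with majorant $|f|$, along an arbitrary sequence tending to $+\infty$. *)
Lemma Rintegral_truncation D f : measurable D -> mu.-integrable D (EFin \o f) ->
  \int[mu]_(x in D `&` `[- T, T]) f x @[T --> +oo] --> \int[mu]_(x in D) f x.
Proof.
move=> mD intf; apply/cvg_pinftyP => t toy.
have /measurable_int/measurable_EFinP mf := intf.
under eq_fun do rewrite Rintegral_mkcondr.
apply: fine_cvg; rewrite fineK; last exact: integrable_fin_num.
apply: (@dominated_cvg _ _ _ mu D mD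
    (fun n x => ((f \_ `[- t n, t n]) x)%:E) _ (EFin \o (fun x => `|f x|))) => //=.
- by move=> n; apply/measurable_EFinP/measurable_restrict => //; apply: measurable_funS mf.
- move=> x Dx; apply: cvg_EFin; first exact: nearW.
  apply: cvg_near_cst; move/cvgryPge : toy => /(_ `|x|); apply: filterS => n xt.
  by rewrite /= patchE mem_set//= in_itv/= -ler_norml.
- exact: integrable_norm.
- move=> n x Dx; rewrite lee_fin patchE; case: ifPn => // _.
  by rewrite normr0.
Qed.

End lebesgue_line.

Section complex_lebesgue.
Context {R : realType}.
Local Notation mu := (@lebesgue_measure R).
Implicit Types (f F : R -> R[i]).

Definition ccont f := continuous (fun r => Re (f r)) /\ continuous (fun r => Im (f r)).

Lemma ccont_meas f (D : set R) : measurable D -> ccont f -> cmeas D f.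
Proof.
by move=> mD [fr fi]; split; apply: (measurable_funS measurableT) => //; exact: continuous_measurable_fun.
Qed.

Lemma cderiv_ccont f : (forall x, exists l, cderiv f x l) -> ccont f.
Proof.
by move=> df; split=> x; have [l /cderiv_continuous[]] := df x.
Qed.

Lemma ccont_cst (z : R[i]) : ccont (fun=> z).
Proof. by split => x; exact: cvg_cst. Qed.

Lemma ccontD f F : ccont f -> ccont F -> ccont (fun x => f x + F x).
Proof.
move=> [fr fi] [Fr Fi]; split => x.
  by under eq_fun do rewrite ReD; apply: continuousD; [exact: fr|exact: Fr].
by under eq_fun do rewrite ImD; apply: continuousD; [exact: fi|exact: Fi].
Qed.

Lemma ccontM f F : ccont f -> ccont F -> ccont (fun x => f x * F x).
Proof.
move=> [fr fi] [Fr Fi]; split => x.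
  under eq_fun do rewrite ReM.
  by apply: cvgB; apply: cvgM; [exact: fr|exact: Fr|exact: fi|exact: Fi].
under eq_fun do rewrite ImM.
by apply: cvgD; apply: cvgM; [exact: fr|exact: Fi|exact: fi|exact: Fr].
Qed.

Lemma ccontN f : ccont f -> ccont (fun x => - f x).
Proof.
by move=> cf; under eq_fun do rewrite -mulN1r; apply: ccontM => //; exact: ccont_cst.
Qed.

Lemma cFTC f F (a b : R) : a < b -> (forall x, cderiv F x (f x)) -> ccont f ->
  cint mu `[a, b] f = F b - F a.
Proof.
move=> ab dF [fr fi].
have [Fr Fi] : ccont F by apply: cderiv_ccont => x; exists (f x).
have oo (G g : R -> R) : (forall x : R, is_derive x 1 G (g x)) -> continuous G ->
    derivable_oo_LRcontinuous G a b /\ {in `]a, b[, derive1 G =1 g}.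
  move=> dG cG; split.
    by split; [move=> x _; exact: ex_derive|exact/cvg_at_right_filter/cG|
      exact/cvg_at_left_filter/cG].
  by move=> x _; rewrite derive1E derive_val.
have [r1 r2] := oo _ _ (fun x => (dF x).1) Fr.
have [i1 i2] := oo _ _ (fun x => (dF x).2) Fi.
apply: complex_ext; rewrite /= /Rintegral.
  by rewrite (continuous_FTC2 ab _ r1 r2)//= ?ReD ?ReN//; exact: continuous_subspaceT.
by rewrite (continuous_FTC2 ab _ i1 i2)//= ?ImD ?ImN//; exact: continuous_subspaceT.
Qed.

Lemma cint_truncation (D : set R) f : measurable D -> cintegrable mu D f ->
  cabs (cint mu (D `&` `[- T, T]) f - cint mu D f) @[T --> +oo] --> (0 : R).
Proof.
move=> mD [/(Rintegral_truncation mD) fr /(Rintegral_truncation mD) fi].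
pose h T := `|\int[mu]_(x in D `&` `[- T, T]) Re (f x) - \int[mu]_(x in D) Re (f x)| +
            `|\int[mu]_(x in D `&` `[- T, T]) Im (f x) - \int[mu]_(x in D) Im (f x)|.
have h0 : h T @[T --> +oo] --> (0 : R).
  rewrite -(addr0 0); apply: cvgD; rewrite -(@normr0 _ R).
    by apply: cvg_norm; exact/subr_cvg0.
  by apply: cvg_norm; exact/subr_cvg0.
apply: (squeeze_cvgr _ (@cvg_cst _ (0 : R) _ _ _) h0).
apply: nearW => T; rewrite cabs_ge0 andTb; exact: cabs_le_ReIm.
Qed.

(** Complex limits are expressed through a real modulus tending to 0, so uniqueness is a squeeze on
    $|a - b|$. *)
Lemma cabs_lim_unique (h : R -> R[i]) (a b : R[i]) :
  cabs (h T - a) @[T --> +oo] --> (0 : R) ->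
  cabs (h T - b) @[T --> +oo] --> (0 : R) -> a = b.
Proof.
move=> ha hb; apply/eqP; rewrite -subr_eq0 -cabs_eq0; apply/eqP.
have hab : (cabs (h T - a) + cabs (h T - b)) @[T --> +oo] --> (0 : R).
  by rewrite -(addr0 0); exact: cvgD.
have h0 : (fun=> cabs (a - b)) @ (+oo : set_system R) --> (0 : R).
  apply: (squeeze_cvgr _ (@cvg_cst _ (0 : R) _ _ _) hab).
  apply: nearW => T; rewrite cabs_ge0 andTb.
  have -> : a - b = (h T - b) - (h T - a) by ring.
  rewrite [leRHS]addrC; exact: cabsB.
by have /cvg_lim <- := h0; rewrite // lim_cst.
Qed.

Lemma cFTC_line f F : (forall x, cderiv F x (f x)) -> ccont f ->
  cintegrable mu setT f -> forall L : R[i],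
  cabs (F T - F (- T) - L) @[T --> +oo] --> (0 : R) -> cint mu setT f = L.
Proof.
move=> dF cf intf L FL.
apply: (@cabs_lim_unique (fun T => F T - F (- T))) FL.
apply: cvg_trans (cint_truncation measurableT intf); apply: near_eq_cvg.
near=> T; congr cabs; congr (_ - _); rewrite setTI (cFTC _ dF cf)//.
rewrite gtrN//; near: T; apply: nbhs_pinfty_gt; exact: num_real.
Unshelve. all: by end_near. Qed.

Lemma cFTC_halfline f F (a : R) : (forall x, cderiv F x (f x)) -> ccont f ->
  cintegrable mu `[a, +oo[ f -> forall L : R[i],
  cabs (F T - L) @[T --> +oo] --> (0 : R) -> cint mu `[a, +oo[ f = L - F a.
Proof.
move=> dF cf intf L FL.
apply: (@cabs_lim_unique (fun T => F T - F a)).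
  apply: cvg_trans (cint_truncation (measurable_itv _) intf); apply: near_eq_cvg.
  near=> T; congr cabs; congr (_ - _).
  have aT' : `|a| <= T by near: T; apply: nbhs_pinfty_ge; exact: num_real.
  have -> : `[a, +oo[%classic `&` `[- T, T]%classic = `[a, T]%classic :> set R.
    apply/seteqP; split => x /=; rewrite !in_itv/= ?andbT.
      by move=> [-> /andP[]].
    move=> /andP[ax xT]; split=> //; rewrite xT andbT (le_trans _ ax)//.
    by by rewrite lerNl (le_trans (ler_norm _))// normrN.
  have aT : a < T by near: T; apply: nbhs_pinfty_gt; exact: num_real.
  by rewrite (cFTC aT dF cf).
apply: cvg_trans FL; apply: near_eq_cvg; apply: nearW => T /=.
by congr cabs; ring.
Unshelve. all: by end_near. Qed.

End complex_lebesgue.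

Section complex_under_integral.
Context {R : realType} d {Y : measurableType d} {mu : {measure set Y -> \bar R}}.
Variables (f f' : R -> Y -> R[i]) (B : set Y) (G : Y -> R) (a u v : R).
Hypotheses (mB : measurable B) (Ia : `]u, v[%classic a).
Hypothesis intf : forall x, `]u, v[%classic x -> cintegrable mu B (f x).
Hypothesis df : forall x y, `]u, v[%classic x -> B y -> cderiv (f ^~ y) x (f' x y).
Hypothesis intG : mu.-integrable B (EFin \o G).
Hypothesis G_ub : forall x y, `]u, v[%classic x -> B y -> cabs (f' x y) <= G y.

Lemma cderiv_under_integral :
  cderiv (fun x => cint mu B (f x)) a (cint mu B (f' a)).
Proof.
(* The bound [G] is only known to be nonnegative on [B]; its absolute value is nonnegative
   everywhere. *)
pose G' y := `|G y|.
have iG' : mu.-integrable B (EFin \o G') by exact: integrable_norm.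
have key (h h' : R -> Y -> R) :
    (forall x, `]u, v[%classic x -> mu.-integrable B (EFin \o h x)) ->
    (forall x y, `]u, v[%classic x -> B y -> is_derive x 1 (h ^~ y) (h' x y)) ->
    (forall x y, `]u, v[%classic x -> B y -> `|h' x y| <= G y) ->
    is_derive a 1 (fun x => \int[mu]_(y in B) h x y) (\int[mu]_(y in B) h' a y).
  move=> ih dh hG.
  have p x y : `]u, v[%classic x -> B y -> partial1of2 h x y = h' x y.
    by move=> Ix By; rewrite partial1of2E; have [] := dh x y Ix By.
  have der : forall x y, `]u, v[%classic x -> B y -> derivable (h ^~ y) x 1.
    by move=> x y Ix By; have [] := dh x y Ix By.
  have ub : forall x y, `]u, v[%classic x -> B y -> `|partial1of2 h x y| <= G' y.
    by move=> x y Ix By; rewrite p// (le_trans (hG _ _ Ix By))// ler_norm.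
  have G'0 y : 0 <= G' y by exact: normr_ge0.
  apply: DeriveDef; first exact: (derivable_under_integral mB Ia ih der G'0 iG' ub).
  rewrite -derive1E (differentiation_under_integral mB Ia ih der G'0 iG' ub).
  by apply: eq_Rintegral => y /set_mem By; exact: p.
split => /=.
  apply: (key (fun x y => Re (f x y)) (fun x y => Re (f' x y))).
  - by move=> x /intf[].
  - by move=> x y Ix By; have [] := df Ix By.
  - by move=> x y Ix By; rewrite (le_trans (Re_cabs _))// G_ub.
apply: (key (fun x y => Im (f x y)) (fun x y => Im (f' x y))).
- by move=> x /intf[].
- by move=> x y Ix By; have [] := df Ix By.
- by move=> x y Ix By; rewrite (le_trans (Im_cabs _))// G_ub.
Qed.

End complex_under_integral.

(** * Integrals of exponentials over half-lines and of $1/(1+y^2)$ *)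

Section explicit_integrals.
Context {R : realType}.
Local Notation mu := (@lebesgue_measure R).

Lemma cvg_pinfty0 (h : R -> R) (K : R) :
  (forall T, 1 <= T -> 0 <= h T <= K / T) -> h T @[T --> +oo] --> (0 : R).
Proof.
move=> hK; have KT : K / T @[T --> +oo] --> (0 : R).
  rewrite -(mulr0 K); apply: cvgM; first exact: cvg_cst.
  have T0 : \forall T \near +oo, 0 < (T : R) by apply: nbhs_pinfty_gt; exact: num_real.
  exact: (gtr0_cvgV0 T0).2.
apply: (squeeze_cvgr _ (@cvg_cst _ (0 : R) _ _ _) KT).
by near=> T; apply: hK; near: T; apply: nbhs_pinfty_ge; exact: num_real.
Unshelve. all: by end_near. Qed.

(** From $1 + cx \le e^{cx}$. This crude decay is enough to make boundary terms at infinity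
    vanish. *)
Lemma expRN_le (c x : R) : 0 < c -> 0 < x -> expR (- (c * x)) <= c^-1 / x.
Proof.
move=> c0 x0; rewrite expRN -invfM ?[_^-1 * _]mulrC lef_pV2 ?posrE ?mulr_gt0 ?expR_gt0//.
by rewrite (le_trans _ (expR_ge1Dx _))// lerDr.
Qed.

Lemma integrable_expRN (c a : R) : 0 < c ->
  mu.-integrable `[a, +oo[ (EFin \o (fun t => expR (- (c * t)))).
Proof.
move=> c0.
have cf : continuous (fun t : R => expR (- (c * t))).
  move=> t; apply: (@continuous_comp _ _ _ (fun t : R => - (c * t)) expR).
    by apply: continuousN; apply: continuousM; [exact: cvg_cst|exact: cvg_id].
  exact: continuous_expR.
apply/integrableP; split.
  by apply/measurable_EFinP/measurable_funTS; exact: continuous_measurable_fun.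
under eq_integral => t _ do rewrite /= ger0_norm ?expR_ge0//.
have dF (x : R) : is_derive x 1 (fun t => - c^-1 * expR (- (c * t))) (expR (- (c * x))).
  have d1 : is_derive x 1 (fun t : R => - (c * t)) (- c).
    apply: (is_derive_eq (is_deriveN (is_deriveM (is_derive_cst c x 1) (is_derive_id x 1)))).
    by rewrite /GRing.scale /= mulr1 mulr0 addr0.
  apply: (is_derive_eq (is_deriveM (is_derive_cst (- c^-1) x 1)
    (is_derive1_comp (is_derive_expR _) d1))).
  by rewrite /GRing.scale /=; field; rewrite gt_eqF.
rewrite (ge0_continuous_FTC2y (F := fun t => - c^-1 * expR (- (c * t))) (l := 0))//.
- by rewrite -EFinB ltry.
- exact: continuous_subspaceT.
- rewrite -oppr0; under eq_fun do rewrite mulNr; apply: cvgN.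
  apply: (@cvg_pinfty0 _ (c^-1 * c^-1)) => T T1.
  rewrite mulr_ge0 ?expR_ge0 ?invr_ge0 ?(ltW c0)//= -mulrA.
  by rewrite ler_pM2l ?invr_gt0// expRN_le// (lt_le_trans _ T1).
- apply: cvg_at_right_filter.
  apply: cvgM; first exact: cvg_cst.
  exact: cf.
- by move=> x _; rewrite derive1E derive_val.
Qed.

Lemma cderiv_expc_linear (a b : R[i]) (x : R) :
  cderiv (fun r => expc (a + b * r%:C)) x (b * expc (a + b * x%:C)).
Proof. by rewrite mulrC; exact: cderiv_expc (cderiv_id _ _ _). Qed.

Lemma cderiv_expc_scale (b : R[i]) (x : R) :
  cderiv (fun r => expc (b * r%:C)) x (b * expc (b * x%:C)).
Proof.
have := cderiv_expc_linear 0 b x; rewrite add0r.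
by apply: cderiv_ext => r; rewrite add0r.
Qed.

Lemma ccont_expc_scale (b : R[i]) : ccont (fun r => expc (b * r%:C)).
Proof. by apply: cderiv_ccont => x; eexists; exact: cderiv_expc_scale. Qed.

Lemma cabs_expc_scale (z : R[i]) (t : R) : cabs (expc (z * t%:C)) = expR (Re z * t).
Proof. by rewrite cabs_expc ReM /= mulr0 subr0. Qed.

Lemma cintegrable_expc (z : R[i]) (a : R) : 0 < Re z ->
  cintegrable mu `[a, +oo[ (fun t => expc (- z * t%:C)).
Proof.
move=> z0; apply: cintegrable_le (integrable_expRN a z0) _ => //.
  exact/ccont_meas/ccont_expc_scale.
by move=> t _; rewrite cabs_expc_scale ReN mulNr.
Qed.

Lemma cint_expc (z : R[i]) (a : R) : 0 < Re z ->
  cint mu `[a, +oo[ (fun t => expc (- z * t%:C)) = expc (- z * a%:C) / z.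
Proof.
move=> z0; have zn0 := neq0_Re_gt0 z0.
rewrite (@cFTC_halfline R _ (fun t => - z^-1 * expc (- z * t%:C)) a _ _ _ 0).
- by rewrite sub0r mulNr opprK mulrC.
- move=> x; apply: cderiv_eq (cderivZ _ (cderiv_expc_scale _ _)) _.
  by rewrite mulrA mulrNN mulVf// mul1r.
- exact: ccont_expc_scale.
- exact: cintegrable_expc.
- apply: (@cvg_pinfty0 _ (cabs z^-1 * (Re z)^-1)) => T T1.
  rewrite cabs_ge0/= subr0 cabsM cabsN -mulrA ler_wpM2l ?cabs_ge0//.
  by rewrite cabs_expc_scale ReN mulNr expRN_le// (lt_le_trans _ T1).
Qed.

Lemma integrable_oneDsqrV : mu.-integrable setT (EFin \o (fun y => (1 + y ^+ 2)^-1)).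
Proof.
have m0 : measurable_fun setT (fun y : R => (1 + y ^+ 2)^-1).
  by apply: continuous_measurable_fun; exact: continuous_oneDsqrV.
apply/integrableP; split; first exact/measurable_EFinP.
under eq_integral => t _ do rewrite /= ger0_norm ?invr_ge0 ?addr_ge0 ?sqr_ge0//.
rewrite ge0_symfun_integralT//; last 3 first.
- by move=> x; rewrite invr_ge0 addr_ge0 ?sqr_ge0.
- exact: continuous_oneDsqrV.
- by move=> x /=; rewrite sqrrN.
by rewrite -set_itvcy integral0y_oneDsqr -EFinM ltry.
Qed.

End explicit_integrals.

(** * Powers and exponentials on the line $\mathrm{Re}\,s = c$ *)

Section vertical_line.
Context {R : realType}.
Variables (c : R) (c0 : 0 < c).
Local Notation mu := (@lebesgue_measure R).
Local Notation s y := (c +i* y).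

Lemma line_neq0 (y : R) : s y != 0 :> R[i].
Proof. by apply: neq0_Re_gt0. Qed.

Lemma cderiv_line (y : R) : cderiv (fun y => s y) y (0 +i* 1).
Proof.
apply: cderiv_ext (cderiv_id c%:C (0 +i* 1) y) => r.
by apply: complex_ext; rewrite !reimE /=; ring.
Qed.

Lemma cabs_line_ge (y : R) : c <= cabs (s y).
Proof. by have := Re_cabs (s y); rewrite /= gtr0_norm. Qed.

Lemma cabs_line_geN (y : R) : `|y| <= cabs (s y).
Proof. exact: (Im_cabs (s y)). Qed.

(** Chosen so that $1 + y^2 \le (1 + c^{-2})(c^2 + y^2)$: one majorant $1/(1+y^2)$ then serves every
    vertical line. *)
Definition lineK := 1 + c ^- 2.

Lemma lineK_ge0 : 0 <= lineK.
Proof. by rewrite addr_ge0// invr_ge0 exprn_ge0// ltW. Qed.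

Lemma cabs_lineV2 (y : R) : cabs (s y ^- 2) <= lineK * (1 + y ^+ 2)^-1.
Proof.
have y1 : 0 < 1 + y ^+ 2 by rewrite ltr_wpDr ?sqr_ge0.
have cy : 0 < c ^+ 2 + y ^+ 2 by rewrite ltr_wpDr ?sqr_ge0 ?exprn_gt0.
rewrite cabsV cabsX cabs_sqr /= ler_pdivlMr// mulrC ler_pdivrMr// /lineK.
have -> : (1 + c ^- 2) * (c ^+ 2 + y ^+ 2) = c ^+ 2 + y ^+ 2 + 1 + c ^- 2 * y ^+ 2.
  by field; rewrite gt_eqF.
have := sqr_ge0 c; have : 0 <= c ^- 2 * y ^+ 2.
  by rewrite mulr_ge0 ?invr_ge0 ?sqr_ge0 ?exprn_ge0// ltW.
lra.
Qed.

Lemma integrable_lineV2 (K : R) :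
  mu.-integrable setT (EFin \o (fun y => K * (1 + y ^+ 2)^-1)).
Proof. exact: (integrableZl measurableT _ integrable_oneDsqrV). Qed.

Lemma cderiv_lineV n (y : R) :
  cderiv (fun y => (s y) ^- n) y (- n%:R * (0 +i* 1) * (s y) ^- n.+1).
Proof.
apply: cderiv_eq (cderivV _ (cderivX n (cderiv_line y))) _.
  by rewrite expf_neq0 ?line_neq0.
case: n => [|n] /=; first by rewrite !mul0r mulr0 oppr0 !mul0r.
have s0 := line_neq0 y.
rewrite (exprS _ n.+1) (exprS _ n); field.
by rewrite expf_neq0 ?line_neq0 ?s0.
Qed.

Lemma cderiv_expc_line (x y : R) :
  cderiv (fun y => expc (s y * x%:C)) y ((0 +i* 1) * x%:C * expc (s y * x%:C)).
Proof.
apply: cderiv_eq (cderiv_expc (cderivM (cderiv_line y) (cderiv_cst x%:C y))) _.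
by rewrite mulr0 addr0 mulrC.
Qed.

Lemma cabs_expc_line (x y : R) : cabs (expc (s y * x%:C)) = expR (c * x).
Proof. by rewrite cabs_expc_scale. Qed.

End vertical_line.

(** * Inversion formula for the ramp *)

Lemma is_derive0_eq {R : realType} (h : R -> R) (a b : R) : a <= b ->
  (forall x, a <= x <= b -> is_derive x 1 h 0) -> h a = h b.
Proof.
rewrite le_eqVlt => /predU1P[->//|ab] dh.
have oo x : x \in `]a, b[ -> is_derive x 1 h 0.
  by rewrite in_itv/= => /andP[ax xb]; apply: dh; rewrite !ltW.
have [|x _] := @MVT R h (fun=> 0) a b ab oo.
  apply: derivable_within_continuous => x; rewrite in_itv/= => /dh.
  by move=> ?; exact: ex_derive.
by rewrite mul0r => /eqP; rewrite subr_eq0 => /eqP.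
Qed.

Lemma cderiv0_eq {R : realType} (h : R -> R[i]) (a b : R) : a <= b ->
  (forall x, a <= x <= b -> cderiv h x 0) -> h a = h b.
Proof.
move=> ab dh; apply: complex_ext.
  by apply: (is_derive0_eq (h := fun x => Re (h x)) ab) => x /dh[].
by apply: (is_derive0_eq (h := fun x => Im (h x)) ab) => x /dh[].
Qed.

Section ramp_inversion.
Context {R : realType}.
Variables (c : R) (c0 : 0 < c).
Local Notation mu := (@lebesgue_measure R).
Local Notation s y := (c +i* y).

(** For $n \ge 2$ the value to expect is $2\pi x^{n-1}/(n-1)!$ for $x > 0$ and 0 otherwise. The goal
    is [F 2]; [F 3] is the auxiliary function, because it can be differentiated under the integral
    sign. *)
Let F n (x : R) := cint mu setT (fun y => expc (s y * x%:C) * (s y) ^- n).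

Let ccont_F n x : ccont (fun y => expc (s y * x%:C) * (s y) ^- n).
Proof.
apply: cderiv_ccont => y; eexists.
by apply: cderivM; [exact: cderiv_expc_line|exact: cderiv_lineV].
Qed.

Let bound_F n x y :
  cabs (expc (s y * x%:C) * (s y) ^- n.+2) <=
  expR (c * x) * c ^- n * lineK c * (1 + y ^+ 2)^-1.
Proof.
rewrite cabsM cabs_expc_line -!mulrA ler_wpM2l ?expR_ge0//.
rewrite -addn2 exprD invfM cabsM ler_pM ?cabs_ge0 ?cabs_lineV2//.
rewrite cabsV cabsX lef_pV2 ?posrE ?exprn_gt0//; last first.
  by rewrite cabs_gt0 line_neq0.
by rewrite lerXn2r ?nnegrE ?cabs_ge0 ?(ltW c0)// cabs_line_ge.
Qed.

Let int_F n x : cintegrable mu setT (fun y => expc (s y * x%:C) * (s y) ^- n.+2).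
Proof.
apply: cintegrable_le (integrable_lineV2 _) _ => //.
exact/ccont_meas/ccont_F.
Qed.

Let F_bound n : exists2 K, 0 <= K & forall x, cabs (F n.+2 x) <= K * expR (c * x).
Proof.
exists (2 * (c ^- n * lineK c * \int[mu]_y (1 + y ^+ 2)^-1)).
  rewrite !mulr_ge0 ?lineK_ge0 ?invr_ge0 ?exprn_ge0 ?(ltW c0)//.
  by apply: Rintegral_ge0 => y _; rewrite invr_ge0 addr_ge0 ?sqr_ge0.
move=> x; apply: le_trans (cabs_cint_le _ (int_F n x) (integrable_lineV2 _) _) _ => //.
rewrite RintegralZl//; last exact: integrable_oneDsqrV.
by rewrite le_eqVlt; apply/orP; left; apply/eqP; ring.
Qed.

(** Differentiation in $x$ lowers the exponent by one, so exponent 3 is the first for which the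
    derivative still converges absolutely. On the window []x - 1, x + 1[] the exponential factor is
    at most $e^{c(x+1)}$. *)
Let F_deriv n x : cderiv (F n.+3) x (F n.+2 x).
Proof.
pose f' (x : R) y := expc (s y * x%:C) * (s y) ^- n.+2.
apply: (@cderiv_under_integral _ _ _ mu _ f' setT
  (fun y => expR (c * (x + 1)) * c ^- n * lineK c * (1 + y ^+ 2)^-1) x (x - 1) (x + 1)) => //.
- by rewrite /= in_itv/=; apply/andP; split; lra.
- by move=> r y _ _; apply: cderiv_eq (cderivM (cderiv_expc_scale _ _) (cderiv_cst _ _)) _;
    rewrite mulr0 addr0 /f' (exprS _ n.+2) invfM; field; rewrite ?expf_neq0 ?line_neq0.
- exact: integrable_lineV2.
- move=> r y; rewrite /= in_itv/= => /andP[_ rx] _; apply: (le_trans (bound_F _ _ _)).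
  apply: ler_wpM2r; first by rewrite invr_ge0 addr_ge0 ?sqr_ge0.
  apply: ler_wpM2r; first exact: lineK_ge0.
  apply: ler_wpM2r; first by rewrite invr_ge0 exprn_ge0// ltW.
  by rewrite ler_expR ler_pM2l// ltW.
Qed.

(** The integral over the whole line of the $y$-derivative of $e^{sx}s^{-n-2}$ vanishes, because
    this function tends to 0 at both ends. *)
Let F_rec n x : x%:C * F n.+2 x = n.+2%:R * F n.+3 x.
Proof.
have : cint mu setT (fun y => (0 +i* 1) * (x%:C * (expc (s y * x%:C) * s y ^- n.+2) -
   n.+2%:R * (expc (s y * x%:C) * s y ^- n.+3))) = 0.
  have ci : cintegrable mu setT (fun y => (0 +i* 1) * (x%:C * (expc (s y * x%:C) * s y ^- n.+2) -
     n.+2%:R * (expc (s y * x%:C) * s y ^- n.+3))).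
    by apply: cintegrableZ => //; apply: cintegrableB => //;
      apply: cintegrableZ => //; exact: int_F.
  apply: (cFTC_line (F := fun y => expc (s y * x%:C) * s y ^- n.+2) _ _ ci).
  - move=> y; apply: cderiv_eq (cderivM (cderiv_expc_line c x y) (cderiv_lineV c0 n.+2 y)) _.
    by ring.
  - apply: ccontM; first exact: ccont_cst.
    by apply: ccontD; [|apply: ccontN]; apply: ccontM; [exact: ccont_cst|exact: ccont_F|exact: ccont_cst|exact: ccont_F].
  - apply: (@cvg_pinfty0 _ _ (2 * (expR (c * x) * c ^- n * lineK c))) => T T1.
    rewrite cabs_ge0 andTb subr0 (le_trans (cabsB _ _))//.
    have T0 : 0 < T by exact: lt_le_trans T1.
    have b (y : R) : `|y| = T -> cabs (expc (s y * x%:C) * s y ^- n.+2) <=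
        expR (c * x) * c ^- n * lineK c / T.
      move=> yT; apply: (le_trans (bound_F _ _ _)).
      rewrite ler_wpM2l ?mulr_ge0 ?expR_ge0 ?lineK_ge0 ?invr_ge0 ?exprn_ge0 ?(ltW c0)//.
      rewrite lef_pV2 ?posrE// ?ltr_wpDr ?sqr_ge0// -(real_normK (num_real y)) yT.
      by have := sqr_ge0 (T - 1); lra.
    by rewrite -mulrA mulr_natl mulr2n lerD// b// ?normrN gtr0_norm.
rewrite cintZ//; last first.
  by apply: cintegrableB => //; apply: cintegrableZ => //; exact: int_F.
rewrite cintB//; [|apply: cintegrableZ => //; exact: int_F..].
rewrite !cintZ//; [|exact: int_F..].
move=> /eqP; rewrite mulf_eq0 => /orP[/eqP[/eqP]|]; first by rewrite oner_eq0.
by rewrite subr_eq0 => /eqP.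
Qed.

(** Derivative and recurrence combine into Euler's equation $x F_3' = 2 F_3$, so $x^{-2}F_3(x)$ is
    constant on any interval avoiding 0. The hypothesis says that [a] and [x] have the same sign. *)
Let F3_quadratic (a x : R) : 0 < a * x -> F 3 x = (x ^+ 2 / a ^+ 2)%:C * F 3 a.
Proof.
wlog ax : a x / a <= x.
  move=> H p; have [/H->//|/ltW/H] := leP a x.
  rewrite mulrC => /(_ p) ->; rewrite mulrA -rmorphM /= mulf_div.
  rewrite [X in X / _]mulrC divff ?mul1r//.
  by move: p; apply: contraTneq => /eqP; rewrite mulf_eq0 !sqrf_eq0 => /orP[]/eqP->;
    rewrite ?mulr0 ?mul0r ltxx.
move=> p; have nz (r : R) : a <= r <= x -> r != 0.
  move=> /andP[ar rx]; move: p; apply: contraTneq => r0; rewrite r0 in ar rx.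
  by rewrite -leNgt mulr_le0_ge0.
have d (r : R) : a <= r <= x -> cderiv (fun r => ((r%:C)^-1) ^+ 2 * F 3 r) r 0.
  move=> /nz r0.
  have rC : (r%:C : R[i]) != 0 by apply: contra r0 => /eqP[->].
  have di : cderiv (fun r => r%:C : R[i]) r 1.
    apply: cderiv_ext (cderiv_id 0 1 r) => t; rewrite add0r mul1r//.
  apply: cderiv_eq (cderivM (cderivX 2 (cderivV rC di)) (F_deriv 0 r)) _.
  apply: (mulfI (expf_neq0 3 rC)); rewrite mulr0 /=.
  have e : 2%:R * F 3 r = r%:C * F 2 r by rewrite F_rec.
  transitivity (r%:C * F 2 r - 2%:R * F 3 r); last by rewrite e subrr.
  by field.
have := cderiv0_eq ax d.
have aC : (a%:C : R[i]) != 0.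
  by have := nz a; rewrite lexx ax => /(_ isT); apply: contra => /eqP[->].
have xC : (x%:C : R[i]) != 0.
  by have := nz x; rewrite lexx ax => /(_ isT); apply: contra => /eqP[->].
move=> /(congr1 (fun z => x%:C ^+ 2 * z)).
rewrite rmorphM fmorphV !rmorphXn /= => e.
transitivity (x%:C ^+ 2 * (x%:C^-1 ^+ 2 * F 3 x)); last rewrite -e; by field.
Qed.

(** On the negative axis $F_3(x) = x^2 F_3(-1)$ would grow quadratically, whereas $|F_3(x)| \le K
    e^{cx} \le K$ there. *)
Let F3_neg : F 3 (-1) = 0.
Proof.
apply/eqP; rewrite -cabs_eq0; apply: contraT => n0.
have g0 : 0 < cabs (F 3 (-1)) by rewrite lt_def n0 cabs_ge0.
have [K K0 FK] := F_bound 1.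
(* With $t = K/|F_3(-1)|$, $x^2 = (1+t)^2 > t$, so $x^2|F_3(-1)|$ exceeds $K$. *)
pose x := - (1 + K / cabs (F 3 (-1))).
have Kg : 0 <= K / cabs (F 3 (-1)) by rewrite divr_ge0// ltW.
have x0 : x < 0 by rewrite /x; lra.
have := FK x; rewrite (@F3_quadratic (-1)); last by rewrite mulN1r oppr_gt0.
rewrite cabsM cabs_real [(-1) ^+ 2]sqrrN expr1n divr1 ger0_norm ?sqr_ge0// leNgt => /negP[].
apply: (@le_lt_trans _ _ K).
  rewrite ler_piMr// -(@expR0 R) ler_expR pmulr_rle0// ltW//.
rewrite -ltr_pdivrMr// /x sqrrN.
by set t := K / _ in Kg *; have := sqr_ge0 t; rewrite sqrrD expr1n mul1r mulr2n; lra.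
Qed.

(** The recurrence gives no information on [F 2] at $x = 0$. There the integrand $s^{-2}$ is, up to
    a constant factor, the derivative of $s^{-1}$, which vanishes at both ends. *)
Let F2_0 : F 2 0 = 0.
Proof.
have ci : cintegrable mu setT (fun y => - (0 +i* 1) * (expc (s y * 0%:C) * s y ^- 2)).
  by apply: cintegrableZ => //; exact: int_F.
have : cint mu setT (fun y => - (0 +i* 1) * (expc (s y * 0%:C) * s y ^- 2)) = 0.
  apply: (cFTC_line (F := fun y => s y ^- 1) _ _ ci).
  - move=> y; apply: cderiv_eq (cderiv_lineV c0 1 y) _.
    by rewrite mulr0 expc0; ring.
  - by apply: ccontM; [exact: ccont_cst|exact: ccont_F].
  - apply: (@cvg_pinfty0 _ _ 2) => T T1.
    have T0 : 0 < T by exact: lt_le_trans T1.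
    rewrite cabs_ge0 andTb subr0 (le_trans (cabsB _ _))// mulr_natl mulr2n.
    have b (y : R) : `|y| = T -> cabs (s y ^- 1) <= T^-1.
      move=> yT; rewrite cabsV expr1 lef_pV2 ?posrE//; last by rewrite cabs_gt0 line_neq0.
      by rewrite -yT cabs_line_geN.
    by rewrite lerD// b// ?normrN gtr0_norm.
rewrite cintZ//.
move=> /eqP; rewrite mulf_eq0 oppr_eq0 => /orP[/eqP[/eqP]|/eqP//].
by rewrite oner_eq0.
Qed.

Let F2_linear (x : R) : F 2 x = (2 * Num.max x 0)%:C * F 3 1.
Proof.
have [x0|x0|->] := ltgtP x 0.
- have xC : (x%:C : R[i]) != 0 by apply: contraTneq x0 => -[->]; rewrite ltxx.
  apply: (mulfI xC); rewrite F_rec mulr0 mul0r mulr0.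
  by rewrite (@F3_quadratic (-1)) ?F3_neg ?mulr0// mulN1r oppr_gt0.
- have xC : (x%:C : R[i]) != 0 by apply: contraTneq x0 => -[->]; rewrite ltxx.
  apply: (mulfI xC); rewrite F_rec (@F3_quadratic 1) ?mul1r//.
  by rewrite expr1n divr1 rmorphXn rmorphM rmorph_nat /=; ring.
- by rewrite F2_0 mulr0 mul0r.
Qed.

(** The Laplace transform of the ramp at the point $2c$, times [k]. It is one of the two evaluations
    that determine the remaining constant. *)
Let int_ramp (k : R[i]) :
  cint mu `[0, +oo[ (fun x => x%:C * (k * expc (- (2 * c)%:C * x%:C))) =
  k / (4 * c ^+ 2)%:C.
Proof.
have cC : (c%:C : R[i]) != 0 by apply: contraTneq c0 => -[->]; rewrite ltxx.
have ci : cintegrable mu `[0, +oo[ (fun x => x%:C * (k * expc (- (2 * c)%:C * x%:C))).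
  apply: cintegrable_le (integrableZl _ (cabs k * c^-1) (integrable_expRN 0 c0)) _ => //.
    by apply: cmeasM; [exact/cmeas_real|apply: cmeasM; [exact: cmeas_cst|
      exact/ccont_meas/ccont_expc_scale]].
  move=> x; rewrite /= in_itv/= andbT => x0.
  rewrite !cabsM cabs_real cabs_expc_scale /= ger0_norm// mulrCA -mulrA.
  rewrite ler_wpM2l ?cabs_ge0//.
  have -> : - (2 * c) * x = - (c * x) + - (c * x) by ring.
  rewrite expRD mulrA ler_wpM2r ?expR_ge0// expRN ler_pdivrMr ?expR_gt0//.
  by rewrite mulrC ler_pdivlMr// (le_trans _ (expR_ge1Dx _))// mulrC lerDr.
rewrite (cFTC_halfline (F := fun x => - (x%:C / (2 * c)%:C + ((4 * c ^+ 2)%:C)^-1) *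
   (k * expc (- (2 * c)%:C * x%:C))) _ _ ci (L := 0)).
- by rewrite !rmorph0 mul0r !add0r mulr0 expc0 mulr1 mulNr opprK mulrC.
- move=> x.
  have dl : cderiv (fun x : R => - (x%:C / (2 * c)%:C + ((4 * c ^+ 2)%:C)^-1)) x
      (- ((2 * c)%:C)^-1).
    apply: cderiv_ext (cderiv_id (- ((4 * c ^+ 2)%:C)^-1) (- ((2 * c)%:C)^-1) x) => r.
    by rewrite opprD addrC mulNr [r%:C * _]mulrC.
  apply: cderiv_eq (cderivM dl (cderivZ k (cderiv_expc_scale _ _))) _.
  by rewrite !rmorphM !rmorph_nat; field; rewrite cC.
- apply: ccontM; last by apply: ccontM; [exact: ccont_cst|exact: ccont_expc_scale].
  by apply: cderiv_ccont => x; exists 1; apply: cderiv_ext (cderiv_id 0 1 x) => r;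
    rewrite add0r mul1r.
- have cn0 : 0 <= c by exact: ltW.
  apply: (@cvg_pinfty0 _ _ ((c^-1 + c ^- 2) * (cabs k * (c^-1 * c^-1)))) => T T1.
  have T0 : 0 < T by exact: lt_le_trans T1.
  rewrite cabs_ge0 andTb subr0 !cabsM cabsN cabs_expc_scale.
  have -> : Re (- (2 * c)%:C) * T = - (c * T) + - (c * T) by rewrite ReN /=; ring.
  rewrite expRD; have e1 := expRN_le c0 T0.
  have T1C : cabs (T%:C / (2 * c)%:C + ((4 * c ^+ 2)%:C)^-1) <= (c^-1 + c ^- 2) * T.
    apply: (le_trans (cabsD _ _)); rewrite cabsM !cabsV !cabs_real.
    have c20 : 0 < c ^+ 2 by rewrite exprn_gt0.
    rewrite !gtr0_norm ?mulr_gt0// [leRHS]mulrDl lerD//.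
      by rewrite mulrC ler_wpM2r ?(ltW T0)// lef_pV2 ?posrE ?mulr_gt0//; lra.
    rewrite -[leLHS]mulr1 ler_pM ?invr_ge0 ?mulr_ge0 ?(ltW c20)//.
    by rewrite lef_pV2 ?posrE ?mulr_gt0//; lra.
  apply: (le_trans (ler_wpM2r _ T1C)); first by rewrite !mulr_ge0 ?cabs_ge0 ?expR_ge0.
  have -> : (c^-1 + c ^- 2) * (cabs k * (c^-1 * c^-1)) / T =
      (c^-1 + c ^- 2) * T * (cabs k * ((c^-1 / T) * (c^-1 / T))).
    by field; rewrite !gt_eqF.
  rewrite ler_wpM2l ?mulr_ge0 ?addr_ge0 ?invr_ge0 ?exprn_ge0 ?(ltW T0)//.
  by rewrite ler_wpM2l ?cabs_ge0// ler_pM ?expR_ge0.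
Qed.

(** The point $2c$ is chosen because $2c - s = \bar s$ on the line: the integrand is $\bar s/|s|^4$,
    which has an elementary primitive with an arctangent, and this is where $\pi$ enters. *)
Let cint_kappa : cint mu setT (fun y => s y ^- 2 / ((2 * c)%:C - s y)) =
  (pi / (2 * c ^+ 2))%:C.
Proof.
have cn0 : c != 0 by rewrite gt_eqF.
pose N (y : R) := c ^+ 2 + y ^+ 2.
have N0 y : 0 < N y by rewrite ltr_wpDr ?sqr_ge0 ?exprn_gt0.
have Nn0 y : N y != 0 by rewrite gt_eqF.
have E y : s y ^- 2 / ((2 * c)%:C - s y) = (c / N y ^+ 2) +i* (- y / N y ^+ 2).
  have D0 : (2 * c)%:C - s y != 0.
    by apply: neq0_Re_gt0; rewrite ReD ReN /= mulr_natl mulr2n addrK.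
  apply: (mulIf D0); rewrite divfK//.
  apply: (mulfI (expf_neq0 2 (line_neq0 c0 y))).
  rewrite mulfV ?expf_neq0 ?line_neq0// expr2.
  have H : N y = c ^+ 2 + y ^+ 2 by [].
  by apply: complex_ext; rewrite !reimE /=; field: H; rewrite Nn0.
have dN (y : R) : is_derive y 1 N (2 * y).
  apply: (is_derive_eq (is_deriveD (is_derive_cst (c ^+ 2) y 1)
    (is_deriveM (is_derive_id y 1) (is_derive_id y 1)))).
  by rewrite /GRing.scale /=; ring.
have dNV (y : R) : is_derive y 1 (fun y => (N y)^-1) (- (N y) ^- 2 * (2 * y)).
  by have := dN y; have := Nn0 y; exact: is_deriveV.
(* The primitive: real part $\frac{y}{2cN} + \frac{1}{2c^2}\arctan(y/c)$, imaginary part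
   $\frac{1}{2N}$. *)
pose H (y : R) : R[i] := (y * (N y)^-1 * (2 * c)^-1 + atan (y / c) * (2 * c ^+ 2)^-1)
  +i* ((N y)^-1 * 2^-1).
have dH y : cderiv H y (s y ^- 2 / ((2 * c)%:C - s y)).
  rewrite E; split => /=.
    have dl : is_derive y 1 (fun y : R => y / c) c^-1.
      apply: (is_derive_eq (is_deriveM (is_derive_id y 1) (is_derive_cst c^-1 y 1))).
      by rewrite /GRing.scale /=; ring.
    have da : is_derive y 1 (atan \o (fun y : R => y / c)) ((1 + (y / c) ^+ 2)^-1 * c^-1).
      exact: is_derive1_comp.
    have dd := is_deriveD
      (is_deriveM (is_deriveM (is_derive_id y 1) (dNV y)) (is_derive_cst (2 * c)^-1 y 1))
      (is_deriveM da (is_derive_cst (2 * c ^+ 2)^-1 y 1)).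
    apply: (is_derive_eq dd).
    have n1 : 1 + (y / c) ^+ 2 = N y / c ^+ 2 by rewrite /N; field.
    rewrite /GRing.scale /= n1.
    have -> : c / N y ^+ 2 = (2 * c ^+ 2 - 2 * (N y - y ^+ 2 - c ^+ 2)) / (2 * c) / N y ^+ 2.
      by rewrite /N; field; rewrite cn0 -/(N y) Nn0.
    by rewrite /N; field; rewrite cn0 -/(N y) Nn0.
  have dd := is_deriveM (dNV y) (is_derive_cst (2^-1 : R) y 1).
  apply: (is_derive_eq dd).
  by rewrite /GRing.scale /=; field; exact: Nn0.
have D y : (2 * c)%:C - s y = c -i* y.
  by apply: complex_ext; rewrite !reimE /=; ring.
have cH : ccont (fun y => s y ^- 2 / ((2 * c)%:C - s y)).
  apply: ccontM.
    by apply: cderiv_ccont => y; eexists; exact: cderiv_lineV.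
  apply: cderiv_ccont => y; eexists; apply: cderivV.
    by rewrite D; apply: neq0_Re_gt0.
  apply: cderivD; first exact: cderiv_cst.
  apply: cderiv_ext (cderiv_id (- c%:C) (- (0 +i* 1)) y) => r.
  by apply: complex_ext; rewrite !reimE /=; ring.
have ci : cintegrable mu setT (fun y => s y ^- 2 / ((2 * c)%:C - s y)).
  apply: cintegrable_le (integrable_lineV2 (c^-1 * lineK c)) _ => //.
    exact: ccont_meas.
  move=> y _; rewrite cabsM mulrC -mulrA ler_pM ?cabs_ge0 ?cabs_lineV2// cabsV.
  rewrite D lef_pV2 ?posrE// ?cabs_gt0 ?neq0_Re_gt0//.
  by rewrite (le_trans _ (Re_cabs _))//= ler_norm.
apply: (cFTC_line dH cH ci).
have e T : H T - H (- T) - (pi / (2 * c ^+ 2))%:C =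
    (T * (N T)^-1 * c^-1 + (atan (T / c) - pi / 2) * c ^- 2)%:C.
  have NE : N (- T) = N T by rewrite /N sqrrN.
  apply: complex_ext; rewrite !reimE /= NE; last by ring.
  rewrite !mulNr atanN; move: (Nn0 T) => n0.
  by field; rewrite cn0 n0.
under eq_fun do rewrite e cabs_real.
rewrite -(@normr0 _ R); apply: cvg_norm; rewrite -(addr0 0); apply: cvgD.
  apply: (@cvg_pinfty0 _ _ c^-1) => T T1; have T0 : 0 < T by exact: lt_le_trans T1.
  rewrite !mulr_ge0 ?invr_ge0 ?(ltW T0) ?(ltW (N0 T)) ?(ltW c0)//= mulrC.
  rewrite ler_wpM2l ?invr_ge0 ?(ltW c0)// ler_pdivrMr// mulrC ler_pdivlMr//.
  by rewrite /N -expr2 lerDr sqr_ge0.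
rewrite -(mul0r (c ^- 2)); apply: cvgM; last exact: cvg_cst.
apply/subr_cvg0; apply: (@cvg_comp _ _ _ (fun T : R => T / c) atan); last exact: cvgy_atan.
by apply: gt0_cvgMly; [rewrite invr_gt0|exact: cvg_id].
Qed.

(** The Laplace transform of [F 2] at $2c$ is computed twice: from its linear form by [int_ramp],
    and by exchanging the integrals, which leads to [cint_kappa]. *)
Let kappaE : 2 * F 3 1 = (2 * pi)%:C.
Proof.
pose w (x : R) : R := if 0 <= x then 1 else 0.
have mw : measurable_fun setT (w : measurableTypeR R -> R).
  by apply: measurable_fun_ifT => //; exact: measurable_fun_ler.
pose P (y x : R) : R[i] := (w x)%:C * (expc (- ((2 * c)%:C - s y) * x%:C) * s y ^- 2).
have mP : cmeas setT (fun p : measurableTypeR R * measurableTypeR R => P p.1 p.2).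
  have ml (g : R -> R[i]) : ccont g -> cmeas setT (fun p : measurableTypeR R * measurableTypeR R => g p.1).
    by move=> cg; apply: cmeas_fst; exact: ccont_meas.
  apply: cmeasM.
    by apply: (@cmeas_snd _ _ (measurableTypeR R) (measurableTypeR R) _ (fun x => (w x)%:C)); exact: cmeas_real.
  apply: cmeasM; last first.
    by apply: (ml (fun y => s y ^- 2)); apply: cderiv_ccont => y; eexists; exact: cderiv_lineV.
  apply: cmeas_expc; apply: cmeasM.
    apply: (ml (fun y => - ((2 * c)%:C - s y))); apply: ccontN; apply: ccontD.
      exact: ccont_cst.
    by apply: ccontN; apply: cderiv_ccont => y; eexists; exact: cderiv_line.
  by apply: (@cmeas_snd _ _ (measurableTypeR R) (measurableTypeR R) _ (fun x => x%:C)); exact: cmeas_real.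
have ih : mu.-integrable setT (EFin \o (fun x => w x * expR (- (c * x)))).
  have := integrable_expRN 0 c0; rewrite integrable_mkcond//.
  apply: eq_integrable => // x _ /=; rewrite patchE mem_setE in_itv/= andbT /w.
  by case: ifPn; rewrite ?mul1r ?mul0r.
have Pb y x : cabs (P y x) <= lineK c * (1 + y ^+ 2)^-1 * (w x * expR (- (c * x))).
  rewrite /P !cabsM cabs_real.
  have -> : cabs (expc (- ((2 * c)%:C - s y) * x%:C)) = expR (- (c * x)).
    by rewrite cabs_expc !reimE /=; congr expR; ring.
  have w0 : 0 <= w x by rewrite /w; case: ifPn.
  rewrite ger0_norm// mulrA [leLHS]mulrC ler_wpM2r ?cabs_lineV2//.
  by rewrite mulr_ge0 ?expR_ge0.
have := cfubini (integrable_lineV2 (lineK c)) ih mP Pb.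
have -> : cint mu setT (fun y => cint mu setT (P y)) =
    cint mu setT (fun y => s y ^- 2 / ((2 * c)%:C - s y)).
  apply: eq_cint => y _.
  have z0 : 0 < Re ((2 * c)%:C - s y) by rewrite !reimE /= mulr_natl mulr2n addrK.
  rewrite (@cint_mkcond _ _ _ mu `[0, +oo[%classic
     (fun x => s y ^- 2 * expc (- ((2 * c)%:C - s y) * x%:C))).
  - rewrite cintZ//; last exact: cintegrable_expc.
    by rewrite cint_expc// rmorph0 mulr0 expc0 mul1r.
  - by move=> x; rewrite /= in_itv/= andbT /P /w => ->; rewrite mul1r mulrC.
  - move=> x; rewrite /= in_itv/= andbT /P /w => /negP/negbTE ->.
    by rewrite mul0r.
rewrite cint_kappa.
have -> : cint mu setT (fun x => cint mu setT (P^~ x)) = 2 * F 3 1 / (4 * c ^+ 2)%:C.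
  rewrite -int_ramp; apply: cint_mkcond => x; rewrite /= in_itv/= andbT => x0.
    have -> : x%:C * (2 * F 3 1 * expc (- (2 * c)%:C * x%:C)) = expc (- (2 * c)%:C * x%:C) * F 2 x.
      by rewrite F2_linear max_l// rmorphM rmorph_nat /=; ring.
    rewrite /F -cintZ//; apply: eq_cint => y _.
    rewrite /P /w x0 mul1r mulrA -expcD; congr (expc _ * _).
    by ring.
  rewrite (_ : cint _ _ _ = cint mu setT (fun y => 0 * (expc (s y * x%:C) * s y ^- 2))).
    by rewrite cintZ// mul0r.
  apply: eq_cint => y _; rewrite /P /w.
  by move/negP/negbTE: x0 => ->; rewrite !mul0r.
have cC : (c%:C : R[i]) != 0 by apply: contraTneq c0 => -[->]; rewrite ltxx.
move=> /(congr1 (fun z => z * (4 * c ^+ 2)%:C)).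
rewrite divfK; last by rewrite rmorphM mulf_neq0 ?rmorph_nat ?pnatr_eq0// rmorphXn expf_neq0.
move=> <-; rewrite -rmorphM; congr (_%:C); field.
by rewrite gt_eqF.
Qed.

Lemma ramp_inversion (x : R) :
  cint mu setT (fun y => expc (s y * x%:C) * s y ^- 2) =
  (2 * pi * Num.max x 0)%:C.
Proof.
rewrite -/(F 2 x) F2_linear (rmorphM _ (2 * pi)) /= -kappaE (rmorphM _ 2) rmorph_nat /=.
by ring.
Qed.

End ramp_inversion.

(** * The exponential integral and the Euler constant *)

Section mean_value.
Context {R : realType}.

Lemma is_derive_bound (f f' : R -> R) (a b m M : R) : a <= b ->
  (forall x, a <= x <= b -> is_derive x 1 f (f' x) /\ m <= f' x <= M) ->
  m * (b - a) <= f b - f a <= M * (b - a).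
Proof.
rewrite le_eqVlt => /predU1P[->|ab] df; first by rewrite !subrr !mulr0 lexx.
have dd x : a <= x <= b -> is_derive x 1 f (f' x) by move=> /df[].
have oo x : x \in `]a, b[ -> is_derive x 1 f (f' x).
  by rewrite in_itv/= => /andP[ax xb]; apply: dd; rewrite !ltW.
have [|x] := @MVT R f f' a b ab oo.
  apply: derivable_within_continuous => x; rewrite in_itv/= => /dd ?.
  exact: ex_derive.
rewrite in_itv/= => /andP[ax xb] ->.
have [|_ /andP[m1 m2]] := df x; first by rewrite !ltW.
have ba : 0 <= b - a by rewrite subr_ge0 ltW.
by rewrite !ler_wpM2r.
Qed.

Lemma cderiv_bound (f f' : R -> R[i]) (a b M : R) : a <= b ->
  (forall x, a <= x <= b -> cderiv f x (f' x) /\ cabs (f' x) <= M) ->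
  cabs (f b - f a) <= 2 * M * (b - a).
Proof.
move=> ab df; rewrite (le_trans (cabs_le_ReIm _))// ReD ReN ImD ImN.
rewrite -mulrA mulr_natl mulr2n lerD// ler_norml -mulNr.
  apply: (@is_derive_bound (fun x => Re (f x)) (fun x => Re (f' x))) => // x /df[[]].
  by move=> fr _ fM; split=> //; rewrite -ler_norml (le_trans (Re_cabs _)).
apply: (@is_derive_bound (fun x => Im (f x)) (fun x => Im (f' x))) => // x /df[[]].
by move=> _ fi fM; split=> //; rewrite -ler_norml (le_trans (Im_cabs _)).
Qed.

(** Mean value bound for $r \mapsto e^{-rz}$ on $[0,1]$, where the exponential has modulus at most
    1. *)
Lemma cabs_1Bexpc (z : R[i]) : 0 <= Re z -> cabs (1 - expc (- z)) <= 2 * cabs z.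
Proof.
move=> z0; rewrite -[leLHS]cabsN opprB.
have := @cderiv_bound (fun r => expc (- z * r%:C)) (fun r => - z * expc (- z * r%:C))
  0 1 (cabs z) ler01.
rewrite rmorph0 rmorph1 mulr0 mulr1 expc0 subr0 mulr1; apply.
move=> x /andP[x0 _]; split; first exact: cderiv_expc_scale.
rewrite cabsM cabsN ler_piMr ?cabs_ge0// cabs_expc_scale.
by rewrite -(@expR0 R) ler_expR ReN mulNr oppr_le0 mulr_ge0.
Qed.

Lemma cderiv_logc (f : R -> R[i]) (x : R) (l : R[i]) : 0 < Re (f x) ->
  cderiv f x l -> cderiv (fun r => logc (f r)) x (l / f x).
Proof.
move=> f0 [fr fi].
have n0 : 0 < Re (f x) ^+ 2 + Im (f x) ^+ 2 by rewrite ltr_wpDr ?sqr_ge0 ?exprn_gt0.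
pose N : R -> R := (fun r => Re (f r)) * (fun r => Re (f r)) +
  (fun r => Im (f r)) * (fun r => Im (f r)).
have NE : N x = Re (f x) ^+ 2 + Im (f x) ^+ 2 by rewrite !expr2.
have dN := is_deriveD (is_deriveM fr fr) (is_deriveM fi fi).
have N0 : 0 < N x by rewrite NE.
have rn0 : Re (f x) != 0 by rewrite gt_eqF.
split.
  have d1 : is_derive x 1 (Num.sqrt \o N) ((2 * Num.sqrt (N x))^-1 *
      (2 * Re (f x) * Re l + 2 * Im (f x) * Im l)).
    apply: (@is_derive1_comp _ Num.sqrt N); first exact: is_derive1_sqrt.
    by apply: (is_derive_eq dN); rewrite /GRing.scale /=; ring.
  have d2 : is_derive x 1 (@ln R \o (Num.sqrt \o N)) ((Num.sqrt (N x))^-1 *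
      ((2 * Num.sqrt (N x))^-1 * (2 * Re (f x) * Re l + 2 * Im (f x) * Im l))).
    apply: (@is_derive1_comp _ (@ln R) (Num.sqrt \o N)) => //.
    by apply: is_derive1_ln; rewrite /= sqrtr_gt0.
  rewrite (_ : (fun _ => _) = @ln R \o (Num.sqrt \o N)); last first.
    by apply/funext => r; rewrite /= !expr2.
  apply: (is_derive_eq d2).
  have -> : (Num.sqrt (N x))^-1 *
      ((2 * Num.sqrt (N x))^-1 * (2 * Re (f x) * Re l + 2 * Im (f x) * Im l)) =
      (2 * Re (f x) * Re l + 2 * Im (f x) * Im l) / (2 * Num.sqrt (N x) ^+ 2).
    by field; rewrite gt_eqF// sqrtr_gt0.
  rewrite sqr_sqrtr ?(ltW N0)// NE !reimE.
  by field; rewrite gt_eqF.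
have dV := @is_deriveV _ (fun r => Re (f r)) x _ 1 rn0 fr.
have d1 := is_deriveM fi dV.
have d2 : is_derive x 1 (atan \o ((fun r => Im (f r)) * (fun r => (Re (f r))^-1)))
    ((1 + (Im (f x) / Re (f x)) ^+ 2)^-1 *
     (Im l / Re (f x) - Im (f x) * Re l / Re (f x) ^+ 2)).
  apply: (@is_derive1_comp _ atan ((fun r => Im (f r)) * (fun r => (Re (f r))^-1))).
  by apply: (is_derive_eq d1); rewrite /GRing.scale /=; field.
apply: (is_derive_eq d2).
have -> : 1 + (Im (f x) / Re (f x)) ^+ 2 = (Re (f x) ^+ 2 + Im (f x) ^+ 2) / Re (f x) ^+ 2.
  by field.
rewrite !reimE.
by field; rewrite rn0 gt_eqF.
Qed.

End mean_value.

(** * The exponential integral $E_1$ and its derivative *)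

Section exponential_integral.
Context {R : realType}.
Local Notation mu := (@lebesgue_measure R).

(** Extended by 0 below 1, so that convolutions and Laplace integrals run over the whole line. *)
Definition wt (t : R) : R := if 1 <= t then t^-1 else 0.

(** This is [t * wt t]. It arises when $E_1$ is differentiated and when a convolution with [wt] is
    multiplied by its argument. *)
Definition wt1 (t : R) : R := if 1 <= t then 1 else 0.

Lemma wt_ge0 t : 0 <= wt t.
Proof. by rewrite /wt; case: ifPn => // t1; rewrite invr_ge0 (le_trans _ t1). Qed.

Lemma wt1_ge0 t : 0 <= wt1 t.
Proof. by rewrite /wt1; case: ifPn. Qed.

Lemma wt_le t : wt t <= wt1 t.
Proof. by rewrite /wt /wt1; case: ifPn => // t1; rewrite invf_le1// (lt_le_trans _ t1). Qed.

Lemma wt_t t : t * wt t = wt1 t.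
Proof.
rewrite /wt /wt1; case: ifPn => [t1|_]; last by rewrite mulr0.
by rewrite divff// gt_eqF// (lt_le_trans _ t1).
Qed.

Lemma measurable_wt1 : measurable_fun setT (wt1 : measurableTypeR R -> R).
Proof. by apply: measurable_fun_ifT => //; exact: measurable_fun_ler. Qed.

Lemma measurable_wt : measurable_fun setT (wt : measurableTypeR R -> R).
Proof.
(* The maximum keeps the denominator away from 0, so this branch is continuous on the whole line. *)
rewrite (_ : wt = fun t => if 1 <= t then (Num.max t 1)^-1 else 0); last first.
  by apply/funext => t; rewrite /wt; case: ifPn => // t1; rewrite max_l.
apply: measurable_fun_ifT => //; first exact: measurable_fun_ler.
apply: continuous_measurable_fun => t; apply: cvgV.
  by rewrite gt_eqF// lt_max ltr01 orbT.
by apply: continuous_max; [exact: cvg_id|exact: cvg_cst].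
Qed.

Lemma integrable_wt1_expR (a : R) : 0 < a ->
  mu.-integrable setT (EFin \o (fun t => wt1 t * expR (- (a * t)))).
Proof.
move=> a0; have := integrable_expRN 1 a0; rewrite integrable_mkcond//.
apply: eq_integrable => // x _ /=; rewrite patchE mem_setE in_itv/= andbT /wt1.
by case: ifPn; rewrite ?mul1r ?mul0r.
Qed.

Lemma integrable_wt_expR (a : R) : 0 < a ->
  mu.-integrable setT (EFin \o (fun t => wt t * expR (- (a * t)))).
Proof.
move=> a0; apply: (le_integrable _ _ _ (integrable_wt1_expR a0)) => //.
  apply/measurable_EFinP/measurable_funM; first exact: measurable_wt.
  by apply: measurableT_comp => //; apply: measurableT_comp => //; exact: mulrl_measurable.
move=> t _ /=; rewrite lee_fin !normrM ler_wpM2r//.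
by rewrite !ger0_norm ?wt_le ?wt_ge0 ?wt1_ge0.
Qed.

Definition E1 (z : R[i]) : R[i] :=
  cint mu setT (fun t => (wt t)%:C * expc (- z * t%:C)).

Lemma cmeas_wt_expc (z : R[i]) : cmeas setT
  (fun t : measurableTypeR R => (wt t)%:C * expc (- z * t%:C)).
Proof.
apply: cmeasM; first by apply: cmeas_real; exact: measurable_wt.
exact/ccont_meas/ccont_expc_scale.
Qed.

Lemma cabs_wt_expc (z : R[i]) t :
  cabs ((wt t)%:C * expc (- z * t%:C)) = wt t * expR (- (Re z * t)).
Proof. by rewrite cabsM cabs_real cabs_expc_scale ger0_norm ?wt_ge0// ReN mulNr. Qed.

Lemma cintegrable_E1 (z : R[i]) : 0 < Re z ->
  cintegrable mu setT (fun t => (wt t)%:C * expc (- z * t%:C)).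
Proof.
move=> z0; apply: cintegrable_le (integrable_wt_expR z0) _ => //.
  exact: cmeas_wt_expc.
by move=> t _; rewrite cabs_wt_expc.
Qed.

(** Differentiating $e^{-zt}$ cancels the weight $1/t$, and what remains is an elementary
    exponential integral. An arbitrary direction [d] covers both the real axis and vertical
    lines. *)
Lemma cderiv_E1 (z d : R[i]) (r : R) : 0 < Re (z + d * r%:C) ->
  cderiv (fun r => E1 (z + d * r%:C)) r
    (- d * expc (- (z + d * r%:C)) / (z + d * r%:C)).
Proof.
set a := Re _ => a0.
(* On a window of this radius the real part stays at least $a/2$; adding 1 to $|d|$ allows $d =
   0$. *)
pose e := a / (2 * (1 + cabs d)).
have d1 : 0 < 1 + cabs d by rewrite ltr_wpDr ?cabs_ge0.
have e0 : 0 < e by rewrite divr_gt0// mulr_gt0.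
have far x : `]r - e, r + e[%classic x -> a / 2 <= Re (z + d * x%:C).
  rewrite /= in_itv/= => /andP[rx xr].
  have -> : Re (z + d * x%:C) = a + Re (d * (x - r)%:C).
    by rewrite /a !reimE /=; ring.
  have : `|Re (d * (x - r)%:C)| <= a / 2.
    rewrite (le_trans (Re_cabs _))// cabsM cabs_real.
    have -> : a / 2 = (1 + cabs d) * e by rewrite /e; field; rewrite gt_eqF.
    rewrite ler_pM ?cabs_ge0//; first by rewrite lerDr.
    by rewrite ler_norml; apply/andP; split; lra.
  by rewrite ler_norml => /andP[]; lra.
have a2 : 0 < a / 2 by rewrite divr_gt0.
have -> : - d * expc (- (z + d * r%:C)) / (z + d * r%:C) =
   cint mu setT (fun t => - d * ((wt1 t)%:C * expc (- (z + d * r%:C) * t%:C))).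
  rewrite (@cint_mkcond _ _ _ mu `[1, +oo[%classic
    (fun t => - d * expc (- (z + d * r%:C) * t%:C))).
  - rewrite cintZ//; last exact: cintegrable_expc.
    by rewrite cint_expc// rmorph1 mulr1 mulrA.
  - by move=> t; rewrite /= in_itv/= andbT /wt1 => ->; rewrite mul1r.
  - move=> t; rewrite /= in_itv/= andbT /wt1 => /negP/negbTE ->.
    by rewrite mul0r mulr0.
apply: (@cderiv_under_integral _ _ _ mu _
  (fun x t => - d * ((wt1 t)%:C * expc (- (z + d * x%:C) * t%:C))) setT
  (fun t => cabs d * (wt1 t * expR (- (a / 2 * t)))) r (r - e) (r + e)) => //.
- by rewrite /= in_itv/=; apply/andP; split; lra.
- by move=> x /far xa; apply: cintegrable_E1; exact: lt_le_trans xa.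
- move=> x t _ _.
  have dl : cderiv (fun x : R => - (z + d * x%:C) * t%:C) x (- d * t%:C).
    apply: cderiv_ext (cderiv_id (- z * t%:C) (- d * t%:C) x) => q.
    by ring.
  apply: cderiv_eq (cderivZ (wt t)%:C (cderiv_expc dl)) _.
  by rewrite -wt_t rmorphM /=; ring.
- exact: (integrableZl measurableT _ (integrable_wt1_expR a2)).
- move=> x t /far xa _; rewrite !cabsM cabsN cabs_real ger0_norm ?wt1_ge0//.
  rewrite ler_wpM2l ?cabs_ge0// cabs_expc_scale ReN.
  have [t1|t1] := leP 1 t; last first.
    have -> : wt1 t = 0 by rewrite /wt1 leNgt t1.
    by rewrite !mul0r.
  rewrite ler_wpM2l ?wt1_ge0// ler_expR mulNr lerN2 ler_wpM2r//.
  by rewrite (le_trans _ t1).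
Qed.

End exponential_integral.

(** * Behaviour of $E_1$ near 0 and the constant $\gamma$ *)

Section euler_constant.
Context {R : realType}.
Local Notation mu := (@lebesgue_measure R).

(** This is $\mathrm{Ein}(z) - \gamma$ with $\mathrm{Ein}(z) = \int_0^z (1 - e^{-t})\,dt/t$. The
    logarithmic singularity of $E_1$ cancels, and the derivative is bounded on the right
    half-plane. *)
Definition Psi (z : R[i]) : R[i] := E1 z + logc z.

Lemma cderiv_Psi (z d : R[i]) (r : R) : 0 < Re (z + d * r%:C) ->
  cderiv (fun r => Psi (z + d * r%:C)) r
    (d * (1 - expc (- (z + d * r%:C))) / (z + d * r%:C)).
Proof.
move=> p; apply: cderiv_eq (cderivD (cderiv_E1 p) (cderiv_logc p (cderiv_id z d r))) _.
by rewrite -mulrDl; congr (_ / _); ring.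
Qed.

Definition e1 (a : R) : R := \int[mu]_t (wt t * expR (- (a * t))).

Lemma E1_real (a : R) : E1 a%:C = (e1 a)%:C.
Proof.
have e t : (wt t)%:C * expc (- a%:C * t%:C) = (wt t * expR (- (a * t)))%:C :> R[i].
  have -> : - a%:C * t%:C = (- (a * t))%:C :> R[i] by rewrite rmorphN rmorphM mulNr.
  by rewrite expc_real rmorphM.
rewrite /E1 (@eq_cint _ _ _ mu setT _ _ (fun t _ => e t)); apply: complex_ext => //=.
by rewrite Rintegral_cst// mul0r.
Qed.

Lemma e1_ge0 a : 0 <= e1 a.
Proof. by apply: Rintegral_ge0 => t _; rewrite mulr_ge0 ?wt_ge0 ?expR_ge0. Qed.

Lemma e1_le (a : R) : 0 < a -> e1 a <= a^-1.
Proof.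
move=> a0; apply: (@le_trans _ _ (\int[mu]_t (wt1 t * expR (- (a * t))))).
  apply: le_Rintegral => //; [exact: integrable_wt_expR|exact: integrable_wt1_expR|].
  by move=> t _; rewrite ler_wpM2r ?expR_ge0 ?wt_le.
have := @cint_expc R a%:C 1 a0.
rewrite -(@cint_mkcond _ _ _ mu `[1, +oo[%classic
  (fun t => expc (- a%:C * t%:C)) (fun t => (wt1 t * expR (- (a * t)))%:C)); last 2 first.
- move=> t; rewrite /= in_itv/= andbT /wt1 => ->; rewrite mul1r -expc_real.
  by congr expc; rewrite rmorphN rmorphM mulNr.
- by move=> t; rewrite /= in_itv/= andbT /wt1 => /negP/negbTE ->; rewrite mul0r.
rewrite rmorph1 mulr1 -rmorphN expc_real -fmorphV -rmorphM => /(congr1 (@complex.Re R)) /= ->.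
by rewrite ler_piMl ?invr_ge0 ?(ltW a0)// -(@expR0 R) ler_expR oppr_le0 ltW.
Qed.

Definition psi (a : R) : R := Re (Psi a%:C).

Lemma Psi_real a : 0 < a -> Psi a%:C = (psi a)%:C.
Proof.
move=> a0; apply: complex_ext => //.
by rewrite /Psi ImD E1_real /= mul0r atan0 addr0.
Qed.

Lemma psiE a : 0 < a -> psi a = e1 a + ln a.
Proof.
move=> a0; rewrite /psi /Psi ReD E1_real /=.
by rewrite expr0n/= addr0 sqrtr_sqr gtr0_norm.
Qed.

Lemma is_derive_psi (a : R) : 0 < a -> is_derive a 1 psi ((1 - expR (- a)) / a).
Proof.
move=> a0; have p : 0 < Re (0 + 1 * a%:C) by rewrite add0r mul1r.
have [+ _] := cderiv_Psi p.
have -> : 1 * (1 - expc (- (0 + 1 * a%:C))) / (0 + 1 * a%:C) = ((1 - expR (- a)) / a)%:C.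
  by rewrite add0r !mul1r -rmorphN expc_real rmorphM rmorphB rmorph1 fmorphV.
move=> dp; rewrite (_ : psi = fun r => Re (Psi (0 + 1 * r%:C)))//.
by apply/funext => r; rewrite add0r mul1r.
Qed.

(** The derivative $(1 - e^{-x})/x$ lies in $[0, 1]$ for $x > 0$. *)
Lemma psi_mono a b : 0 < b -> b <= a -> 0 <= psi a - psi b <= a - b.
Proof.
move=> b0 ba; rewrite -[X in _ <= _ <= X]mul1r -[X in X <= _ <= _](mul0r (a - b)).
apply: (@is_derive_bound _ _ (fun x => (1 - expR (- x)) / x)) => // x /andP[bx xa].
have x0 : 0 < x := lt_le_trans b0 bx.
split; first exact: is_derive_psi.
rewrite divr_ge0 ?(ltW x0)//=; last by rewrite subr_ge0 -(@expR0 R) ler_expR oppr_le0 ltW.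
by rewrite ler_pdivrMr// mul1r lerBlDr -lerBlDl; exact: expR_ge1Dx.
Qed.

(** Since [psi] is increasing, this infimum is its limit at $0^+$. It is shown below to be
    $-\gamma$. *)
Let g := inf [set psi a | a in [set a : R | 0 < a]].

Let psi_g a : 0 < a -> g <= psi a <= g + a.
Proof.
move=> a0; have lb : lbound [set psi a | a in [set a : R | 0 < a]] (psi 1 - 1).
  move=> _ [b /= b0 <-]; have [b1|/ltW b1] := leP 1 b.
    by have /andP[] := psi_mono ltr01 b1; lra.
  by have /andP[] := psi_mono b0 b1; lra.
have ne : [set psi a | a in [set a : R | 0 < a]] !=set0 by exists (psi 1), 1 => //=.
apply/andP; split.
  by apply: ge_inf; [exists (psi 1 - 1)|exists a].
rewrite -lerBlDr; apply: lb_le_inf => // _ [b /= b0 <-].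
have [ba|/ltW ab] := leP b a.
  by have /andP[] := psi_mono b0 ba; lra.
by have /andP[] := psi_mono a0 ab; lra.
Qed.

(** The sum is $\int_0^x (1 - (1 - r/n)^n)\,dr/r$, a finite analogue of $\mathrm{Ein}$; at $x = n$
    it equals the harmonic number. *)
Let h n (x : R) : R := \sum_(i < n) (1 - (1 - x / n%:R) ^+ i.+1) / i.+1%:R.

Let h_derive n (x : R) : 0 < x -> (0 < n)%N ->
  is_derive x 1 (h n) ((1 - (1 - x / n%:R) ^+ n) / x).
Proof.
move=> x0 n0; have nR : n%:R != 0 :> R by rewrite pnatr_eq0 -lt0n.
have dl : is_derive x 1 (fun x : R => 1 - x / n%:R) (- n%:R^-1).
  have dd := is_deriveB (is_derive_cst (1 : R) x 1)
    (is_deriveM (is_derive_id x 1) (is_derive_cst (n%:R^-1 : R) x 1)).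
  by apply: (is_derive_eq dd); rewrite /GRing.scale /=; ring.
have di (i : nat) : is_derive x 1 (fun x : R => (1 - (1 - x / n%:R) ^+ i.+1) / i.+1%:R)
    (n%:R^-1 * (1 - x / n%:R) ^+ i).
  have dX := is_deriveX i.+1 dl; rewrite exprfctE in dX.
  have dd := is_deriveM (is_deriveB (is_derive_cst (1 : R) x 1) dX)
    (is_derive_cst (i.+1%:R^-1 : R) x 1).
  apply: (is_derive_eq dd); rewrite /GRing.scale /=.
  have iR : i.+1%:R != 0 :> R by rewrite pnatr_eq0.
  by move: (i.+1%:R) iR => k k0; field; rewrite nR k0.
have dh m : is_derive x 1 (fun x => \sum_(i < m) (1 - (1 - x / n%:R) ^+ i.+1) / i.+1%:R)
    (n%:R^-1 * \sum_(i < m) (1 - x / n%:R) ^+ i).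
  elim: m => [|m IH].
    rewrite big_ord0 mulr0 (_ : (fun _ => _) = cst 0); first exact: is_derive_cst.
    by apply/funext => r; rewrite big_ord0.
  have dd := is_deriveD IH (di m).
  rewrite (_ : (fun _ => _) = (fun x => \sum_(i < m) (1 - (1 - x / n%:R) ^+ i.+1) / i.+1%:R) +
     (fun x : R => (1 - (1 - x / n%:R) ^+ m.+1) / m.+1%:R)); last first.
    by apply/funext => r; rewrite big_ord_recr.
  by apply: (is_derive_eq dd); rewrite big_ord_recr/=; ring.
apply: (is_derive_eq (dh n)).
have := subrX1 (1 - x / n%:R) n.
set S := \sum_(i < n) _; set q := _ ^+ n => e.
have -> : q = 1 + (1 - x / n%:R - 1) * S by rewrite -e; ring.
by field; rewrite nR gt_eqF.
Qed.

Let bernoulli (m : nat) (t : R) : 0 <= t <= 1 -> 1 - m%:R * t <= (1 - t) ^+ m.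
Proof.
move=> /andP[t0 t1]; elim: m => [|m IH]; first by rewrite mul0r subr0 expr0.
rewrite exprS; apply: (le_trans _ (ler_wpM2l _ IH)); last by rewrite subr_ge0.
rewrite -natr1; have : 0 <= m%:R * t ^+ 2 by rewrite mulr_ge0 ?sqr_ge0.
by rewrite expr2; lra.
Qed.

(** The upper bound follows from $e^x(1-x/n)^n \ge ((1+x/n)(1-x/n))^n = (1 - x^2/n^2)^n \ge 1 -
    x^2/n$, the last step being Bernoulli's inequality. *)
Let exp_bernoulli n (x : R) : (0 < n)%N -> 0 < x <= n%:R ->
  0 <= expR (- x) - (1 - x / n%:R) ^+ n <= x ^+ 2 * expR (- x) / n%:R.
Proof.
move=> n0 /andP[x0 xn]; have nR : 0 < n%:R :> R by rewrite ltr0n.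
have q0 : 0 <= 1 - x / n%:R by rewrite subr_ge0 ler_pdivrMr// mul1r.
have en : expR (- x) = expR (- (x / n%:R)) ^+ n.
  by rewrite -expRM_natl; congr expR; field; rewrite gt_eqF.
have ep : expR x = expR (x / n%:R) ^+ n.
  by rewrite -expRM_natl; congr expR; field; rewrite gt_eqF.
apply/andP; split.
  by rewrite subr_ge0 en lerXn2r ?nnegrE ?expR_ge0// expR_ge1Dx.
have t01 : 0 <= (x / n%:R) ^+ 2 <= 1.
  rewrite sqr_ge0/= expr_le1// ?divr_ge0 ?(ltW x0)//.
  by rewrite ler_pdivrMr// mul1r.
have B := bernoulli n t01.
have key : (1 - (x / n%:R) ^+ 2) ^+ n <= (1 - x / n%:R) ^+ n * expR x.
  rewrite ep -exprMn; apply: lerXn2r; rewrite ?nnegrE.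
  - have /andP[_ ?] := t01; by rewrite subr_ge0.
  - by rewrite mulr_ge0 ?expR_ge0.
  - have -> : 1 - (x / n%:R) ^+ 2 = (1 - x / n%:R) * (1 + x / n%:R) by ring.
    by rewrite ler_wpM2l// expR_ge1Dx.
have : (1 - n%:R * (x / n%:R) ^+ 2) * expR (- x) <= (1 - x / n%:R) ^+ n.
  apply: (le_trans (ler_wpM2r (expR_ge0 _) (le_trans B key))).
  by rewrite -mulrA -expRD subrr expR0 mulr1.
have -> : n%:R * (x / n%:R) ^+ 2 = x ^+ 2 / n%:R by field; rewrite gt_eqF.
rewrite mulrBl mul1r [x ^+ 2 * _ / _]mulrAC; lra.
Qed.

(** The derivative of [h n - psi] lies between 0 and $xe^{-x}/n$. Hence [h n - psi] increases, while
    adding $(x+1)e^{-x}/n$ makes it decrease; this correction is at most $1/n$ because $1 + d \le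
    e^d$. *)
Let h_psi n (d : R) : (0 < n)%N -> 0 < d <= n%:R ->
  - n%:R^-1 <= (h n n%:R - psi n%:R) - (h n d - psi d) <= n%:R^-1.
Proof.
move=> n0 /andP[d0 dn]; have nR : 0 < n%:R :> R by rewrite ltr0n.
have n1 : 0 < n%:R^-1 :> R by rewrite invr_gt0.
have dx (x : R) : d <= x <= n%:R -> is_derive x 1 (fun x => h n x - psi x)
    ((expR (- x) - (1 - x / n%:R) ^+ n) / x).
  move=> /andP[dx xn]; have x0 : 0 < x := lt_le_trans d0 dx.
  have dd := is_deriveB (h_derive x0 n0) (is_derive_psi x0).
  by apply: (is_derive_eq dd); field; rewrite gt_eqF.
have de (x : R) : is_derive x 1 (fun x => (x + 1) * expR (- x) / n%:R)
    (- x * expR (- x) / n%:R).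
  have dN : is_derive x 1 (fun x : R => - x) (-1) by exact: is_deriveN (is_derive_id x 1).
  have dE : is_derive x 1 (expR \o (fun x : R => - x)) (expR (- x) * -1).
    exact: is_derive1_comp.
  have dd := is_deriveM (is_deriveM (is_deriveD (is_derive_id x 1) (is_derive_cst (1 : R) x 1)) dE)
    (is_derive_cst (n%:R^-1 : R) x 1).
  by apply: (is_derive_eq dd); rewrite !fctE /GRing.scale /=; ring.
have b (x : R) : d <= x <= n%:R -> 0 <= (expR (- x) - (1 - x / n%:R) ^+ n) / x <=
    x * expR (- x) / n%:R.
  move=> /andP[dxx xn]; have x0 : 0 < x := lt_le_trans d0 dxx.
  have /andP[b1 b2] := @exp_bernoulli n x n0 (introT andP (conj x0 xn)).
  rewrite divr_ge0 ?(ltW x0)//= ler_pdivrMr// (le_trans b2)//.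
  by rewrite le_eqVlt; apply/orP; left; apply/eqP; ring.
(* The constant [1 + n%:R] is a crude bound for the other side of the two-sided mean value
   estimate. *)
have /andP[lo _] : 0 * (n%:R - d) <= (h n n%:R - psi n%:R) - (h n d - psi d) <= (1 + n%:R) * (n%:R - d).
  apply: (@is_derive_bound _ (fun x => h n x - psi x) _ d n%:R 0 (1 + n%:R) dn) => x dxn; split; first exact: dx.
  have /andP[b1 b2] := b x dxn; rewrite b1/= (le_trans b2)//.
  move: dxn => /andP[dxx xn]; have x0 : 0 < x := lt_le_trans d0 dxx.
  apply: (@le_trans _ _ 1); last by rewrite lerDl ltW.
  rewrite ler_pdivrMr// mul1r (le_trans _ xn)// ler_piMr ?(ltW x0)//.
  by rewrite -(@expR0 R) ler_expR oppr_le0 ltW.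
have /andP[_ hi] : - (1 + n%:R) * (n%:R - d) <= 
    ((h n n%:R - psi n%:R) + (n%:R + 1) * expR (- n%:R) / n%:R) -
    ((h n d - psi d) + (d + 1) * expR (- d) / n%:R) <= 0 * (n%:R - d).
  have dd (x : R) (dxn : d <= x <= n%:R) := is_deriveD (dx x dxn) (de x).
  apply: (@is_derive_bound _ (fun x => (h n x - psi x) + (x + 1) * expR (- x) / n%:R)
    (fun x => (expR (- x) - (1 - x / n%:R) ^+ n) / x + - x * expR (- x) / n%:R)
    d n%:R _ 0 dn) => x dxn; split; first exact: dd.
  have /andP[b1 b2] := b x dxn.
  have /andP[dxx xn] := dxn; have x0 : 0 < x := lt_le_trans d0 dxx.
  have u : x * expR (- x) / n%:R <= 1 + n%:R.
    apply: (@le_trans _ _ 1); last by rewrite lerDl ltW.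
    rewrite ler_pdivrMr// mul1r (le_trans _ xn)// ler_piMr ?(ltW x0)//.
    by rewrite -(@expR0 R) ler_expR oppr_le0 ltW.
  by rewrite mulNr mulNr; apply/andP; split; lra.
move: lo hi; rewrite !mul0r => lo hi.
have e0 : 0 <= (n%:R + 1) * expR (- n%:R) / n%:R :> R.
  by rewrite !mulr_ge0 ?expR_ge0 ?addr_ge0 ?(ltW n1).
have e2 : (d + 1) * expR (- d) / n%:R <= n%:R^-1.
  rewrite ler_piMl ?(ltW n1)// expRN ler_pdivrMr ?expR_gt0// mul1r addrC.
  exact: expR_ge1Dx.
by apply/andP; split; lra.
Qed.

(** Taking $d = 1/n$ in [h_psi] leaves four errors of at most $1/n$: the estimate itself, [h n] at
    $1/n$, [psi] at $1/n$ against its infimum, and $E_1(n) = \psi(n) - \ln n$. *)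
Let harmonic_bound n : (0 < n)%N ->
  `|\sum_(1 <= i < n.+1) i%:R^-1 - ln n%:R + g| <= 4 / n%:R.
Proof.
move=> n0; have nR : 0 < n%:R :> R by rewrite ltr0n.
have n1 : 0 < n%:R^-1 :> R by rewrite invr_gt0.
have nge1 : 1 <= n%:R :> R by rewrite ler1n.
have ninv : n%:R^-1 <= n%:R :> R by rewrite (le_trans _ nge1)// invf_le1.
have hn : h n n%:R = \sum_(1 <= i < n.+1) i%:R^-1.
  rewrite big_add1 big_mkord; apply: eq_bigr => i _.
  by rewrite divff ?gt_eqF// subrr expr0n/= subr0 mul1r.
have hd : 0 <= h n n%:R^-1 <= n%:R^-1.
  have t01 : 0 <= (n%:R^-1 / n%:R : R) <= 1.
    rewrite divr_ge0 ?(ltW n1) ?(ltW nR)//= ler_pdivrMr// mul1r//.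
  have /andP[t0 t1] := t01; have q0 : 0 <= 1 - n%:R^-1 / n%:R :> R by lra.
  have q1 : 1 - n%:R^-1 / n%:R <= 1 :> R by lra.
  rewrite /h sumr_ge0/=; last first.
    by move=> i _; rewrite divr_ge0// subr_ge0 exprn_ile1.
  have nS : n%:R^-1 = \sum_(i < n) (n%:R^-1 / n%:R) :> R.
    by rewrite sumr_const card_ord -mulr_natr; field; rewrite gt_eqF.
  rewrite [leRHS]nS; apply: ler_sum => i _; rewrite ler_pdivrMr//.
  by rewrite lerBlDr -lerBlDl [_ * i.+1%:R]mulrC; exact: (bernoulli i.+1 t01).
have := @h_psi n n%:R^-1 n0; rewrite n1 ninv => /(_ isT); rewrite hn (psiE nR).
have /andP[g1 g2] := psi_g n1.
have := e1_ge0 n%:R; have := e1_le nR; move: hd => /andP[h1 h2] e2 e1' /andP[k1 k2].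
by rewrite ler_norml; apply/andP; split; lra.
Qed.

Let euler_gammaE : euler_gamma = - g.
Proof.
apply/cvg_lim => //; apply/subr_cvg0; apply/cvgr0Pnorm_le => e e0.
near=> n; rewrite opprK; have n0 : (0 < n)%N by near: n; exists 1%N.
apply: (le_trans (harmonic_bound n0)).
have nR : 0 < n%:R :> R by rewrite ltr0n.
rewrite ler_pdivrMr// mulrC -ler_pdivrMr//; near: n.
exact: nbhs_infty_ger.
Unshelve. all: by end_near. Qed.

Lemma psi_gamma a : 0 < a -> 0 <= psi a + euler_gamma <= a.
Proof. by move=> /psi_g /andP[p1 p2]; rewrite euler_gammaE; apply/andP; split; lra. Qed.

(** Move vertically from the real point [a]: the derivative bound 2, doubled by the componentwise
    mean value estimate, costs $4|y|$; at [a] itself the distance is at most $a$. Together this is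
    at most $5|a + iy|$. *)
Lemma Psi_gamma (a y : R) : 0 < a ->
  cabs (Psi (a +i* y) + euler_gamma%:C) <= 5 * cabs (a +i* y).
Proof.
move=> a0; have line (r : R) : a%:C + (0 +i* 1) * r%:C = a +i* r :> R[i].
  by apply: complex_ext; rewrite !reimE /=; ring.
have dPsi (r : R) : cderiv (fun r => Psi (a%:C + (0 +i* 1) * r%:C)) r
    ((0 +i* 1) * (1 - expc (- (a +i* r))) / (a +i* r)) /\
    cabs ((0 +i* 1) * (1 - expc (- (a +i* r))) / (a +i* r)) <= 2.
  have p : 0 < Re (a%:C + (0 +i* 1) * r%:C) by rewrite line.
  split; first by have := cderiv_Psi p; rewrite line.
  rewrite !cabsM cabsV ler_pdivrMr ?cabs_gt0 ?neq0_Re_gt0//.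
  have -> : cabs (0 +i* 1 : R[i]) = 1 by rewrite /= expr0n add0r expr1n sqrtr1.
  by rewrite mul1r cabs_1Bexpc//= ltW.
have dist : cabs (Psi (a +i* y) - Psi a%:C) <= 4 * `|y|.
  have [y0|/ltW y0] := leP 0 y.
    have := @cderiv_bound R _ _ 0 y 2 y0 (fun x _ => dPsi x).
    by rewrite !line subr0 ger0_norm// -natrM.
  have := @cderiv_bound R _ _ y 0 2 y0 (fun x _ => dPsi x).
  by rewrite !line sub0r -cabsN opprB ler0_norm// -natrM.
have -> : Psi (a +i* y) + euler_gamma%:C =
    (Psi (a +i* y) - Psi a%:C) + (psi a + euler_gamma)%:C.
  by rewrite (Psi_real a0) (rmorphD (real_complex R) (psi a)) /=; ring.
apply: (le_trans (cabsD _ _)); rewrite cabs_real.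
have /andP[p1 p2] := psi_gamma a0; rewrite ger0_norm//.
have h1 : `|y| <= cabs (a +i* y) := Im_cabs (a +i* y).
have h2 : a <= cabs (a +i* y) by rewrite (le_trans _ (Re_cabs (a +i* y))) ?ler_norm.
set A := cabs (_ - _) in dist *; set B := cabs (_ +i* _) in h1 h2 *.
lra.
Qed.

(** Passing to absolute values replaces $z$ by $\mathrm{Re}\,z$, so the bound is uniform along a
    vertical line. *)
Lemma cabs_E1_le (z : R[i]) : 0 < Re z ->
  cabs (E1 z) <= 2 * (Re z - ln (Re z) - euler_gamma).
Proof.
move=> z0; apply: (@le_trans _ _ (2 * e1 (Re z))).
  apply: (cabs_cint_le _ (cintegrable_E1 z0) (integrable_wt_expR z0)) => //.
  by move=> t _; rewrite cabs_wt_expc.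
by rewrite ler_pM2l//; have := psi_gamma z0; rewrite psiE// => /andP[p1 p2]; lra.
Qed.

End euler_constant.

(** * Iterated convolutions *)

Section weighted_convolution.
Context {R : realType}.
Local Notation mu := (@lebesgue_measure R).

(** A class stable under convolution with a weight supported on $[1,\infty)$: the integrand
    $w(t)f(u-t)$ is bounded and vanishes outside $1 \le t \le u$. *)
Definition causal (f : R -> R) :=
  [/\ measurable_fun setT (f : measurableTypeR R -> R), (forall u, 0 <= f u),
      (forall u, u < 0 -> f u = 0) & (forall v, exists B, forall u, u <= v -> f u <= B)].

Definition wconv (w f : R -> R) (u : R) : R := \int[mu]_t (w t * f (u - t)).

Definition unit_weight (w : R -> R) :=
  measurable_fun setT (w : measurableTypeR R -> R) /\ (forall t, 0 <= w t <= wt1 t).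

Lemma unit_weight_wt : unit_weight wt.
Proof. by split; [exact: measurable_wt|move=> t; rewrite wt_ge0 wt_le]. Qed.

Lemma unit_weight_wt1 : unit_weight wt1.
Proof. by split; [exact: measurable_wt1|move=> t; rewrite wt1_ge0 lexx]. Qed.

Let ind (v t : R) : R := if (1 <= t) && (t <= v) then 1 else 0.

Let ind_ge0 v t : 0 <= ind v t. Proof. by rewrite /ind; case: ifPn. Qed.

Let indE v t : ind v t = ((fun=> 1 : R) \_ (`[1, v]%classic : set R)) t.
Proof. by rewrite patchE mem_setE in_itv/= /ind. Qed.

Let integrable_ind v : mu.-integrable setT (EFin \o ind v).
Proof.
have : mu.-integrable `[1, v] (EFin \o (fun=> 1 : R)).
  apply: continuous_compact_integrable; first exact: segment_compact.
  by move=> x; exact: cvg_cst.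
rewrite integrable_mkcond//; apply: eq_integrable => // t _ /=.
by rewrite indE !patchE; case: ifP.
Qed.

Let Rintegral_ind v : \int[mu]_t ind v t = Num.max (v - 1) 0.
Proof.
rewrite (_ : Rintegral _ _ _ = \int[mu]_(t in `[1, v]) 1); last first.
  by rewrite [RHS]Rintegral_mkcond; apply: eq_Rintegral => t _; rewrite indE.
rewrite Rintegral_cst// mul1r /= lebesgue_measure_itv /= lte_fin.
case: ltP => v1 /=; first by rewrite max_l// subr_ge0 ltW.
by rewrite max_r// subr_le0.
Qed.

Section slice.
Variables (w f : R -> R).
Hypotheses (uw : unit_weight w) (cf : causal f).

Let slice_bound (v B u t : R) : (forall u, u <= v -> f u <= B) -> u <= v ->
  `|w t * f (u - t)| <= B * ind v t.
Proof.
case: uw => mw wb; case: cf => mf f0 fs _ fB uv; have /andP[w0 w1] := wb t.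
rewrite ger0_norm ?mulr_ge0// /ind.
have B0 : 0 <= B by rewrite (le_trans (f0 v))// fB.
move: w1; rewrite /wt1; case: ifPn => [t1 w1|t1 w1] /=; last first.
  by rewrite (_ : w t = 0) ?mul0r ?mulr0//; apply/eqP; rewrite eq_le w0 w1.
case: ifPn => [tv|]; last first.
  by rewrite -ltNge => vt; rewrite fs ?mulr0// subr_lt0 (le_lt_trans uv).
by rewrite mulr1 (le_trans (ler_wpM2r _ w1))// mul1r fB//; lra.
Qed.

Let measurable_slice (u : R) :
  measurable_fun setT (fun t : measurableTypeR R => w t * f (u - t)).
Proof.
case: uw => mw wb; case: cf => mf f0 fs _; apply: measurable_funM => //.
by apply: measurableT_comp => //; exact: measurable_funB.
Qed.

Lemma integrable_slice (u : R) : mu.-integrable setT (EFin \o (fun t => w t * f (u - t))).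
Proof.
case: (cf) => mf f0 fs /(_ u)[B fB].
apply: (le_integrable _ _ _ (integrableZl _ B (integrable_ind u))) => //.
  exact/measurable_EFinP.
move=> t _; rewrite /= lee_fin (le_trans (slice_bound t fB (lexx u)))//.
exact: ler_norm.
Qed.

Lemma causal_wconv : causal (wconv w f).
Proof.
case: (cf) => mf f0 fs fB; case: (uw) => mw wb; split.
- have m2 : measurable_fun setT (fun p : measurableTypeR R * measurableTypeR R =>
      (w p.2 * f (p.1 - p.2))%:E).
    apply/measurable_EFinP/measurable_funM; first exact: (measurableT_comp mw measurable_snd).
    apply: (measurableT_comp mf).
    by apply: measurable_funB; [exact: measurable_fst|exact: measurable_snd].
  have := @measurable_fun_fubini_tonelli_F _ _ (measurableTypeR R) (measurableTypeR R) R mu _ m2.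
  move=> /(_ _)/(measurableT_comp (@fine_measurable R setT measurableT)); apply=> -[x y].
  by rewrite lee_fin mulr_ge0//; have /andP[] := wb y.
- by move=> u; apply: Rintegral_ge0 => t _; rewrite mulr_ge0//; have /andP[] := wb t.
- move=> u u0; rewrite /wconv (_ : Rintegral _ _ _ = \int[mu]_(t in setT) 0).
    by rewrite Rintegral_cst// mul0r.
  apply: eq_Rintegral => t _; have := wb t; rewrite /wt1; case: ifPn => [t1 _|t1 wt0].
    by rewrite fs ?mulr0//; lra.
  by rewrite (_ : w t = 0) ?mul0r//; apply/eqP; rewrite eq_le andbC.
- move=> v; have [B vB] := fB v; exists (B * Num.max (v - 1) 0) => u uv.
  rewrite -Rintegral_ind -RintegralZl//; apply: le_Rintegral => //.
  - exact: integrable_slice.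
  - exact: (integrableZl measurableT _ (integrable_ind v)).
  - by move=> t _; rewrite (le_trans (ler_norm _))// slice_bound.
Qed.

End slice.

(** Fubini: the double integrand is bounded by [B] and supported in the square $[1,v]^2$. *)
Lemma wconvC (w w' f : R -> R) (v : R) : unit_weight w -> unit_weight w' -> causal f ->
  wconv w (wconv w' f) v = wconv w' (wconv w f) v.
Proof.
move=> uw uw' cf; case: (cf) => mf f0 fs fB; case: (uw) => mw wb; case: (uw') => mw' wb'.
have [B vB] := fB v.
have B0 : 0 <= B by rewrite (le_trans (f0 v))// vB.
have Zl (a : R) (w1 : R -> R) u : unit_weight w1 ->
    a * wconv w1 f u = \int[mu]_t (a * (w1 t * f (u - t))).
  by move=> uw1; rewrite RintegralZl//; exact: integrable_slice.
rewrite /wconv; under eq_Rintegral => r _ do rewrite (Zl _ _ _ uw').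
under [RHS]eq_Rintegral => r _ do rewrite (Zl _ _ _ uw).
have wz (w1 : R -> R) t : unit_weight w1 -> t < 1 -> w1 t = 0.
  move=> [_ /(_ t)]; rewrite /wt1 (leNgt 1 t) => + t1; rewrite t1/= => w10.
  by apply/eqP; rewrite eq_le andbC.
rewrite (@Rfubini _ _ (measurableTypeR R) (measurableTypeR R) R mu mu
  (fun t => B * ind v t) (ind v) (integrableZl measurableT B (integrable_ind v))
  (integrable_ind v) (fun r t => w r * (w' t * f (v - r - t)))).
- apply: eq_Rintegral => t _; apply: eq_Rintegral => r _.
  by rewrite mulrCA; congr (_ * (_ * f _)); ring.
- apply: measurable_funM; first exact: (measurableT_comp mw measurable_fst).
  apply: measurable_funM; first exact: (measurableT_comp mw' measurable_snd).
  apply: (measurableT_comp mf); apply: measurable_funB; last exact: measurable_snd.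
  by apply: measurable_funB => //; exact: measurable_fst.
- move=> r t; have /andP[w0 w1] := wb r; have /andP[w0' w1'] := wb' t.
  rewrite ger0_norm ?mulr_ge0//.
  have [r1|r1] := ltP r 1; first by rewrite (wz w)// mul0r !mulr_ge0.
  have [t1|t1] := ltP t 1; first by rewrite (wz w' t)// mul0r mulr0 !mulr_ge0.
  have [rv|rv] := ltP v r; first by rewrite fs ?mulr0 ?mulr_ge0//; lra.
  have [tv|tv] := ltP v t; first by rewrite fs ?mulr0 ?mulr_ge0//; lra.
  move: w1 w1'; rewrite /wt1 /ind r1 t1 rv tv /= !mulr1 => w1 w1'.
  rewrite (le_trans (ler_wpM2r _ w1)) ?mulr_ge0// mul1r.
  by rewrite (le_trans (ler_wpM2r _ w1'))// mul1r vB//; lra.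
Qed.

(** The base case is the unit step, so the agreement with the integral over tuples also holds for
    negative arguments. *)
Fixpoint Ik k : R -> R :=
  if k is k'.+1 then wconv wt (Ik k') else fun u => if 0 <= u then 1 else 0.

Fixpoint Jk k : R -> R :=
  if k is k'.+1 then wconv wt (Jk k') else fun u => Num.max u 0.

Lemma causal_Ik k : causal (Ik k).
Proof.
elim: k => [|k IH] /=; last exact: (causal_wconv unit_weight_wt IH).
split.
- by apply: measurable_fun_ifT => //; exact: measurable_fun_ler.
- by move=> u; case: ifPn.
- by move=> u; rewrite ltNge => /negbTE ->.
- by move=> v; exists 1 => u _; case: ifPn.
Qed.

Lemma causal_Jk k : causal (Jk k).
Proof.
elim: k => [|k IH] /=; last exact: (causal_wconv unit_weight_wt IH).
split.
- by apply: measurable_maxr.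
- by move=> u; rewrite le_max lexx orbT.
- by move=> u /ltW u0; rewrite max_r.
- move=> v; exists (Num.max v 0) => u uv.
  by rewrite ge_max !le_max uv lexx orbT.
Qed.

(** For the unit step this is the shifted ramp; commuting the convolutions with [wt1] and [wt]
    carries it to all [k]. *)
Lemma wconv_wt1_Ik k v : wconv wt1 (Ik k) v = Jk k (v - 1).
Proof.
elim: k v => [|k IH] v /=.
  rewrite -Rintegral_ind; apply: eq_Rintegral => t _.
  rewrite /wt1 /ind subr_ge0; case: (1 <= t); case: (t <= v); rewrite ?mulr1 ?mul0r ?mulr0//.
rewrite (wconvC _ unit_weight_wt1 unit_weight_wt (causal_Ik k)).
by apply: eq_Rintegral => t _; rewrite IH; congr (_ * Jk _ _); ring.
Qed.

(** Under the convolution write $v = t + (v - t)$. The part $t$ turns [wt] into [wt1] and gives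
    $J_k(v-1)$; the part $v - t$ multiplies $I_k(v-t)$ and is handled by induction. For $k = 0$ the
    truncated [k.-1] carries the coefficient 0. *)
Lemma mul_Ik k v : v * Ik k v = Jk k v + k%:R * Jk k.-1 (v - 1).
Proof.
elim: k v => [|k IH] v.
  by rewrite mul0r addr0 /=; case: (lerP 0 v) => v0; rewrite ?mulr1 ?mulr0.
have iI := integrable_slice unit_weight_wt (causal_Ik k) v.
have iI1 := integrable_slice unit_weight_wt1 (causal_Ik k) v.
have iJ := integrable_slice unit_weight_wt (causal_Jk k) v.
have iJ' := integrable_slice unit_weight_wt (causal_Jk k.-1) (v - 1).
have -> : v * Ik k.+1 v = \int[mu]_t (wt1 t * Ik k (v - t) +
    (wt t * Jk k (v - t) + k%:R * (wt t * Jk k.-1 (v - 1 - t)))).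
  rewrite /= /wconv -RintegralZl//; apply: eq_Rintegral => t _.
  rewrite -wt_t; have -> : k%:R * (wt t * Jk k.-1 (v - 1 - t)) =
     wt t * (k%:R * Jk k.-1 (v - t - 1)) by rewrite mulrCA; congr (_ * (_ * Jk _ _)); ring.
  by rewrite -mulrDr -IH; ring.
rewrite RintegralD//; last first.
  exact: (integrableD measurableT iJ (integrableZl measurableT _ iJ')).
rewrite RintegralD//; last exact: (integrableZl measurableT _ iJ').
rewrite RintegralZl// -/(wconv _ _ _) wconv_wt1_Ik -/(wconv _ _ _) /=.
rewrite addrCA; congr (_ + _); rewrite -natr1 mulrDl mul1r addrC; congr (_ + _).
by case: k {IH iI iI1 iJ iJ'} => [|k] /=; rewrite ?mul0r.
Qed.

End weighted_convolution.

(** * The integral over tuples as an iterated convolution *)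

Section dickman_integral.
Context {R : realType}.
Local Notation mu := (@lebesgue_measure R).

Let G k (u : R) (t : k.-tuple (measurableTypeR R)) : R :=
  (\prod_(i < k) wt (tnth t i)) * (if \sum_(i < k) tnth t i <= u then 1 else 0).

Let G_ge0 k u t : 0 <= @G k u t.
Proof.
by rewrite mulr_ge0//; [apply: prodr_ge0 => i _; exact: wt_ge0|case: ifPn].
Qed.

Let measurable_G k u : measurable_fun setT (@G k u).
Proof.
apply: measurable_funM.
  apply: measurable_prod => i _; apply: (measurableT_comp measurable_wt).
  exact: measurable_tnth.
apply: measurable_fun_ifT => //; apply: measurable_fun_ler => //.
by apply: measurable_sum => i; exact: measurable_tnth.
Qed.

Let G_cons k u x t : @G k.+1 u (tuple_of_pair (x, t)) = wt x * @G k (u - x) t.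
Proof.
rewrite /G !big_ord_recl tnth0 -mulrA; congr (_ * (_ * _)).
  by apply: eq_bigr => i _; rewrite tnthS; congr (wt (tnth _ _)); exact/val_inj.
rewrite lerBrDl; congr (if _ + _ <= _ then _ else _).
by apply: eq_bigr => i _; rewrite tnthS; congr (tnth _ _); exact/val_inj.
Qed.

(** Tonelli splits off the first coordinate $x$; the constraint on the others becomes a sum at most
    $u - x$, which is the convolution step. *)
Let integral_G k (u : R) :
  (\int[lebesgue_tuple k]_t (@G k u t)%:E)%E = (Ik k u)%:E.
Proof.
elim: k u => [|k IH] u.
  rewrite /lebesgue_tuple integral_dirac//; last first.
    by apply/measurable_EFinP; exact: measurable_G.
  by rewrite diracT mul1e /G !big_ord0 mul1r.
transitivity (\int[pushforward (mu \x lebesgue_tuple k)%E (@tuple_of_pair R k)]_t (@G k.+1 u t)%:E)%E.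
  by [].
have mG : measurable_fun setT (fun t => (@G k.+1 u t)%:E).
  by apply/measurable_EFinP; exact: measurable_G.
rewrite ge0_integral_pushforward//; last 2 first.
  exact: measurable_tuple_of_pair.
  by move=> t _; rewrite lee_fin G_ge0.
rewrite preimage_setT fubini_tonelli1/=; last 2 first.
  exact: (measurableT_comp mG (@measurable_tuple_of_pair R k)).
  by move=> t; rewrite lee_fin G_ge0.
have ii := integrable_slice unit_weight_wt (causal_Ik k) u.
rewrite /wconv /Rintegral fineK; last exact: integrable_fin_num.
apply: eq_integral => x _; rewrite /fubini_F /=.
under eq_integral => t _ do rewrite G_cons EFinM.
rewrite ge0_integralZl//.
- by rewrite IH.
- by apply/measurable_EFinP; exact: measurable_G.
- by move=> t _; rewrite lee_fin G_ge0.
- by rewrite lee_fin wt_ge0.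
Qed.

Lemma dickmanI_Ik k (u : R) : dickmanI k u = Ik k u.
Proof.
rewrite /dickmanI Rintegral_mkcond /Rintegral -[RHS]/(fine (Ik k u)%:E) -integral_G.
congr fine; apply: eq_integral => t _; congr (_%:E).
rewrite patchE /G; case: ifPn => [/set_mem[t1 tu]|].
  by rewrite tu mulr1; apply: eq_bigr => i _; rewrite /wt t1.
move=> /negP nt; case: ifPn => [tu|]; last by rewrite mulr0.
have [[i ti]|/forallNP all1] := pselect (exists i, ~ (1 <= tnth t i)).
  by rewrite (bigD1 i)//= /wt; move/negP/negbTE : ti => ->; rewrite !mul0r.
by case: nt; apply/mem_set; split=> // i; apply/negPn/negP => /negP; exact: all1.
Qed.

End dickman_integral.

(** * Contour integrals *)

Section contour.
Context {R : realType}.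
Variables (c u : R) (c0 : 0 < c) (u0 : 0 < u).
Local Notation mu := (@lebesgue_measure R).
Local Notation s y := (c +i* y).
Local Notation v := (u^-1).

Let E y := E1 (s y * v%:C).

Let v0 : 0 < v. Proof. by rewrite invr_gt0. Qed.

Let Re_sv y : Re (s y * v%:C) = c * v.
Proof. by rewrite ReM /= mulr0 subr0. Qed.

Let cv0 : 0 < c * v. Proof. exact: mulr_gt0. Qed.

Lemma ccont_E1_line : ccont E.
Proof.
have line r : (c * v)%:C + (0 +i* v) * r%:C = s r * v%:C.
  by apply: complex_ext; rewrite !reimE /=; ring.
apply: cderiv_ccont => y; eexists.
have p : 0 < Re ((c * v)%:C + (0 +i* v) * y%:C) by rewrite line Re_sv.
by apply: cderiv_ext (cderiv_E1 p) => r; rewrite line.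
Qed.

Let M := 2 * (c * v - ln (c * v) - euler_gamma).

Lemma cabs_E1_line y : cabs (E y) <= 2 * (c * v - ln (c * v) - euler_gamma).
Proof. by have := @cabs_E1_le R (s y * v%:C); rewrite Re_sv; exact. Qed.

Let M0 : 0 <= M. Proof. exact: le_trans (cabs_ge0 _) (cabs_E1_line 0). Qed.

(** The variable is rescaled by $1/u$, so that the line $\mathrm{Re}\,s = c$ stays fixed while $u$
    grows. *)
Definition contour_integrand k (x y : R) : R[i] :=
  expc (s y * (x * v)%:C) * s y ^- 2 * E y ^+ k.

Local Notation A := contour_integrand.

Lemma ccont_contour_integrand k x : ccont (A k x).
Proof.
apply: ccontM.
  apply: ccontM; apply: cderiv_ccont => y; eexists; first exact: cderiv_expc_line.
  exact: cderiv_lineV.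
elim: k => [|k IH]; first by under eq_fun do rewrite expr0; exact: ccont_cst.
by under eq_fun do rewrite exprS; apply: ccontM => //; exact: ccont_E1_line.
Qed.

Let A_bound k x y :
  cabs (A k x y) <= expR (c * (x * v)) * M ^+ k * lineK c * (1 + y ^+ 2)^-1.
Proof.
rewrite /A !cabsM cabs_expc_line cabsX.
have -> : expR (c * (x * v)) * M ^+ k * lineK c / (1 + y ^+ 2) =
  expR (c * (x * v)) * (lineK c * (1 + y ^+ 2)^-1) * M ^+ k by ring.
rewrite ler_pM ?mulr_ge0 ?expR_ge0 ?cabs_ge0 ?exprn_ge0 ?cabs_ge0//.
  by rewrite ler_wpM2l ?expR_ge0 ?cabs_lineV2.
by rewrite lerXn2r ?nnegrE ?cabs_ge0// cabs_E1_line.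
Qed.

Lemma cintegrable_contour_integrand k x : cintegrable mu setT (A k x).
Proof.
apply: cintegrable_le (integrable_lineV2 _) _ => //.
exact/ccont_meas/ccont_contour_integrand.
Qed.

(** Replacing $x$ by $x - t$ multiplies the integrand by $e^{-st/u}$; integrating this against [wt]
    produces one more factor $E_1(s/u)$. *)
Lemma contour_J k x : cint mu setT (A k x) = (2 * pi * (Jk k x * v))%:C.
Proof.
elim: k x => [|k IH] x.
  transitivity (cint mu setT (fun y => expc (s y * (x * v)%:C) * s y ^- 2)).
    by apply: eq_cint => y _; rewrite /A expr0 mulr1.
  rewrite (ramp_inversion c0); congr (_%:C); congr (_ * _).
  rewrite /= maxr_pMl ?(ltW v0)// mul0r//.
pose P (y t : R) : R[i] := (wt t)%:C * A k (x - t) y.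
have PE y t : P y t = A k x y * ((wt t)%:C * expc (- (s y * v%:C) * t%:C)).
  rewrite /P /A; have -> : s y * ((x - t) * v)%:C = s y * (x * v)%:C + - (s y * v%:C) * t%:C.
    by apply: complex_ext; rewrite !reimE /=; ring.
  by rewrite expcD; ring.
have mP : cmeas setT (fun p : measurableTypeR R * measurableTypeR R => P p.1 p.2).
  rewrite (_ : (fun _ => _) = (fun p => A k x p.1 *
     ((wt p.2)%:C * expc (- (s p.1 * v%:C) * p.2%:C)))); last by apply/funext => p; exact: PE.
  apply: cmeasM.
    apply: (@cmeas_fst _ _ (measurableTypeR R) (measurableTypeR R) _ (A k x)).
    exact/ccont_meas/ccont_contour_integrand.
  apply: cmeasM.
    apply: (@cmeas_snd _ _ (measurableTypeR R) (measurableTypeR R) _ (fun t => (wt t)%:C)).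
    by apply: cmeas_real; exact: measurable_wt.
  apply: cmeas_expc; apply: cmeasM; last first.
    apply: (@cmeas_snd _ _ (measurableTypeR R) (measurableTypeR R) _ (fun t => t%:C)).
    exact: cmeas_real.
  apply: (@cmeas_fst _ _ (measurableTypeR R) (measurableTypeR R) _ (fun y => - (s y * v%:C))).
  apply: ccont_meas => //; apply: ccontN; apply: ccontM; last exact: ccont_cst.
  by apply: cderiv_ccont => y; eexists; exact: cderiv_line.
have Pb y t : cabs (P y t) <= expR (c * (x * v)) * M ^+ k * lineK c * (1 + y ^+ 2)^-1 *
    (wt t * expR (- (c * v * t))).
  rewrite PE cabsM cabs_wt_expc Re_sv.
  by apply: ler_pM => //; rewrite ?cabs_ge0// mulr_ge0 ?wt_ge0 ?expR_ge0.
transitivity (cint mu setT (fun y => cint mu setT (P y))).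
  apply: eq_cint => y _; symmetry; rewrite (@eq_cint _ _ _ mu setT _ _ (fun t _ => PE y t)).
  rewrite cintZ//; first by rewrite /A (exprSr (E y) k) mulrA.
  by apply: cintegrable_E1; rewrite Re_sv.
rewrite (cfubini (integrable_lineV2 _) (integrable_wt_expR cv0) mP Pb).
have ij := integrable_slice unit_weight_wt (causal_Jk k) x.
transitivity (cint mu setT (fun t => (2 * pi * v)%:C * (wt t * Jk k (x - t))%:C)).
  apply: eq_cint => t _; rewrite /P cintZ//; last exact: cintegrable_contour_integrand.
  by rewrite IH !rmorphM /=; ring.
rewrite cintZ//; last first.
  by split => //; exact: integrable0.
have -> : cint mu setT (fun t => (wt t * Jk k (x - t))%:C) = (Jk k.+1 x)%:C.
  by apply: complex_ext => //=; rewrite Rintegral_cst// mul0r.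
by rewrite -rmorphM; congr (_%:C); ring.
Qed.

(** [mul_Ik] at $v = u$, divided by $u$, with [contour_J] at $x = u$ and $x = u - 1$; the shift by 1
    accounts for the factor $e^{-s/u}$. *)
Lemma contour_I k : (2 * pi * dickmanI k u)%:C = cint mu setT (fun y =>
  expc (s y) * s y ^- 2 * (E y ^+ k + k%:R * E y ^+ k.-1 * expc (- (s y * v%:C)))).
Proof.
have e y : expc (s y) * s y ^- 2 * (E y ^+ k + k%:R * E y ^+ k.-1 * expc (- (s y * v%:C))) =
    A k u y + k%:R * A k.-1 (u - 1) y.
  rewrite /A divff ?gt_eqF// mulr1.
  have -> : s y * ((u - 1) * v)%:C = s y + - (s y * v%:C).
    by apply: complex_ext; rewrite !reimE /=; field; rewrite gt_eqF.
  by rewrite expcD; ring.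
rewrite (@eq_cint _ _ _ mu setT _ _ (fun y _ => e y)) cintD//; last 2 first.
  exact: cintegrable_contour_integrand.
  by apply: cintegrableZ => //; exact: cintegrable_contour_integrand.
rewrite cintZ//; last exact: cintegrable_contour_integrand.
rewrite !contour_J -(rmorph_nat (real_complex R)) -rmorphM -rmorphD; congr (_%:C).
have -> : dickmanI k u = (Jk k u + k%:R * Jk k.-1 (u - 1)) / u.
  by rewrite dickmanI_Ik -mul_Ik mulrAC divff ?mul1r// gt_eqF.
by field; rewrite gt_eqF.
Qed.

End contour.

(** * Tail integrals of powers of the logarithm *)

Section log_tail.
Context {R : realType}.
Local Notation mu := (@lebesgue_measure R).

(** The term of degree $n+1$ in the exponential series, taken at $\ln t$. *)
Lemma ln_pow_le n (t : R) : 1 <= t -> ln t ^+ n * ln t <= n.+1`!%:R * t.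
Proof.
move=> t1; have t0 : 0 < t by exact: lt_le_trans t1.
have l0 : 0 <= ln t by exact: ln_ge0.
have := expR_ge1Dxn n l0; rewrite lnK ?posrE// => h.
have f0 : 0 < n.+1`!%:R :> R by rewrite ltr0n fact_gt0.
rewrite -exprSr -ler_pdivrMl// mulrC (le_trans _ h)// lerDr//.
Qed.

Lemma cvg_ln_pow_div n : ln t ^+ n / t @[t --> +oo] --> (0 : R).
Proof.
have lnoo : ln (t : R) @[t --> +oo] --> +oo.
  apply/cvgryPge => A; near=> t.
  have t0 : 0 < t by near: t; apply: nbhs_pinfty_gt; exact: num_real.
  have tA : expR A <= t by near: t; apply: nbhs_pinfty_ge; exact: num_real.
  by rewrite -[leLHS](@expRK R) ler_ln ?posrE ?expR_gt0.
have l0 : \forall t \near +oo, 0 < ln (t : R).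
  near=> t; apply: ln_gt0; near: t; apply: nbhs_pinfty_gt; exact: num_real.
have h0 : n.+1`!%:R * (ln t)^-1 @[t --> +oo] --> (0 : R).
  rewrite -(mulr0 n.+1`!%:R); apply: cvgM; first exact: cvg_cst.
  exact: (gtr0_cvgV0 l0).2.
apply: (squeeze_cvgr _ (@cvg_cst _ (0 : R) _ _ _) h0).
near=> t; have t1 : 1 < t by near: t; apply: nbhs_pinfty_gt; exact: num_real.
have t0 : 0 < t by exact: lt_trans t1.
have lt0 : 0 < ln t by exact: ln_gt0.
rewrite divr_ge0 ?exprn_ge0 ?(ltW lt0) ?(ltW t0)//=.
by rewrite ler_pdivrMr// mulrAC ler_pdivlMr// ln_pow_le// ltW.
Unshelve. all: by end_near. Qed.

(** The derivative of $-2(\ln y)^k/y$. It has a closed integral and, as soon as $\ln y \ge 2k$,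
    dominates $(\ln y)^k/y^2$. *)
Definition log_tail k (y : R) : R :=
  2 * ((ln y ^+ k - k%:R * ln y ^+ k.-1) * y ^- 2).

Lemma log_tail_ge k (y : R) : 1 <= y -> 2 * k%:R + 1 <= ln y ->
  0 <= ln y ^+ k * y ^- 2 <= log_tail k y.
Proof.
move=> y1 ly; have l0 : 0 <= ln y by exact: ln_ge0.
have y2 : 0 <= y ^- 2 by rewrite invr_ge0 exprn_ge0// (le_trans _ y1).
rewrite mulr_ge0 ?exprn_ge0//= /log_tail mulrA ler_wpM2r//.
case: k ly => [|k] ly; first by rewrite mul0r expr0; lra.
have /= : 2 * k.+1%:R * ln y ^+ k <= ln y ^+ k.+1.
  by rewrite exprS ler_wpM2r ?exprn_ge0//; lra.
lra.
Qed.

Lemma integral_log_tail k (u : R) : 1 <= u -> 2 * k%:R + 1 <= ln u ->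
  mu.-integrable `[u, +oo[ (EFin \o log_tail k) /\
  \int[mu]_(y in `[u, +oo[) log_tail k y = 2 * (ln u ^+ k / u) /\
  (forall y, u <= y -> {for y, continuous (log_tail k)}).
Proof.
move=> u1 lu; have u0 : 0 < u by exact: lt_le_trans u1.
have tail0 (y : R) : u <= y -> 0 <= log_tail k y.
  move=> uy; have y0 : 0 < y := lt_le_trans u0 uy.
  have ly : 2 * k%:R + 1 <= ln y by rewrite (le_trans lu)// ler_ln ?posrE.
  by have /andP[a b] := log_tail_ge (le_trans u1 uy) ly; exact: le_trans b.
pose F (y : R) := - (2 * (ln y ^+ k * y^-1)).
have dF (y : R) : 0 < y -> is_derive y 1 F (log_tail k y).
  move=> y0; have dl := is_derive1_ln y0.
  have dX := is_deriveX k dl; rewrite exprfctE in dX.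
  have y0' : y != 0 by rewrite gt_eqF.
  have dV := @is_deriveV _ id y _ 1 y0' (is_derive_id y 1).
  have dd := is_deriveN (is_deriveM (is_derive_cst (2 : R) y 1) (is_deriveM dX dV)).
  apply: (is_derive_eq dd); rewrite /log_tail /GRing.scale /=.
  by move: (ln y ^+ k) (ln y ^+ k.-1) => a b; field.
have ct (y : R) : 0 < y -> {for y, continuous (log_tail k)}.
  move=> y0; have cl := continuous_ln y0.
  have cX n : ln r ^+ n @[r --> y] --> ln y ^+ n.
    elim: n => [|n IH].
      by rewrite expr0 (_ : (fun _ => _) = cst 1); [exact: cvg_cst|exact/funext].
    rewrite exprS (_ : (fun _ => _) = (fun r => ln r * ln r ^+ n)); first exact: cvgM.
    by apply/funext => r; rewrite exprS.
  apply: cvgM; first exact: cvg_cst.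
  apply: cvgM; first by apply: cvgB => //; apply: cvgM => //; exact: cvg_cst.
  apply: cvgV; first by rewrite expf_neq0// gt_eqF.
  by apply: (cvgM (f := id) (g := id)); exact: cvg_id.
have cw : {within `[u, +oo[, continuous (log_tail k)}.
  apply: continuous_in_subspaceT => y; rewrite inE/= in_itv/= andbT => uy.
  exact/ct/(lt_le_trans u0).
have I : (\int[mu]_(y in `[u, +oo[) (log_tail k y)%:E = (2 * (ln u ^+ k / u))%:E)%E.
  rewrite (ge0_continuous_FTC2y (F := F) (l := 0))//.
  - by rewrite -EFinB /F sub0r opprK.
  - rewrite -oppr0; apply: cvgN; rewrite -(mulr0 2); apply: cvgM; first exact: cvg_cst.
    exact: cvg_ln_pow_div.
  - by move=> y uy; have [] := dF y (lt_trans u0 uy).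
  - apply: cvg_at_right_filter; have [d _] := dF u u0.
    exact/differentiable_continuous/derivable1_diffP.
  - move=> y; rewrite in_itv/= andbT => uy; have [_ e] := dF y (lt_trans u0 uy).
    by rewrite derive1E.
have m : measurable_fun `[u, +oo[ (log_tail k).
  by apply: subspace_continuous_measurable_fun.
split; last first.
  by split; [rewrite /Rintegral I|move=> y uy; apply: ct; exact: lt_le_trans uy].
apply/integrableP; split; first exact/measurable_EFinP.
rewrite [ltLHS](_ : _ = \int[mu]_(y in `[u, +oo[) (log_tail k y)%:E)%E; first by rewrite I ltry.
apply: eq_integral => y; rewrite inE/= in_itv/= andbT => uy.
by rewrite ger0_norm ?tail0.
Qed.

(** The majorant is the sum of three restrictions, the left tail being the reflected right one. They
    overlap at $\pm u$, which is harmless because all three are nonnegative. *)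
Lemma cint_three (f : R -> R[i]) (u : R) (B b : R -> R) : 0 < u -> ccont f ->
  mu.-integrable `[- u, u] (EFin \o B) ->
  (forall y, - u <= y <= u -> cabs (f y) <= B y) ->
  mu.-integrable `[u, +oo[ (EFin \o b) -> (forall y, u <= y -> {for y, continuous b}) ->
  (forall y, u <= y -> 0 <= b y) ->
  (forall y, u <= `|y| -> cabs (f y) <= b `|y|) ->
  cintegrable mu setT f /\ cabs (cint mu setT f) <=
    2 * (\int[mu]_(y in `[- u, u]) B y + 2 * \int[mu]_(y in `[u, +oo[) b y).
Proof.
move=> u0 cf iB fB ib cb b0 fb.
have cbN : {within `]-oo, - u], continuous (b \o -%R)}.
  apply: continuous_in_subspaceT => y; rewrite inE/= in_itv/= => yu.
  apply: continuous_comp; first exact: opp_continuous.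
  by apply: cb; lra.
have sub : (\int[mu]_(y in `]-oo, (- u)%R]) ((b \o -%R) y)%:E = \int[mu]_(y in `[u, +oo[) (b y)%:E)%E.
  rewrite ge0_integration_by_substitutionNy//.
    by apply: eq_integral => y _ /=; rewrite opprK.
  by move=> y; rewrite in_itv/= => yu; apply: b0; lra.
have ibN : mu.-integrable `]-oo, (- u)] (EFin \o (b \o -%R)).
  apply/integrableP; split.
    by apply/measurable_EFinP; apply: subspace_continuous_measurable_fun.
  rewrite [ltLHS](_ : _ = \int[mu]_(y in `]-oo, (- u)%R]) ((b \o -%R) y)%:E)%E.
    rewrite sub; have : (\int[mu]_(y in `[u, +oo[) (b y)%:E)%E \is a fin_num.
      exact: (integrable_fin_num _ ib).
    by rewrite fin_numElt => /andP[].
  apply: eq_integral => y; rewrite inE/= in_itv/= => yu.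
  by rewrite ger0_norm//; apply: b0; lra.
pose B1 := B \_ `[- u, u]; pose B2 := b \_ `[u, +oo[; pose B3 := (b \o -%R) \_ `]-oo, - u].
have i1 : mu.-integrable setT (EFin \o B1).
  by move: iB; rewrite integrable_mkcond// -restrict_EFin.
have i2 : mu.-integrable setT (EFin \o B2).
  by move: ib; rewrite integrable_mkcond// -restrict_EFin.
have i3 : mu.-integrable setT (EFin \o B3).
  by move: ibN; rewrite integrable_mkcond// -restrict_EFin.
have i23 : mu.-integrable setT (EFin \o (fun y => B2 y + B3 y)).
  exact: (integrableD measurableT i2 i3).
have i123 : mu.-integrable setT (EFin \o (fun y => B1 y + (B2 y + B3 y))).
  exact: (integrableD measurableT i1 i23).
have p1 y : 0 <= B1 y.
  rewrite /B1 patchE; case: ifPn => //; rewrite inE/= in_itv/= => yu.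
  exact: le_trans (cabs_ge0 _) (fB _ yu).
have p2 y : 0 <= B2 y.
  by rewrite /B2 patchE; case: ifPn => //; rewrite inE/= in_itv/= andbT => yu; exact: b0.
have p3 y : 0 <= B3 y.
  by rewrite /B3 patchE; case: ifPn => //; rewrite inE/= in_itv/= => yu; apply: b0; lra.
have dom y : cabs (f y) <= B1 y + (B2 y + B3 y).
  have [uy|yu] := leP u y.
    have e : B2 y = b y by rewrite /B2 patchE mem_set//= in_itv/= uy.
    have := fb y; rewrite ger0_norm ?(le_trans (ltW u0) uy)// => /(_ uy).
    by have := p1 y; have := p3 y; rewrite e; lra.
  have [uy|yu'] := leP y (- u).
    have e : B3 y = b (- y) by rewrite /B3 patchE mem_set//= in_itv/= uy.
    have y0 : y <= 0 by lra.
    have := fb y; rewrite ler0_norm// => /(_ _).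
    by have := p1 y; have := p2 y; rewrite e => ? ? /(_ ltac:(lra)); lra.
  have e : B1 y = B y by rewrite /B1 patchE mem_set//= in_itv/= !ltW.
  have yb : - u <= y <= u by rewrite !ltW.
  have := fB y yb.
  by have := p2 y; have := p3 y; rewrite e; lra.
have ci : cintegrable mu setT f.
  by apply: cintegrable_le i123 _ => //; exact: ccont_meas.
split => //; apply: (le_trans (cabs_cint_le _ ci i123 _)) => //.
rewrite RintegralD// RintegralD// -!Rintegral_mkcond.
have -> : \int[mu]_(y in `]-oo, - u]) (b \o -%R) y = \int[mu]_(y in `[u, +oo[) b y.
  by rewrite /Rintegral -sub.
by rewrite -[X in _ <= _ * (_ + X)]/(2 * _) [2 * \int[mu]_(y in _) b y]mulr_natl mulr2n.
Qed.

End log_tail.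

(** * The coefficients *)

Section inverse_gamma_coefficients.
Context {R : realType}.
Variables (c : R) (c0 : 0 < c).
Local Notation mu := (@lebesgue_measure R).
Local Notation s y := (c +i* y).

(** The factor 4 is two tails times the factor 2 in [log_tail]. *)
Lemma cint_log_tail k (f : R -> R[i]) (u C : R) (B : R -> R) :
  1 <= u -> 2 * k%:R + 1 <= ln u -> 0 <= C -> ccont f ->
  mu.-integrable `[- u, u] (EFin \o B) ->
  (forall y, - u <= y <= u -> cabs (f y) <= B y) ->
  (forall y, u <= `|y| -> cabs (f y) <= C * (ln `|y| ^+ k * `|y| ^- 2)) ->
  cintegrable mu setT f /\ cabs (cint mu setT f) <=
    2 * (\int[mu]_(y in `[- u, u]) B y + 4 * C * (ln u ^+ k / u)).
Proof.
move=> u1 lu C0 cf iB fB fC; have u0 : 0 < u by exact: lt_le_trans u1.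
have [iT [IT cT]] := integral_log_tail u1 lu.
have ln_u y : u <= y -> 1 <= y /\ 2 * k%:R + 1 <= ln y.
  move=> uy; have y0 : 0 < y := lt_le_trans u0 uy.
  by rewrite (le_trans u1 uy) (le_trans lu)// ler_ln ?posrE.
have iCT : mu.-integrable `[u, +oo[ (EFin \o (fun y => C * log_tail k y)).
  by apply: (integrableZl _ C iT).
have cCT y : u <= y -> {for y, continuous (fun y => C * log_tail k y)}.
  by move=> uy; apply: cvgM; [exact: cvg_cst|exact: cT].
have tail y : u <= y -> 0 <= ln y ^+ k * y ^- 2 <= log_tail k y.
  by move=> /ln_u[y1 ly]; exact: log_tail_ge.
have CT0 y : u <= y -> 0 <= C * log_tail k y.
  by move=> /tail/andP[p q]; rewrite mulr_ge0// (le_trans p).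
have CTb y : u <= `|y| -> cabs (f y) <= C * log_tail k `|y|.
  move=> uy; apply: (le_trans (fC y uy)); rewrite ler_wpM2l//.
  by have /andP[] := tail _ uy.
have [ci cb] := cint_three u0 cf iB fB iCT cCT CT0 CTb.
split => //; apply: (le_trans cb); rewrite RintegralZl// IT.
by rewrite le_eqVlt; apply/orP; left; apply/eqP; ring.
Qed.

Definition ell (y : R) : R[i] := logc (s y) + euler_gamma%:C.

(** The terms come from $c \le |s| \le (1+c)(1+|y|)$, from an argument of modulus below $\pi$, and
    from $\gamma$. *)
Definition ellK : R := `|ln c| + ln (1 + c) + pi + `|euler_gamma|.

Lemma ellK_ge0 : 0 <= ellK.
Proof.
have l1 : 0 <= ln (1 + c) by rewrite ln_ge0// lerDl ltW.
have := normr_ge0 (ln c); have := pi_ge0 R; have := normr_ge0 (@euler_gamma R).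
by rewrite /ellK; lra.
Qed.

Lemma cabs_ell (y : R) : cabs (ell y) <= ellK + ln (1 + `|y|).
Proof.
apply: (le_trans (cabsD _ _)); rewrite cabs_real.
have s0 : 0 < cabs (s y) by rewrite cabs_gt0 line_neq0.
have up : ln (cabs (s y)) <= ln (1 + c) + ln (1 + `|y|).
  rewrite -lnM ?posrE ?ltr_pwDl// ?(ltW c0)// ler_ln ?posrE//; last first.
    by rewrite mulr_gt0// ltr_pwDl// ltW.
  apply: (le_trans (cabs_le_ReIm _)); rewrite /= gtr0_norm//.
  have : 0 <= c * `|y| by rewrite mulr_ge0// ltW.
  by lra.
have lo : ln c <= ln (cabs (s y)) by rewrite ler_ln ?posrE// cabs_line_ge.
have l1 : 0 <= ln (1 + c) by rewrite ln_ge0// lerDl ltW.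
have l2 : 0 <= ln (1 + `|y|) by rewrite ln_ge0// lerDl.
have : cabs (logc (s y)) <= (`|ln c| + ln (1 + c) + ln (1 + `|y|)) + pi.
  apply: (le_trans (cabs_le_ReIm _)); apply: lerD.
    rewrite -[Re (logc (s y))]/(ln (cabs (s y))).
    rewrite ler_norml; apply/andP; split.
      by have := ler_norm (- ln c); rewrite normrN; lra.
    by have := normr_ge0 (ln c); lra.
  rewrite -[Im (logc (s y))]/(atan (y / c)).
  rewrite ler_norml; have := atan_gtNpi2 (y / c); have := atan_ltpi2 (y / c).
  by have := pi_ge0 R; move=> *; apply/andP; split; lra.
by rewrite /ellK; lra.
Qed.

Lemma ln_1D (y : R) : 2 <= y -> ln (1 + y) <= 2 * ln y.
Proof.
move=> y2; have y0 : 0 < y by lra.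
rewrite mulr_natl -lnXn// ler_ln ?posrE ?exprn_gt0//; last by lra.
by have : 2 * y <= y * y by [rewrite ler_wpM2r// ltW]; rewrite expr2; lra.
Qed.

Lemma cderiv_ell (y : R) : cderiv ell y ((0 +i* 1) / s y).
Proof.
have p : 0 < Re (s y) by [].
apply: cderiv_eq (cderivD (cderiv_logc p (cderiv_line c y)) (cderiv_cst _ y)) _.
by rewrite addr0.
Qed.

Lemma ccontX (f : R -> R[i]) n : ccont f -> ccont (fun y => f y ^+ n).
Proof.
move=> cf; elim: n => [|n IH]; first by under eq_fun do rewrite expr0; exact: ccont_cst.
by under eq_fun do rewrite exprS; exact: ccontM.
Qed.

Lemma ccont_ell : ccont ell.
Proof. by apply: cderiv_ccont => y; eexists; exact: cderiv_ell. Qed.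

Lemma ccont_exp_line : ccont (fun y => expc (s y) * s y ^- 2).
Proof.
apply: ccontM; last by apply: cderiv_ccont => y; eexists; exact: cderiv_lineV.
by apply: cderiv_ccont => y; eexists; apply: cderiv_expc; exact: cderiv_line.
Qed.

Lemma cabs_exp_line (y : R) : cabs (expc (s y) * s y ^- 2) = expR c * (cabs (s y) ^+ 2)^-1.
Proof. by rewrite cabsM cabs_expc cabsV cabsX. Qed.

Lemma cabs_line_V2 (y : R) : y != 0 -> (cabs (s y) ^+ 2)^-1 <= `|y| ^- 2.
Proof.
move=> y0; rewrite lef_pV2 ?posrE ?exprn_gt0 ?normr_gt0 ?cabs_gt0 ?line_neq0//.
by rewrite lerXn2r ?nnegrE ?cabs_ge0// cabs_line_geN.
Qed.

(* Integrand of C_j after one integration by parts, up to the factor i. *)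
Definition ibp_integrand j (y : R) : R[i] :=
  expc (s y) * s y ^- 2 * (ell y ^+ j - j%:R * ell y ^+ j.-1).

Local Notation m := ibp_integrand.

Lemma ccont_ibp j : ccont (m j).
Proof.
apply: ccontM; first exact: ccont_exp_line.
apply: ccontD; first exact/ccontX/ccont_ell.
by apply: ccontN; apply: ccontM; [exact: ccont_cst|exact/ccontX/ccont_ell].
Qed.

Lemma cintegrable_ibp j : cintegrable mu setT (m j).
Proof.
(* The least threshold that [cint_log_tail] accepts; below it the modulus of the function serves as
   its own majorant. *)
pose u : R := expR (2 * j%:R + 1).
have u2 : 2 <= u.
  apply: (le_trans _ (expR_ge1Dx _)); have : 0 <= j%:R :> R by []; lra.
have u1 : 1 <= u by lra.
have u0 : 0 < u by lra.
have lu : ln u = 2 * j%:R + 1 by rewrite /u expRK.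
have cm : ccont (m j) by exact: ccont_ibp.
have ib : mu.-integrable `[- u, u] (EFin \o (fun y => cabs (m j y))).
  apply: cintegrable_cabs => //; split; apply: continuous_compact_integrable;
    do ?exact: segment_compact; apply: continuous_subspaceT; by case: cm.
have C0 : 0 <= expR c * ((1 + j%:R) * (ellK + 2) ^+ j).
  apply: mulr_ge0; first exact: expR_ge0.
  by apply: mulr_ge0; [rewrite addr_ge0|rewrite exprn_ge0// addr_ge0// ellK_ge0].
have [] := @cint_log_tail j (m j) u _ _ u1 _ C0 cm ib => //; first by rewrite lu.
move=> y uy; have y2 : 2 <= `|y| by exact: le_trans uy.
have y0 : y != 0 by rewrite -normr_gt0; lra.
have ly1 : 1 <= ln `|y|.
  apply: (@le_trans _ _ (ln u)); last by rewrite ler_ln ?posrE//; lra.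
  by rewrite lu; have : 0 <= j%:R :> R by []; lra.
pose La := (ellK + 2) * ln `|y|.
have K2 : 1 <= ellK + 2 by have := ellK_ge0; lra.
have La1 : 1 <= La by rewrite -[leLHS]mulr1 ler_pM.
have La0 : 0 <= La by lra.
have eL : cabs (ell y) <= La.
  apply: (le_trans (cabs_ell y)); have := ln_1D y2.
  have : ellK <= ellK * ln `|y| by rewrite ler_peMr ?ellK_ge0.
  have -> : La = ellK * ln `|y| + 2 * ln `|y| by rewrite /La; ring.
  by move=> *; lra.
rewrite /m cabsM cabs_exp_line.
have br : cabs (ell y ^+ j - j%:R * ell y ^+ j.-1) <= (1 + j%:R) * La ^+ j.
  apply: (le_trans (cabsB _ _)); rewrite cabsM !cabsX cabs_nat mulrDl mul1r lerD//.
    by rewrite lerXn2r ?nnegrE ?cabs_ge0.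
  rewrite ler_wpM2l// (@le_trans _ _ (La ^+ j.-1))//.
    by rewrite lerXn2r ?nnegrE ?cabs_ge0.
  by rewrite ler_weXn2l// leq_pred.
have -> : expR c * ((1 + j%:R) * (ellK + 2) ^+ j) * (ln `|y| ^+ j * `|y| ^- 2) =
    expR c * `|y| ^- 2 * ((1 + j%:R) * La ^+ j).
  by rewrite /La exprMn; move: (_ ^+ j) (ln _ ^+ j) (_ ^- 2) => *; ring.
apply: ler_pM; rewrite ?cabs_ge0 ?mulr_ge0 ?expR_ge0 ?invr_ge0 ?exprn_ge0 ?cabs_ge0//.
by rewrite ler_wpM2l ?expR_ge0 ?cabs_line_V2.
Qed.

(** The boundary term of the integration by parts. *)
Let F j y : R[i] := expc (s y) * s y ^- 1 * ell y ^+ j.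

Let dF j y : cderiv (F j) y (C_integrand j (s y) * (0 +i* 1) - (0 +i* 1) * m j y).
Proof.
have s0 := line_neq0 c0 y.
have d1 : cderiv (fun y => expc (s y)) y (expc (s y) * (0 +i* 1)).
  by apply: cderiv_expc; exact: cderiv_line.
apply: cderiv_eq (cderivM (cderivM d1 (cderiv_lineV c0 1 y)) (cderivX j (cderiv_ell y))) _.
rewrite /C_integrand /m -/(ell y).
by move: (ell y ^+ j) (ell y ^+ j.-1) (expc _) => a b e; rewrite !expr1; field.
Qed.

(** The boundary term is $O((\ln T)^j/T)$ at $\pm T$. This yields convergence of the truncations
    although the original integrand has no absolutely convergent majorant of this kind. *)
Let F_small j : cabs (F j T - F j (- T)) @[T --> +oo] --> (0 : R).
Proof.
pose K := 2 * (expR c * (ellK + 2) ^+ j).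
have h0 : K * (ln T ^+ j / T) @[T --> +oo] --> (0 : R).
  rewrite -(mulr0 K); apply: cvgM; first exact: cvg_cst.
  exact: cvg_ln_pow_div.
apply: (squeeze_cvgr _ (@cvg_cst _ (0 : R) _ _ _) h0).
near=> T; have T3 : expR 1 <= T by near: T; apply: nbhs_pinfty_ge; exact: num_real.
have T2 : 2 <= T by apply: (le_trans _ T3); have := expR_ge1Dx (1 : R); lra.
have T0 : 0 < T by lra.
have lT : 1 <= ln T by rewrite -[leLHS](@expRK R) ler_ln ?posrE ?expR_gt0.
rewrite cabs_ge0 andTb (le_trans (cabsB _ _))//.
have b y : `|y| = T -> cabs (F j y) <= expR c * (ellK + 2) ^+ j * (ln T ^+ j / T).
  move=> yT; rewrite /F !cabsM cabs_expc cabsV expr1 cabsX.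
  have -> : expR c * (ellK + 2) ^+ j * (ln T ^+ j / T) =
    expR c * T^-1 * ((ellK + 2) * ln T) ^+ j.
    by rewrite exprMn; move: (_ ^+ j) (ln _ ^+ j) => *; ring.
  have K0 := ellK_ge0.
  apply: ler_pM; rewrite ?mulr_ge0 ?expR_ge0 ?exprn_ge0 ?invr_ge0 ?cabs_ge0//.
    rewrite ler_wpM2l ?expR_ge0// lef_pV2 ?posrE ?cabs_gt0 ?line_neq0//.
    by rewrite -yT cabs_line_geN.
  apply: lerXn2r; rewrite ?nnegrE ?cabs_ge0//.
    by apply: mulr_ge0; lra.
  apply: (le_trans (cabs_ell y)); rewrite yT; have := ln_1D T2.
  have : ellK <= ellK * ln T by rewrite ler_peMr.
  have -> : (ellK + 2) * ln T = ellK * ln T + 2 * ln T by ring.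
  by move=> *; lra.
rewrite /K -mulrA mulr_natl mulr2n lerD// b// ?normrN gtr0_norm//.
Unshelve. all: by end_near. Qed.

Lemma C_truncated_lim j :
  cabs (C_truncated j c T - (0 +i* 1) * cint mu setT (m j)) @[T --> +oo] --> (0 : R).
Proof.
have h0 : (cabs (F j T - F j (- T)) +
    cabs (cint mu (setT `&` `[- T, T]%classic) (m j) - cint mu setT (m j))) @[T --> +oo] --> (0 : R).
  rewrite -(addr0 0); apply: cvgD; first exact: F_small.
  exact: (cint_truncation measurableT (cintegrable_ibp j)).
apply: (squeeze_cvgr _ (@cvg_cst _ (0 : R) _ _ _) h0).
near=> T; have T0 : 0 < T by near: T; apply: nbhs_pinfty_gt; exact: num_real.
rewrite cabs_ge0 andTb setTI.
have im : cintegrable mu `[- T, T] (m j).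
  by apply: (cintegrableS measurableT _ _ (cintegrable_ibp j)).
have ci : ccont (fun y => C_integrand j (s y) * (0 +i* 1)).
  apply: ccontM; last exact: ccont_cst.
  apply: ccontM; last exact/ccontX/ccont_ell.
  apply: ccontM; first by apply: cderiv_ccont => y; eexists; apply: cderiv_expc; exact: cderiv_line.
  by apply: cderiv_ccont => y; eexists; exact: cderivV (line_neq0 c0 y) (cderiv_line c y).
have cF : ccont (fun y => C_integrand j (s y) * (0 +i* 1) - (0 +i* 1) * m j y).
  by apply: ccontD => //; apply: ccontN; apply: ccontM; [exact: ccont_cst|exact: ccont_ibp].
have iC : cintegrable mu `[- T, T] (fun y => C_integrand j (s y) * (0 +i* 1)).
  by split; apply: continuous_compact_integrable; do ?exact: segment_compact;
    apply: continuous_subspaceT; case: ci.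
have TT : - T < T by lra.
have := cFTC TT (dF j) cF; rewrite cintB//; last exact: cintegrableZ.
rewrite cintZ// => e.
have -> : C_truncated j c T - (0 +i* 1) * cint mu setT (m j) =
    (F j T - F j (- T)) + (0 +i* 1) * (cint mu `[- T, T] (m j) - cint mu setT (m j)).
  rewrite -e -[C_truncated j c T]/(cint mu `[- T, T] (fun y => C_integrand j (s y) * (0 +i* 1))).
  by ring.
apply: (le_trans (cabsD _ _)); rewrite cabsM.
have -> : cabs (0 +i* 1 : R[i]) = 1 by rewrite /= expr0n add0r expr1n sqrtr1.
by rewrite mul1r.
Unshelve. all: by end_near. Qed.

Lemma cabs_cvg (f : R -> R[i]^o) (l : R[i]^o) :
  cabs (f T - l) @[T --> +oo] --> (0 : R) -> f T @[T --> +oo] --> l.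
Proof.
move=> fl; apply/cvgrPdistC_lt => e e0.
(* A positive element of [R[i]] is real, because the order only compares numbers with equal
   imaginary parts. *)
have eR : e = (Re e)%:C by move: e0; rewrite ltcE /= => /andP[/eqP ei _]; apply: complex_ext.
have e0' : 0 < Re e by move: e0; rewrite ltcE => /andP[].
move/cvgr0Pnorm_lt : fl => /(_ _ e0'); apply: filterS => T.
by rewrite ger0_norm ?cabs_ge0// => h; rewrite eR normcE ltcR.
Qed.

Lemma cvg_C_truncated j : cvg (C_truncated j c T @[T --> +oo]).
Proof. by apply/cvg_ex; eexists; apply: cabs_cvg; exact: C_truncated_lim. Qed.

Lemma C_coefE j : C_coef j c = j`!%:R^-1 * ((2 * pi)^-1)%:C * cint mu setT (m j).
Proof.
have e := cvg_lim (@norm_hausdorff _ _) (cabs_cvg (C_truncated_lim j)).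
have i0 : (0 +i* 1 : R[i]) != 0 by apply/eqP => -[/eqP]; rewrite oner_eq0.
have gen (a p i v : R[i]) : i != 0 -> a * (p * i)^-1 * (i * v) = a * p^-1 * v.
  by move=> ?; rewrite invfM -!mulrA; congr (a * (p^-1 * _)); rewrite mulrA mulVf// mul1r.
by rewrite /C_coef e gen// fmorphV rmorphM rmorph_nat.
Qed.

End inverse_gamma_coefficients.

(** * Asymptotics *)

(** The map $l^j \mapsto l^j - j\,l^{j-1}$ is $1 - d/dl$; applied to the binomial expansion of $(x -
    l)^k$ it gives the right-hand side. *)
Lemma sum_binomial_ibp (F : comPzRingType) (x l : F) k :
  \sum_(j < k.+1) 'C(k, j)%:R * (-1) ^+ j * (l ^+ j - j%:R * l ^+ j.-1) * x ^+ (k - j) =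
  (x - l) ^+ k + k%:R * (x - l) ^+ k.-1.
Proof.
have bn n : (x - l) ^+ n = \sum_(j < n.+1) 'C(n, j)%:R * (-1) ^+ j * l ^+ j * x ^+ (n - j).
  by rewrite exprBn; apply: eq_bigr => j _; rewrite -mulr_natl; ring.
transitivity (\sum_(j < k.+1) 'C(k, j)%:R * (-1) ^+ j * l ^+ j * x ^+ (k - j) +
    \sum_(j < k.+1) (- ('C(k, j)%:R * (-1) ^+ j * j%:R * l ^+ j.-1 * x ^+ (k - j)))).
  by rewrite -big_split/=; apply: eq_bigr => j _; ring.
rewrite -bn; congr (_ + _); rewrite big_ord_recl/= mulr0 !mul0r oppr0 add0r.
case: k => [|k]; first by rewrite big_ord0 mul0r.
rewrite /= bn mulr_sumr; apply: eq_bigr => j _; rewrite /bump leq0n add1n subSS /=.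
have e : j.+1%:R * 'C(k.+1, j.+1)%:R = k.+1%:R * 'C(k, j)%:R :> F.
  by rewrite -!natrM mul_bin_diag.
rewrite exprS !mulrA -e; move: ('C(_, _)%:R) (j.+1%:R) => a b; ring.
Qed.

(** * The integral of $1/|s|$ along a vertical segment *)

Section inverse_norm_integral.
Context {R : realType}.
Variables (c : R) (c0 : 0 < c).
Local Notation mu := (@lebesgue_measure R).
Local Notation s y := (c +i* y).

(** A primitive is $\ln(y + |s|)$. Its value at $-u$ is rewritten by $(-u+|s|)(u+|s|) = c^2$. *)
Lemma integral_line_norm (u : R) : 0 < u ->
  mu.-integrable `[- u, u] (EFin \o (fun y => (cabs (s y))^-1)) /\
  \int[mu]_(y in `[- u, u]) (cabs (s y))^-1 = 2 * ln (u + cabs (s u)) - 2 * ln c.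
Proof.
move=> u0; pose N (y : R) := c * c + y * y.
have N0 y : 0 < N y by rewrite ltr_pwDl ?mulr_gt0// -expr2 sqr_ge0.
have nE y : cabs (s y) = Num.sqrt (N y) by rewrite /= !expr2.
have s0 y : 0 < cabs (s y) by rewrite cabs_gt0 line_neq0.
have dN (y : R) : is_derive y 1 N (2 * y).
  have dd := is_deriveD (is_derive_cst (c * c) y 1)
    (is_deriveM (is_derive_id y 1) (is_derive_id y 1)).
  by apply: (is_derive_eq dd); rewrite /GRing.scale /=; ring.
have ds (y : R) : is_derive y 1 (fun y => cabs (s y)) (y / cabs (s y)).
  rewrite (_ : (fun _ => _) = Num.sqrt \o N); last by apply/funext => r; exact: nE.
  have d1 : is_derive y 1 (Num.sqrt \o N) ((2 * Num.sqrt (N y))^-1 * (2 * y)).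
    by apply: (@is_derive1_comp _ Num.sqrt N); exact: is_derive1_sqrt.
  by apply: (is_derive_eq d1); rewrite nE; field; rewrite -nE gt_eqF.
have ys0 (y : R) : 0 < y + cabs (s y).
  have : `|y| < cabs (s y).
    rewrite nE -sqrtr_sqr ltr_sqrt ?N0// /N -expr2 ltrDr mulr_gt0//.
  by rewrite ltr_norml => /andP[]; lra.
have dF (y : R) : is_derive y 1 (fun y => ln (y + cabs (s y))) (cabs (s y))^-1.
  have d1 := is_deriveD (is_derive_id y 1) (ds y).
  have d2 : is_derive y 1 (@ln R \o (fun y => y + cabs (s y)))
      ((y + cabs (s y))^-1 * (1 + y / cabs (s y))).
    by apply: (@is_derive1_comp _ (@ln R) (fun y => y + cabs (s y))); exact: is_derive1_ln.
  apply: (is_derive_eq d2); move: (s0 y) (ys0 y); move: (cabs _) => S S0 yS.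
  by field; rewrite !gt_eqF.
have cs : continuous (fun y => (cabs (s y))^-1).
  move=> y; apply: cvgV; first by rewrite gt_eqF.
  have [d _] := ds y.
  have : {for y, continuous (fun y => cabs (s y))}.
    exact/differentiable_continuous/derivable1_diffP.
  exact.
have cF : ccont (fun y => ((cabs (s y))^-1)%:C) by split => // y; exact: cvg_cst.
have uu : - u < u by lra.
have dC (y : R) : cderiv (fun y => (ln (y + cabs (s y)))%:C) y ((cabs (s y))^-1)%:C.
  by split; [exact: dF|exact: is_derive_cst].
split.
  by apply: continuous_compact_integrable; [exact: segment_compact|exact: continuous_subspaceT].
have := congr1 (@complex.Re R) (cFTC uu dC cF); rewrite /= => ->.
have sN : cabs (s (- u)) = cabs (s u) by rewrite /= sqrrN.
have prod : (- u + cabs (s u)) * (u + cabs (s u)) = c * c.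
  have -> : (- u + cabs (s u)) * (u + cabs (s u)) = cabs (s u) ^+ 2 - u * u by ring.
  by rewrite nE sqr_sqrtr ?(ltW (N0 u))// /N addrK.
have := congr1 (@ln R) prod.
have pN : 0 < - u + cabs (s u) by rewrite -sN ys0.
rewrite lnM ?posrE// lnM ?posrE// -[Num.sqrt (c ^+ 2 + (- u) ^+ 2)]/(cabs (s (- u))) sN.
rewrite -[Num.sqrt (c ^+ 2 + u ^+ 2)]/(cabs (s u)).
by move: (ln (- u + _)) (ln (u + _)) (ln c) => p q r; lra.
Qed.

End inverse_norm_integral.

(** * Error estimate for $I_k$ and transfer to $L_k$ *)

Section asymptotics.
Context {R : realType}.
Variables (c : R) (c0 : 0 < c).
Local Notation mu := (@lebesgue_measure R).
Local Notation s y := (c +i* y).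

Definition main_term k (u : R) : R[i] :=
  \sum_(j < k.+1) 'C(k, j)%:R * D_coef j c * (ln u ^+ (k - j))%:C.

Let L u y : R[i] := (ln u)%:C - ell c y.

Let E u y := E1 (s y * (u^-1)%:C).

Let ccont_L u : ccont (L u).
Proof. by apply: ccontD; [exact: ccont_cst|exact/ccontN/ccont_ell]. Qed.

Let L_integrand k u y := expc (s y) * s y ^- 2 * (L u y ^+ k + k%:R * L u y ^+ k.-1).

Let main_termE k u : cintegrable mu setT (L_integrand k u) /\
  cint mu setT (L_integrand k u) = (2 * pi)%:C * main_term k u.
Proof.
pose a j : R[i] := 'C(k, j)%:R * (-1) ^+ j * (ln u ^+ (k - j))%:C.
have e y : L_integrand k u y = \sum_(j < k.+1) a j * ibp_integrand c j y.
  rewrite /L_integrand -sum_binomial_ibp mulr_sumr; apply: eq_bigr => j _.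
  by rewrite /a /ibp_integrand rmorphXn /=; ring.
have ia j : cintegrable mu setT (fun y => a j * ibp_integrand c j y).
  by apply: cintegrableZ => //; exact: cintegrable_ibp.
have [eq1 int1] := @cint_sum _ _ _ mu setT k.+1 (fun j y => a j * ibp_integrand c j y) measurableT ia.
split; first by apply: (eq_cintegrable _ _ int1) => // y _; rewrite e.
rewrite (@eq_cint _ _ _ mu setT _ _ (fun y _ => e y)) eq1 /main_term mulr_sumr.
apply: eq_bigr => j _; rewrite cintZ//; last exact: cintegrable_ibp.
have p0 : ((2 * pi)%:C : R[i]) != 0.
  by apply/eqP => -[/eqP]; rewrite gt_eqF// mulr_gt0// pi_gt0.
have f0 : (j`!%:R : R[i]) != 0 by rewrite pnatr_eq0 -lt0n fact_gt0.
have PV : ((2 * pi)^-1%:C : R[i]) = ((2 * pi)%:C)^-1 by rewrite fmorphV.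
rewrite /D_coef C_coefE// PV /a.
move: ((-1) ^+ j) => e1; move: (cint _ _ _) ((ln u ^+ _)%:C) ('C(_, _)%:R) => V l b.
move: ((2 * pi)%:C) (j`!%:R) p0 f0 => P f P0 f0; field.
by rewrite P0 f0.
Qed.

Let D k u y := expc (s y) * s y ^- 2 *
  ((E u y ^+ k + k%:R * E u y ^+ k.-1 * expc (- (s y * (u^-1)%:C))) -
   (L u y ^+ k + k%:R * L u y ^+ k.-1)).

Let ccont_D k u : 0 < u -> ccont (D k u).
Proof.
move=> u0; have cE := ccont_E1_line c0 u0.
apply: ccontM; first exact: ccont_exp_line.
apply: ccontD.
  apply: ccontD; first exact: ccontX.
  apply: ccontM; first by apply: ccontM; [exact: ccont_cst|exact: ccontX].
  apply: cderiv_ccont => y; eexists; apply: cderiv_expc.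
  apply: cderiv_ext (cderiv_id (- (c * u^-1)%:C) (- (0 +i* u^-1)) y) => r.
  by apply: complex_ext; rewrite !reimE /=; ring.
apply: ccontN; apply: ccontD; first by apply: ccontX; exact: ccont_L.
by apply: ccontM; [exact: ccont_cst|apply: ccontX; exact: ccont_L].
Qed.

Let cint_D k u : 0 < u -> cintegrable mu setT (D k u) ->
  cint mu setT (D k u) = (2 * pi)%:C * ((dickmanI k u)%:C - main_term k u).
Proof.
move=> u0 iD; have [iL eL] := main_termE k u.
have e : (2 * pi)%:C * (dickmanI k u)%:C = (2 * pi * dickmanI k u)%:C :> R[i].
  by rewrite -rmorphM.
rewrite mulrBr -eL e (contour_I c0 u0) -cintB//.
  by apply: eq_cint => y _; rewrite /D mulrBr.
have iDL := cintegrableD measurableT iD iL.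
apply: (eq_cintegrable _ _ iDL) => // y _; rewrite /D /L_integrand -/(E u y).
by rewrite -mulrDr subrK.
Qed.

(** Since $\log(s/u) = \log s - \ln u$, the difference is exactly $\Psi(s/u) + \gamma$. *)
Let EL_dist u y : 0 < u -> cabs (E u y - L u y) <= 5 * (cabs (s y) / u).
Proof.
move=> u0; have v0 : 0 < u^-1 by rewrite invr_gt0.
have sv : s y * (u^-1)%:C = (c * u^-1) +i* (y * u^-1).
  by apply: complex_ext; rewrite !reimE /=; ring.
have lE : logc (s y * (u^-1)%:C) = logc (s y) - (ln u)%:C.
  rewrite sv; apply: complex_ext; rewrite ?ReD ?ReN ?ImD ?ImN /=.
    have -> : (c / u) ^+ 2 + (y / u) ^+ 2 = (c ^+ 2 + y ^+ 2) * (u^-1) ^+ 2.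
      by rewrite !exprMn; ring.
    rewrite sqrtrM ?addr_ge0 ?sqr_ge0// sqrtr_sqr gtr0_norm// lnM ?posrE ?lnV ?posrE//.
    by rewrite sqrtr_gt0 ltr_wpDr ?sqr_ge0 ?exprn_gt0.
  by rewrite oppr0 addr0; congr atan; field; rewrite !gt_eqF.
have -> : E u y - L u y = Psi ((c * u^-1) +i* (y * u^-1)) + euler_gamma%:C.
  by rewrite -sv /Psi lE /E /L /ell; ring.
apply: (le_trans (Psi_gamma _ (mulr_gt0 c0 v0))).
by rewrite -sv cabsM cabs_real gtr0_norm.
Qed.

(** The first summand comes from $E^{m+1} - L^{m+1}$. The second comes from $(m+1)(E^m e^{-s/u} -
    L^m)$, with $5m$ for the powers and 2 for $|1 - e^{-s/u}| \le 2|s|/u$. *)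
Let const k : R := 5 * k.+1%:R + k.+1%:R * (5 * k%:R + 2).

(** Cancellation replaces one factor [La] by $|s|/u$; with the weight $|s|^{-2}$ this leaves
    $1/(u|s|)$. *)
Let bracket_near m u y (La : R) : 0 < u -> 1 <= La ->
  cabs (E u y) <= La -> cabs (L u y) <= La ->
  cabs (D m.+1 u y) <= expR c * const m * La ^+ m * (u^-1 * (cabs (s y))^-1).
Proof.
move=> u0 La1 EL LL; have La0 : 0 <= La by lra.
have v0 : 0 < u^-1 by rewrite invr_gt0.
have s0 : 0 < cabs (s y) by rewrite cabs_gt0 line_neq0.
have d := EL_dist y u0; set q := cabs (s y) / u in d.
have q0 : 0 <= q by rewrite mulr_ge0 ?ltW.
set z := s y * (u^-1)%:C.
have z0 : 0 <= Re z by rewrite /z ReM /= mulr0 subr0 mulr_ge0 ?ltW.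
have ez : cabs (1 - expc (- z)) <= 2 * q.
  apply: (le_trans (cabs_1Bexpc z0)).
  by rewrite /z cabsM cabs_real gtr0_norm.
have ez1 : cabs (expc (- z)) <= 1.
  by rewrite cabs_expc ReN -(@expR0 R) ler_expR oppr_le0.
have Lm0 n : 0 <= La ^+ n by exact: exprn_ge0.
have b1 : cabs (E u y ^+ m.+1 - L u y ^+ m.+1) <= 5 * m.+1%:R * La ^+ m * q.
  apply: (le_trans (cabs_powB m EL LL)).
  apply: (le_trans (ler_wpM2l _ d)); first by rewrite mulr_ge0.
  by rewrite le_eqVlt; apply/orP; left; apply/eqP; ring.
have b2 : cabs (E u y ^+ m - L u y ^+ m) <= 5 * m%:R * La ^+ m * q.
  case: m {b1} => [|n]; first by rewrite !expr0 subrr cabs0 mulr0 !mul0r.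
  apply: (le_trans (cabs_powB n EL LL)).
  apply: (le_trans (ler_wpM2l _ d)); first by rewrite mulr_ge0.
  have : n.+1%:R * La ^+ n * (5 * q) <= n.+1%:R * La ^+ n.+1 * (5 * q).
    apply: ler_wpM2r; first by rewrite mulr_ge0.
    by apply: ler_wpM2l => //; exact: ler_weXn2l.
  move=> h; apply: (le_trans h).
  by rewrite le_eqVlt; apply/orP; left; apply/eqP; ring.
have b3 : cabs (E u y ^+ m * expc (- z) - L u y ^+ m) <= (5 * m%:R + 2) * La ^+ m * q.
  have -> : E u y ^+ m * expc (- z) - L u y ^+ m =
     (E u y ^+ m - L u y ^+ m) * expc (- z) - L u y ^+ m * (1 - expc (- z)) by ring.
  apply: (le_trans (cabsB _ _)); rewrite !cabsM.
  have t1 : cabs (E u y ^+ m - L u y ^+ m) * cabs (expc (- z)) <= 5 * m%:R * La ^+ m * q.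
    by apply: le_trans b2; rewrite ler_piMr ?cabs_ge0.
  have t2 : cabs (L u y ^+ m) * cabs (1 - expc (- z)) <= La ^+ m * (2 * q).
    apply: ler_pM; rewrite ?cabs_ge0// cabsX.
    by apply: lerXn2r; rewrite ?nnegrE ?cabs_ge0.
  apply: (le_trans (lerD t1 t2)).
  by rewrite le_eqVlt; apply/orP; left; apply/eqP; ring.
have br : cabs ((E u y ^+ m.+1 + m.+1%:R * E u y ^+ m * expc (- z)) -
    (L u y ^+ m.+1 + m.+1%:R * L u y ^+ m)) <= const m * La ^+ m * q.
  have -> : (E u y ^+ m.+1 + m.+1%:R * E u y ^+ m * expc (- z)) -
    (L u y ^+ m.+1 + m.+1%:R * L u y ^+ m) = (E u y ^+ m.+1 - L u y ^+ m.+1) +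
     m.+1%:R * (E u y ^+ m * expc (- z) - L u y ^+ m) by ring.
  apply: (le_trans (cabsD _ _)); rewrite [cabs (m.+1%:R * _)]cabsM cabs_nat.
  have t : m.+1%:R * cabs (E u y ^+ m * expc (- z) - L u y ^+ m) <=
      m.+1%:R * ((5 * m%:R + 2) * La ^+ m * q) by rewrite ler_wpM2l.
  apply: (le_trans (lerD b1 t)).
  by rewrite /const le_eqVlt; apply/orP; left; apply/eqP; ring.
rewrite /D cabsM cabs_exp_line.
apply: (le_trans (ler_wpM2l _ br)).
  by rewrite mulr_ge0 ?expR_ge0// invr_ge0 exprn_ge0// cabs_ge0.
rewrite le_eqVlt; apply/orP; left; apply/eqP; rewrite /q.
move: s0; move: (cabs (s y)) (La ^+ m) (const m) => S l k S0.
by field; rewrite !gt_eqF.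
Qed.

(** No cancellation: all powers of [E] and [L] are bounded separately and the decay $|s|^{-2}$ is
    kept. *)
Let bracket_far m u y (La : R) : 0 < u -> 1 <= La ->
  cabs (E u y) <= La -> cabs (L u y) <= La ->
  cabs (D m.+1 u y) <= expR c * (2 + 2 * m.+1%:R) * La ^+ m.+1 * (cabs (s y) ^+ 2)^-1.
Proof.
move=> u0 La1 EL LL; have La0 : 0 <= La by lra.
have ez1 : cabs (expc (- (s y * (u^-1)%:C))) <= 1.
  rewrite cabs_expc ReN -(@expR0 R) ler_expR oppr_le0 ReM /= mulr0 subr0.
  by apply: mulr_ge0; [exact: ltW|rewrite invr_ge0 ltW].
have p (w : R[i]) n : cabs w <= La -> cabs (w ^+ n) <= La ^+ n.
  by move=> wL; rewrite cabsX; apply: lerXn2r; rewrite ?nnegrE ?cabs_ge0.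
have up : La ^+ m <= La ^+ m.+1 by rewrite ler_weXn2l.
have q (w : R[i]) : cabs w <= La -> cabs (m.+1%:R * w ^+ m) <= m.+1%:R * La ^+ m.+1.
  by move=> wL; rewrite cabsM cabs_nat ler_wpM2l// (le_trans (p _ _ wL)).
rewrite /D cabsM cabs_exp_line /=.
have br : cabs (E u y ^+ m.+1 + m.+1%:R * E u y ^+ m * expc (- (s y * (u^-1)%:C)) -
    (L u y ^+ m.+1 + m.+1%:R * L u y ^+ m)) <= (2 + 2 * m.+1%:R) * La ^+ m.+1.
  apply: (le_trans (cabsB _ _)).
  have t1 : cabs (E u y ^+ m.+1 + m.+1%:R * E u y ^+ m * expc (- (s y * (u^-1)%:C))) <=
      La ^+ m.+1 + m.+1%:R * La ^+ m.+1.
    apply: (le_trans (cabsD _ _)); apply: lerD; first exact: p.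
    by rewrite cabsM (le_trans _ (q _ EL))// ler_piMr ?cabs_ge0.
  have t2 : cabs (L u y ^+ m.+1 + m.+1%:R * L u y ^+ m) <= La ^+ m.+1 + m.+1%:R * La ^+ m.+1.
    by apply: (le_trans (cabsD _ _)); apply: lerD; [exact: p|exact: q].
  apply: (le_trans (lerD t1 t2)).
  by rewrite le_eqVlt; apply/orP; left; apply/eqP; ring.
apply: (le_trans (ler_wpM2l _ br)).
  by rewrite mulr_ge0 ?expR_ge0// invr_ge0 exprn_ge0// cabs_ge0.
by rewrite le_eqVlt; apply/orP; left; apply/eqP; ring.
Qed.

(** A common factor for both bounds in [EL_le]: $|L| \le 3l + \mathrm{ellK}$ and $|E| \le 2l + 2(c +
    |\ln c| + |\gamma|)$. The scale $l$ is $\ln u$ on the central segment and $\ln|y|$ on the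
    tails. *)
Let K : R := 4 + ellK c + 2 * (c + `|ln c| + `|euler_gamma|).

Let K1 : 1 <= K.
Proof.
have := ellK_ge0 c0; have := normr_ge0 (ln c); have := normr_ge0 (@euler_gamma R).
by rewrite /K; move: c0; lra.
Qed.

Let EL_le u y (l : R) : 1 <= u -> ln u <= l -> 1 <= l -> ln (1 + `|y|) <= 2 * l ->
  cabs (E u y) <= K * l /\ cabs (L u y) <= K * l.
Proof.
move=> u1 ul l1 yl; have u0 : 0 < u by lra.
have lu0 : 0 <= ln u by exact: ln_ge0.
have e0 := ellK_ge0 c0; have n1 := normr_ge0 (ln c); have n2 := normr_ge0 (@euler_gamma R).
have a1 : ellK c <= ellK c * l by rewrite ler_peMr.
have a2 : c + `|ln c| + `|euler_gamma| <= (c + `|ln c| + `|euler_gamma|) * l.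
  by rewrite ler_peMr// !addr_ge0// ltW.
have -> : K * l = 4 * l + ellK c * l + 2 * ((c + `|ln c| + `|euler_gamma|) * l).
  by rewrite /K; ring.
have c00 : 0 <= c by rewrite ltW.
split.
  apply: (le_trans (cabs_E1_line c0 u0 y)).
  rewrite ln_div ?posrE//.
  have cu : c / u <= c by rewrite ler_pdivrMr// ler_peMr.
  have := ler_norm (- ln c); have := ler_norm (- @euler_gamma R); rewrite !normrN.
  lra.
apply: (le_trans (cabsB _ _)); rewrite cabs_real ger0_norm//.
have := cabs_ell c0 y; lra.
Qed.

Lemma dickmanI_bound k : exists M A : R, 0 <= M /\ 1 <= A /\ forall u, A <= u ->
  cabs ((dickmanI k u)%:C - main_term k u) <= M * (ln u ^+ k / u).
Proof.
have pi1 : 1 <= 2 * (pi : R) by have := pi_ge2 R; lra.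
(* The factor $2\pi \ge 1$ is simply dropped. *)
have from_D u (X : R) : 0 < u -> cintegrable mu setT (D k u) ->
    cabs (cint mu setT (D k u)) <= X ->
    cabs ((dickmanI k u)%:C - main_term k u) <= X.
  move=> u0 iD; rewrite cint_D// cabsM cabs_real ger0_norm; last by lra.
  by apply: le_trans; rewrite ler_peMl ?cabs_ge0.
case: k from_D => [|m] from_D.
  (* For $k = 0$ the integrand [D] vanishes identically, so there is no error at all. *)
  exists 0, 1; split=> //; split=> // u u1; have u0 : 0 < u by lra.
  have Dz y : 0 * L_integrand 0 u y = D 0 u y.
    by rewrite /D !expr0 !mul0r subrr mulr0.
  have [iL _] := main_termE 0 u.
  have iZ := cintegrableZ 0 measurableT iL.
  have iD : cintegrable mu setT (D 0 u) by apply: (eq_cintegrable _ _ iZ).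
  rewrite mul0r; apply: from_D => //.
  by rewrite -(@eq_cint _ _ _ mu setT _ _ (fun y _ => Dz y)) cintZ// mul0r cabs0.
pose k := m.+1.
pose C1 := expR c * const m * K ^+ m.
pose C2 := expR c * (2 + 2 * k%:R) * K ^+ k.
(* Bounds $\int_{-u}^{u} dy/|s| \le K_2 \ln u$, from $u + |c + iu| \le (2+c)u$ and $\ln u \ge 1$. *)
pose K2 := 2 + 2 * ln (2 + c) + 2 * `|ln c|.
have K0 : 0 <= K by have := K1; lra.
have const0 : 0 <= const m.
  by apply: addr_ge0; apply: mulr_ge0 => //; apply: addr_ge0 => //; exact: mulr_ge0.
have C10 : 0 <= C1.
  by apply: mulr_ge0; [apply: mulr_ge0 => //; exact: expR_ge0|exact: exprn_ge0].
have k20 : 0 <= 2 + 2 * k%:R :> R by apply: addr_ge0 => //; exact: mulr_ge0.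
have C20 : 0 <= C2.
  by apply: mulr_ge0; [apply: mulr_ge0 => //; exact: expR_ge0|exact: exprn_ge0].
have lc0 : 0 <= ln (2 + c) by rewrite ln_ge0//; move: c0; lra.
have K20 : 0 <= K2 by rewrite /K2; have := normr_ge0 (ln c); lra.
(* The central segment contributes $C_1K_2$ and the tails $4C_2$, both doubled by the componentwise
   modulus estimate. The threshold is the one required by [log_tail]. *)
exists (2 * (C1 * K2 + 4 * C2)), (expR (2 * k%:R + 1)); split.
  by apply: mulr_ge0 => //; apply: addr_ge0; apply: mulr_ge0.
have A2 : 2 <= expR (2 * k%:R + 1) :> R.
  apply: (le_trans _ (expR_ge1Dx _)); have : 0 <= k%:R :> R by []; lra.
split; first by lra.
move=> u Au; have u2 : 2 <= u by exact: le_trans Au.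
have u1 : 1 <= u by lra.
have u0 : 0 < u by lra.
have lu : 2 * k%:R + 1 <= ln u by rewrite -[leLHS](@expRK R) ler_ln ?posrE ?expR_gt0.
have k0 : 0 <= k%:R :> R by [].
have lu1 : 1 <= ln u by lra.
have v0 : 0 < u^-1 by rewrite invr_gt0.
have lu0 : 0 <= ln u by lra.
have [iN IN] := integral_line_norm c0 u0.
pose B y := C1 * ln u ^+ m * u^-1 * (cabs (s y))^-1.
have iB : mu.-integrable `[- u, u] (EFin \o B) by apply: (integrableZl _ _ iN).
have DB y : - u <= y <= u -> cabs (D k u y) <= B y.
  rewrite -ler_norml => yu.
  have l2 : ln (1 + `|y|) <= 2 * ln u.
    have yn := normr_ge0 y.
    by apply: le_trans (ln_1D u2); rewrite ler_ln ?posrE; lra.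
  have [EK LK] := EL_le u1 (lexx _) lu1 l2.
  have La1 : 1 <= K * ln u by rewrite -[leLHS]mulr1 ler_pM.
  apply: (le_trans (bracket_near m u0 La1 EK LK)).
  rewrite /B /C1 exprMn le_eqVlt; apply/orP; left; apply/eqP.
  by move: (cabs _)^-1 (K ^+ m) (ln u ^+ m) => *; ring.
have Dfar y : u <= `|y| -> cabs (D k u y) <= C2 * (ln `|y| ^+ k * `|y| ^- 2).
  move=> uy; have y2 : 2 <= `|y| by exact: le_trans uy.
  have luy : ln u <= ln `|y| by rewrite ler_ln ?posrE//; lra.
  have ly1 : 1 <= ln `|y| by lra.
  have [EK LK] := EL_le u1 luy ly1 (ln_1D y2).
  have La1 : 1 <= K * ln `|y| by rewrite -[leLHS]mulr1 ler_pM.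
  apply: (le_trans (bracket_far m u0 La1 EK LK)).
  have -> : C2 * (ln `|y| ^+ k * `|y| ^- 2) =
      expR c * (2 + 2 * k%:R) * (K * ln `|y|) ^+ k * `|y| ^- 2.
    by rewrite /C2 exprMn; move: (K ^+ k) (ln _ ^+ k) (_ ^- 2) => *; ring.
  apply: ler_wpM2l; last by apply: cabs_line_V2 => //; rewrite -normr_gt0; lra.
  by rewrite !mulr_ge0 ?expR_ge0 ?addr_ge0 ?exprn_ge0 ?mulr_ge0//; lra.
have [iD bD] := cint_log_tail u1 lu C20 (ccont_D k u0) iB DB Dfar.
apply: from_D => //; apply: (le_trans bD); rewrite -[leRHS]mulrA ler_pM2l//.
have -> : (C1 * K2 + 4 * C2) * (ln u ^+ k / u) =
    C1 * ln u ^+ m * u^-1 * (K2 * ln u) + 4 * C2 * (ln u ^+ k / u).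
  by rewrite /k exprS; move: (ln u ^+ m) => p; ring.
rewrite lerD2r RintegralZl// IN ler_wpM2l//.
  by rewrite !mulr_ge0 ?exprn_ge0 ?(ltW v0).
have s0 : 0 < u + cabs (s u) by rewrite ltr_wpDr ?cabs_ge0.
have : ln (u + cabs (s u)) <= ln (2 + c) + ln u.
  rewrite -lnM ?posrE//; last by move: c0; lra.
  rewrite ler_ln ?posrE//; last by rewrite mulr_gt0//; move: c0; lra.
  have := cabs_le_ReIm (s u); rewrite -[Re (s u)]/c -[Im (s u)]/u !gtr0_norm//.
  have : c <= c * u by rewrite ler_peMr// ltW.
  by lra.
have := ler_norm (- ln c); rewrite normrN.
have : `|ln c| <= `|ln c| * ln u by rewrite ler_peMr.
have : ln (2 + c) <= ln (2 + c) * ln u by rewrite ler_peMr.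
have -> : K2 * ln u = 2 * ln u + 2 * (ln (2 + c) * ln u) + 2 * (`|ln c| * ln u).
  by rewrite /K2; ring.
by move: (ln (2 + c) * _) (`|ln c| * _) => *; lra.
Qed.

(** An exact rescaling: $\ln(1/t) = -\ln t$ supplies $(-1)^{k-j}$, which cancels the signs in $D_j$
    and $L_k$, and the binomial coefficient absorbs the factorials. *)
Lemma dickmanL_main k (t : R) : 0 < t ->
  (dickmanL k t)%:C - \sum_(j < k.+1) C_coef j c * (ln t ^+ (k - j) / (k - j)`!%:R)%:C =
  ((-1) ^+ k / k`!%:R)%:C * ((dickmanI k t^-1)%:C - main_term k t^-1).
Proof.
move=> t0; rewrite mulrBr -rmorphM; congr (_ - _); rewrite /main_term mulr_sumr.
apply: eq_bigr => j _; have jk : (j <= k)%N by rewrite -ltnS.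
have ff : (k`!%:R : R[i]) = 'C(k, j)%:R * (j`!%:R * (k - j)`!%:R).
  by rewrite -!natrM bin_fact.
have n0 n : (n`!%:R : R[i]) != 0 by rewrite pnatr_eq0 -lt0n fact_gt0.
have b0 : ('C(k, j)%:R : R[i]) != 0 by rewrite pnatr_eq0 -lt0n bin_gt0.
have e1 : ((-1) ^+ k / k`!%:R)%:C = (-1) ^+ k / k`!%:R :> R[i].
  by rewrite rmorphM fmorphV rmorphXn rmorphN1 rmorph_nat.
have e2 n : (ln t^-1 ^+ n)%:C = (-1) ^+ n * (ln t)%:C ^+ n :> R[i].
  by rewrite lnV ?posrE// (exprNn (ln t)) rmorphM !rmorphXn rmorphN1.
have e3 n : (ln t ^+ n / n`!%:R)%:C = (ln t)%:C ^+ n / n`!%:R :> R[i].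
  by rewrite rmorphM fmorphV rmorphXn rmorph_nat.
rewrite /D_coef e1 e2 e3 ff.
have sg : (-1) ^+ k * (-1) ^+ j * (-1) ^+ (k - j) = 1 :> R[i].
  by rewrite -!exprD -addnA subnKC// addnn -mul2n exprM sqrrN expr1n expr1n.
have -> : (-1) ^+ k / ('C(k, j)%:R * (j`!%:R * (k - j)`!%:R)) *
   ('C(k, j)%:R * ((-1) ^+ j * j`!%:R * C_coef j c) *
      ((-1) ^+ (k - j) * (ln t)%:C ^+ (k - j))) =
   ((-1) ^+ k * (-1) ^+ j * (-1) ^+ (k - j)) *
   (C_coef j c * ((ln t)%:C ^+ (k - j) / (k - j)`!%:R)).
  move: (C_coef _ _) ((ln t)%:C ^+ _) ((-1) ^+ k) ((-1) ^+ j) ((-1) ^+ (k - j)) => *.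
  move: ('C(_, _)%:R) (j`!%:R) ((k - j)`!%:R) b0 (n0 j) (n0 (k - j)%N) => b f g b0 f0 g0.
  by field; rewrite b0 f0 g0.
by rewrite sg mul1r.
Qed.

End asymptotics.

Theorem theorem1 (R : realType) (k : nat) (c : R) (hc : 0 < c) :
  [/\ forall j, cvg (C_truncated j c T @[T --> +oo]),
      exists M : R, \forall u \near +oo,
        `|(dickmanI k u)%:C -
          \sum_(j < k.+1) 'C(k, j)%:R * D_coef j c * (ln u ^+ (k - j))%:C|
        <= (M * (ln u ^+ k / u))%:C &
      exists M : R, \forall t \near 0^'+,
        `|(dickmanL k t)%:C -
          \sum_(j < k.+1) C_coef j c * (ln t ^+ (k - j) / (k - j)`!%:R)%:C|
        <= (M * (t * `|ln t| ^+ k))%:C].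
Proof.
have [M [A [M0 [A1 H]]]] := dickmanI_bound hc k.
split; first by move=> j; exact: cvg_C_truncated.
  exists M; near=> u; rewrite normcE lecR; apply: H.
  by near: u; apply: nbhs_pinfty_ge; exact: num_real.
(* The constant for $I_k$ times $|(-1)^k/k!|$; the condition $t \le 1/A$ places $1/t$ in the range
   where that bound holds. *)
exists (k`!%:R^-1 * M); near=> t.
have t0 : 0 < t by near: t; exact: nbhs_right_gt.
have tA : t <= A^-1 by near: t; apply: nbhs_right_le; rewrite invr_gt0; lra.
have f0 : 0 <= k`!%:R^-1 :> R by rewrite invr_ge0.
have A0 : 0 < A by lra.
have At : A <= t^-1 by rewrite -[A]invrK lef_pV2 ?posrE ?invr_gt0.
rewrite dickmanL_main// normcE lecR cabsM cabs_real normrM normrX normrN1 expr1n mul1r.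
rewrite ger0_norm// -mulrA ler_wpM2l//.
have lt0 : ln t <= 0.
  by apply: ln_le0; rewrite (le_trans tA)// invf_le1.
by have := H _ At; rewrite lnV ?posrE// invrK ler0_norm// [t * _]mulrC.
Unshelve. all: by end_near. Qed.
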